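(* Let $f,g$ satisfy the standing assumption (a)–(f) of the context, let $\boldsymbol{x}_0\in\mathbb{R}^{d_x}$, $\epsilon>0$, $\Delta=\varphi(\boldsymbol{x}_0)-\varphi^*$ and $R=\max\{\|\boldsymbol{y}^*(\boldsymbol{x}_0)\|,\|\boldsymbol{y}_\lambda^*(\boldsymbol{x}_0)\|\}$. Run the FSBA algorithm of the context with $M\ge\bar\rho$, $M=\Omega(\bar\rho)$, $T=\Theta\big((\varphi(\boldsymbol{x}_0)-\varphi^* )\sqrt{M}\,\epsilon^{-3/2}\big)$, $\kappa_1=\kappa$, $\ell_1=\ell$, $\kappa_2=3\kappa$, $\ell_2=(1+\lambda)\ell$, $$\lambda=\max\Big\{\frac{\bar\ell\kappa^2}{\Delta},\frac{\bar\ell\kappa^3}{\epsilon},\frac{\bar\ell\kappa^5}{\sqrt{M\epsilon}}\Big\},\qquad \tilde\epsilon=\min\Big\{\frac{C_g\epsilon}{4\lambda\ell},\frac{C_H\sqrt{M\epsilon}}{2C_2}\Big\},\quad C_g=\tfrac1{192},\ C_H=\tfrac1{48},$$ and $$K_t^1=K_t^2=\begin{cases}\Big\lceil 2\sqrt{\kappa_2}\,\log\Big(\frac{\sqrt{\kappa_2+1}}{\tilde\epsilon}R\Big)\Big\rceil, & t=0,\\[2mm] \Big\lceil 2\sqrt{\kappa_2}\,\log\Big(\frac{\sqrt{\kappa_2+1}}{\tilde\epsilon}\big(\tilde\epsilon+4\kappa\|\boldsymbol{s}^*_{t-1}\|\big)\Big)\Big\rceil, & t\ge1.\end{cases}$$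 Then the output $\hat{\boldsymbol{x}}$ is an $\big(\mathcal{O}(\epsilon),\mathcal{O}(\kappa^{2.5}\bar\ell^{0.5}\epsilon^{0.5})\big)$-second-order stationary point of $\varphi$. In addition, the first-order and second-order oracle complexities are bounded by $\tilde{\mathcal{O}}(\kappa^3\bar\ell^{0.5}\epsilon^{-1.5})$ and $\mathcal{O}(\kappa^{2.5}\bar\ell^{0.5}\epsilon^{-1.5})$, respectively.
   Context: **Problem.** $f,g:\mathbb{R}^{d_x}\times\mathbb{R}^{d_y}\to\mathbb{R}$; $\boldsymbol{y}^*(\boldsymbol{x})=\arg\min_{\boldsymbol{y}}g(\boldsymbol{x},\boldsymbol{y})$, $\varphi(\boldsymbol{x})=f(\boldsymbol{x},\boldsymbol{y}^*(\boldsymbol{x}))$, to be minimized over $\boldsymbol{x}$. **Standing assumption.** (a) $g$ is three times differentiable and $\mu$-strongly convex in $\boldsymbol{y}$ for each fixed $\boldsymbol{x}$; (b) $f$ is twice differentiable and $C$-Lipschitz in $(\boldsymbol{x},\boldsymbol{y})$; (c) $\nabla f,\nabla g$ are $\ell$-Lipschitz; (d) $\nabla^2f,\nabla^2g$ are $\rho$-Lipschitz; (e) the third-order derivative of $g$ is $\nu$-Lipschitz; (f) $\varphi^*:=\min_{\boldsymbol{x}}\varphi(\boldsymbol{x})>-\infty$. Put $\bar\ell=\max\{C,\ell,\nu,\rho\}$ and $\kappa=\bar\ell/\mu$. Norms are Euclidean/spectral. **Penalty function.** $\mathcal{L}_\lambda(\boldsymbol{x},\boldsymbol{y})=f(\boldsymbol{x},\boldsymbol{y})+\lambda\big(g(\boldsymbol{x},\boldsymbol{y})-g(\boldsymbol{x},\boldsymbol{y}^*(\boldsymbol{x}))\big)$,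 $\boldsymbol{y}_\lambda^*(\boldsymbol{x})=\arg\min_{\boldsymbol{y}}\mathcal{L}_\lambda(\boldsymbol{x},\boldsymbol{y})$, $\mathcal{L}_\lambda^*(\boldsymbol{x})=\mathcal{L}_\lambda(\boldsymbol{x},\boldsymbol{y}_\lambda^*(\boldsymbol{x}))$. The blocks used below are $\nabla_{xy}^2\mathcal{L}_\lambda=\nabla_{xy}^2f+\lambda\nabla_{xy}^2g$, $\nabla_{yy}^2\mathcal{L}_\lambda=\nabla_{yy}^2f+\lambda\nabla_{yy}^2g$, $\nabla^2_{yx}\mathcal{L}_\lambda=(\nabla^2_{xy}\mathcal{L}_\lambda)^\top$. For $\lambda\ge2\ell/\mu$ it is known that $\mathcal{L}_\lambda(\boldsymbol{x},\cdot)$ is $(\lambda\mu/2)$-strongly convex and $(1+\lambda)\ell$-smooth and that $\nabla^2\mathcal{L}_\lambda^*$ is $\bar\rho$-Lipschitz with $\bar\rho=\mathcal{O}(\bar\ell\kappa^5)$; this is the $\bar\rho$ used in the claim. **Estimators.** $\mathbf{g}(\boldsymbol{x};\boldsymbol{y},\boldsymbol{w})=\nabla_xf(\boldsymbol{x},\boldsymbol{y})+\lambda(\nabla_xg(\boldsymbol{x},\boldsymbol{y})-\nabla_xg(\boldsymbol{x},\boldsymbol{w}))$, $\mathbf{H}(\boldsymbol{x};\boldsymbol{y},\boldsymbol{w})=\nabla_{xx}^2f(\boldsymbol{x},\boldsymbol{y})+\lambda(\nabla_{xx}^2g(\boldsymbol{x},\boldsymbol{y})-\nabla_{xx}^2g(\boldsymbol{x},\boldsymbol{w}))-\nabla_{xy}^2\mathcal{L}_\lambda(\boldsymbol{x},\boldsymbol{y})[\nabla_{yy}^2\mathcal{L}_\lambda(\boldsymbol{x},\boldsymbol{y})]^{-1}\nabla_{yx}^2\mathcal{L}_\lambda(\boldsymbol{x},\boldsymbol{y})+\lambda\nabla_{xy}^2g(\boldsymbol{x},\boldsymbol{w})[\nabla_{yy}^2g(\boldsymbol{x},\boldsymbol{w})]^{-1}\nabla_{yx}^2g(\boldsymbol{x},\boldsymbol{w})$.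 $C_2=\mathcal{O}(\lambda\bar\ell\kappa^2)$ is the coefficient of $\|\boldsymbol{y}-\boldsymbol{y}_\lambda^*(\boldsymbol{x})\|$ in the bound for $\|\nabla^2\mathcal{L}_\lambda^*(\boldsymbol{x})-\mathbf{H}(\boldsymbol{x};\boldsymbol{y},\boldsymbol{w})\|$ in terms of $\|\boldsymbol{w}-\boldsymbol{y}^*(\boldsymbol{x})\|$ and $\|\boldsymbol{y}-\boldsymbol{y}_\lambda^*(\boldsymbol{x})\|$; explicitly $C_2=\rho+\lambda\rho+(\ell+\lambda\ell)\Big(\frac{4(\rho+\lambda\rho)}{\lambda\mu}+\frac{4(\rho+\lambda\rho)(\ell+\lambda\ell)}{\lambda^2\mu^2}\Big)$. **AGD**$(h,\boldsymbol{z}_0,K,\eta,\theta)$: set $\tilde{\boldsymbol{z}}_0=\boldsymbol{z}_0$; for $k=0,\dots,K-1$: $\boldsymbol{z}_{k+1}=\tilde{\boldsymbol{z}}_k-\eta\nabla h(\tilde{\boldsymbol{z}}_k)$, $\tilde{\boldsymbol{z}}_{k+1}=\boldsymbol{z}_{k+1}+\theta(\boldsymbol{z}_{k+1}-\boldsymbol{z}_k)$; return $\boldsymbol{z}_K$. **FSBA.** Input $\boldsymbol{x}_0$, $\boldsymbol{y}_{-1}=\boldsymbol{w}_{-1}=\mathbf{0}$. For $t=0,\dots,T-1$: $\boldsymbol{w}_t=\mathrm{AGD}(g(\boldsymbol{x}_t,\cdot),\boldsymbol{w}_{t-1},K_t^1,\frac1{\ell_1},\frac{\sqrt{\kappa_1}-1}{\sqrt{\kappa_1}+1})$;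 $\boldsymbol{y}_t=\mathrm{AGD}(\mathcal{L}_\lambda(\boldsymbol{x}_t,\cdot),\boldsymbol{y}_{t-1},K_t^2,\frac1{\ell_2},\frac{\sqrt{\kappa_2}-1}{\sqrt{\kappa_2}+1})$; $\mathbf{g}_t=\mathbf{g}(\boldsymbol{x}_t;\boldsymbol{y}_t,\boldsymbol{w}_t)$, $\mathbf{H}_t=\mathbf{H}(\boldsymbol{x}_t;\boldsymbol{y}_t,\boldsymbol{w}_t)$; $\boldsymbol{s}_t^*=\arg\min_{\boldsymbol{s}}\{\mathbf{g}_t^\top\boldsymbol{s}+\frac12\boldsymbol{s}^\top\mathbf{H}_t\boldsymbol{s}+\frac M6\|\boldsymbol{s}\|^3\}$; $\boldsymbol{x}_{t+1}=\boldsymbol{x}_t+\boldsymbol{s}_t^*$; stop if $\|\boldsymbol{s}_t^*\|\le\frac12\sqrt{\epsilon/M}$. Output $\hat{\boldsymbol{x}}=\boldsymbol{x}_{t+1}$ for the last $t$. **Terminology.** A point $\hat{\boldsymbol{x}}$ is an $(\epsilon,\tau)$-second-order stationary point of $\varphi$ if $\|\nabla\varphi(\hat{\boldsymbol{x}})\|\le\epsilon$ and $\lambda_{\min}(\nabla^2\varphi(\hat{\boldsymbol{x}}))\ge-\tau$. First-order (second-order) oracle complexity is the total number of evaluations of first partial gradients (second-derivative blocks) of $f$ and $g$. $\mathcal{O}$ hides absolute constants, $\Omega$ is a lower bound up to a constant factor, $\Theta$ both; $\tilde{\mathcal{O}}$ additionally hides polylogarithmic factors.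
   Formalization: Adds M=O(ℓ̄κ⁵) (for M→∞ the bounds fail), puts the factor Δ explicitly in both complexity bounds (false as Δ→∞ otherwise), and assumes λ≥2ℓ/μ, the regime where the context defines y*_λ and ρ̄; Δ, M, ρ>0 so that denominators are nonzero. *)

(* Defs.v *)
From mathcomp Require Import all_boot all_order all_algebra.
From mathcomp Require Import all_classical all_reals all_analysis.

Set Implicit Arguments.
Unset Strict Implicit.
Unset Printing Implicit Defensive.

Import Order.TTheory GRing.Theory Num.Theory.
Import numFieldNormedType.Exports.

Local Open Scope classical_set_scope.
Local Open Scope ring_scope.

(* Vectors are row vectors, as in the library's [jacobian]; a point (x, y) of
   R^dx * R^dy is [row_mx x y].  The library norm on matrices is the sup norm,
   which gives the same derivatives as the Euclidean one; every quantitative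
   bound below uses [enorm] and the operator norms built from it. *)

Definition dot (R : realType) n (u v : 'rV[R]_n) : R :=
  \sum_(i < n) u 0 i * v 0 i.

Definition enorm (R : realType) n (u : 'rV[R]_n) : R := Num.sqrt (dot u u).

Definition spectral_norm (R : realType) m n (A : 'M[R]_(m, n)) : R :=
  sup [set enorm (v *m A) | v in [set v | enorm v <= 1]].

(* For u |-> D^3 h(z)[u, ., .] this is the usual norm
   sup |D^3 h(z)[u, v, w]| over Euclidean unit balls. *)
Definition tensor_norm (R : realType) n (T : 'rV[R]_n -> 'M[R]_n) : R :=
  sup [set spectral_norm (T u) | u in [set u | enorm u <= 1]].

Definition lipschitz_for (R : realType) n (V : zmodType) (N : V -> R) (L : R)
    (F : 'rV[R]_n -> V) : Prop :=
  forall z z', N (F z - F z') <= L * enorm (z - z').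

Definition grad (R : realType) n (h : 'rV[R]_n -> R) (z : 'rV[R]_n) : 'rV[R]_n :=
  \row_i 'D_(delta_mx 0 i) h z.

(* Entry (i, j) is the i-th partial derivative of the j-th partial derivative. *)
Definition hess (R : realType) n (h : 'rV[R]_n -> R) (z : 'rV[R]_n) : 'M[R]_n :=
  jacobian (grad h) z.

Definition third (R : realType) n (h : 'rV[R]_n -> R) (z : 'rV[R]_n) :
    'rV[R]_n -> 'M[R]_n :=
  'd (hess h) z.

Definition twice_differentiable_at (R : realType) n (h : 'rV[R]_n -> R) z : Prop :=
  (\forall z' \near z, differentiable h z') /\ differentiable (grad h) z.

Definition thrice_differentiable_at (R : realType) n (h : 'rV[R]_n -> R) z : Prop :=
  (\forall z' \near z, twice_differentiable_at h z') /\ differentiable (hess h) z.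

Definition strongly_convex (R : realType) n (mu : R) (h : 'rV[R]_n -> R) : Prop :=
  forall (u v : 'rV[R]_n) (t : R), 0 <= t <= 1 ->
    h (t *: u + (1 - t) *: v) <=
      t * h u + (1 - t) * h v - mu / 2 * t * (1 - t) * enorm (u - v) ^+ 2.

Definition argmin (R : realType) n (h : 'rV[R]_n -> R) : set 'rV[R]_n :=
  [set z | forall z', h z <= h z'].

Definition lambda_min (R : realType) n (A : 'M[R]_n) : R :=
  inf [set a | eigenvalue A a].

Definition second_order_stationary (R : realType) n (h : 'rV[R]_n -> R)
    (eps tau : R) (z : 'rV[R]_n) : Prop :=
  [/\ twice_differentiable_at h z,
      enorm (grad h z) <= eps &
      - tau <= lambda_min (hess h z)].

Record bilevel (R : realType) (dx dy : nat) := Bilevel {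
  fobj : 'rV[R]_(dx + dy) -> R;
  gobj : 'rV[R]_(dx + dy) -> R;
  mu : R;
  lipf : R;
  ell : R;
  rho : R;
  nu : R
}.

Definition lbar (R : realType) dx dy (P : bilevel R dx dy) : R :=
  Num.max (Num.max (lipf P) (ell P)) (Num.max (nu P) (rho P)).

Definition kappa (R : realType) dx dy (P : bilevel R dx dy) : R := lbar P / mu P.

(* [xget 0] is only a total way to name the minimizer: under the standing
   assumption (and 2 ell / mu <= lambda for [ylstar]) it exists and is unique. *)
Definition ystar (R : realType) dx dy (P : bilevel R dx dy) (x : 'rV[R]_dx) :
    'rV[R]_dy :=
  xget 0 (argmin (fun y => gobj P (row_mx x y))).

Definition phi (R : realType) dx dy (P : bilevel R dx dy) (x : 'rV[R]_dx) : R :=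
  fobj P (row_mx x (ystar P x)).

Definition phistar (R : realType) dx dy (P : bilevel R dx dy) : R :=
  inf (range (phi P)).

(* The positivity of rho (as an upper bound it can always be enlarged) keeps the
   denominator [C2] below nonzero; that of ell and lbar follows when dy > 0. *)
Record standing_assumption (R : realType) dx dy (P : bilevel R dx dy) : Prop :=
  StandingAssumption {
    mu_gt0 : 0 < mu P;
    rho_gt0 : 0 < rho P;
    g_diff : forall z, thrice_differentiable_at (gobj P) z;
    g_sc : forall x, strongly_convex (mu P) (fun y => gobj P (row_mx x y));
    f_diff : forall z, twice_differentiable_at (fobj P) z;
    f_lip : lipschitz_for Num.norm (lipf P) (fobj P);
    gradf_lip : lipschitz_for (@enorm R _) (ell P) (grad (fobj P));
    gradg_lip : lipschitz_for (@enorm R _) (ell P) (grad (gobj P));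
    hessf_lip : lipschitz_for (@spectral_norm R _ _) (rho P) (hess (fobj P));
    hessg_lip : lipschitz_for (@spectral_norm R _ _) (rho P) (hess (gobj P));
    thirdg_lip : lipschitz_for (@tensor_norm R _) (nu P) (third (gobj P));
    phi_bounded : has_lbound (range (phi P))
  }.

Definition Lpen (R : realType) dx dy (P : bilevel R dx dy) (lambda : R)
    (x : 'rV[R]_dx) (y : 'rV[R]_dy) : R :=
  fobj P (row_mx x y)
  + lambda * (gobj P (row_mx x y) - gobj P (row_mx x (ystar P x))).

Definition ylstar (R : realType) dx dy (P : bilevel R dx dy) (lambda : R)
    (x : 'rV[R]_dx) : 'rV[R]_dy :=
  xget 0 (argmin (Lpen P lambda x)).

Definition Lstar (R : realType) dx dy (P : bilevel R dx dy) (lambda : R)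
    (x : 'rV[R]_dx) : R :=
  Lpen P lambda x (ylstar P lambda x).

Definition grad_x (R : realType) dx dy (h : 'rV[R]_(dx + dy) -> R)
    (x : 'rV[R]_dx) (y : 'rV[R]_dy) : 'rV[R]_dx :=
  lsubmx (grad h (row_mx x y)).

Definition hess_xx (R : realType) dx dy (h : 'rV[R]_(dx + dy) -> R)
    (x : 'rV[R]_dx) (y : 'rV[R]_dy) : 'M[R]_dx :=
  ulsubmx (hess h (row_mx x y)).

Definition hess_xy (R : realType) dx dy (h : 'rV[R]_(dx + dy) -> R)
    (x : 'rV[R]_dx) (y : 'rV[R]_dy) : 'M[R]_(dx, dy) :=
  ursubmx (hess h (row_mx x y)).

Definition hess_yy (R : realType) dx dy (h : 'rV[R]_(dx + dy) -> R)
    (x : 'rV[R]_dx) (y : 'rV[R]_dy) : 'M[R]_dy :=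
  drsubmx (hess h (row_mx x y)).

Definition hessL_xy (R : realType) dx dy (P : bilevel R dx dy) (lambda : R)
    (x : 'rV[R]_dx) (y : 'rV[R]_dy) : 'M[R]_(dx, dy) :=
  hess_xy (fobj P) x y + lambda *: hess_xy (gobj P) x y.

Definition hessL_yy (R : realType) dx dy (P : bilevel R dx dy) (lambda : R)
    (x : 'rV[R]_dx) (y : 'rV[R]_dy) : 'M[R]_dy :=
  hess_yy (fobj P) x y + lambda *: hess_yy (gobj P) x y.

Definition grad_est (R : realType) dx dy (P : bilevel R dx dy) (lambda : R)
    (x : 'rV[R]_dx) (y w : 'rV[R]_dy) : 'rV[R]_dx :=
  grad_x (fobj P) x y + lambda *: (grad_x (gobj P) x y - grad_x (gobj P) x w).

Definition hess_est (R : realType) dx dy (P : bilevel R dx dy) (lambda : R)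
    (x : 'rV[R]_dx) (y w : 'rV[R]_dy) : 'M[R]_dx :=
  hess_xx (fobj P) x y + lambda *: (hess_xx (gobj P) x y - hess_xx (gobj P) x w)
  - hessL_xy P lambda x y *m invmx (hessL_yy P lambda x y)
      *m (hessL_xy P lambda x y)^T
  + lambda *: (hess_xy (gobj P) x w *m invmx (hess_yy (gobj P) x w)
      *m (hess_xy (gobj P) x w)^T).

Definition C2 (R : realType) dx dy (P : bilevel R dx dy) (lambda : R) : R :=
  rho P + lambda * rho P
  + (ell P + lambda * ell P)
    * (4 * (rho P + lambda * rho P) / (lambda * mu P)
       + 4 * (rho P + lambda * rho P) * (ell P + lambda * ell P)
         / (lambda ^+ 2 * mu P ^+ 2)).

(* The state is the pair (z_k, ztilde_k). *)
Fixpoint agd_state (R : realType) n (h : 'rV[R]_n -> R) (z0 : 'rV[R]_n)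
    (eta theta : R) (k : nat) : 'rV[R]_n * 'rV[R]_n :=
  if k is k'.+1 then
    let: (z, zt) := agd_state h z0 eta theta k' in
    let z' := zt - eta *: grad h zt in (z', z' + theta *: (z' - z))
  else (z0, z0).

Definition AGD (R : realType) n (h : 'rV[R]_n -> R) (z0 : 'rV[R]_n) (K : nat)
    (eta theta : R) : 'rV[R]_n :=
  (agd_state h z0 eta theta K).1.

Definition momentum (R : realType) (k : R) : R := (Num.sqrt k - 1) / (Num.sqrt k + 1).

Definition cubic_model (R : realType) n (g : 'rV[R]_n) (H : 'M[R]_n) (M : R)
    (s : 'rV[R]_n) : R :=
  dot g s + 2^-1 * dot s (s *m H) + M / 6 * enorm s ^+ 3.

(* The term of index t - 1 of a sequence of vectors whose term of index -1 is 0. *)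
Definition prev_iterate (R : realType) n (u : nat -> 'rV[R]_n) (t : nat) : 'rV[R]_n :=
  if t is t'.+1 then u t' else 0.

(* [x], [w], [y], [s] are the iterates of an execution that performs exactly the
   iterations t < N, so that its output is [x N].  The minimizer of the cubic
   model need not be unique: any choice is an execution. *)
Record fsba_run (R : realType) dx dy (P : bilevel R dx dy) (x0 : 'rV[R]_dx)
    (lambda M eps kappa1 ell1 kappa2 ell2 : R) (T : nat) (K1 K2 : nat -> nat)
    (N : nat) (x : nat -> 'rV[R]_dx) (w y : nat -> 'rV[R]_dy)
    (s : nat -> 'rV[R]_dx) : Prop := FsbaRun {
  run_init : x 0%N = x0;
  run_w : forall t, (t < N)%N ->
    w t = AGD (fun v => gobj P (row_mx (x t) v)) (prev_iterate w t) (K1 t)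
              ell1^-1 (momentum kappa1);
  run_y : forall t, (t < N)%N ->
    y t = AGD (Lpen P lambda (x t)) (prev_iterate y t) (K2 t) ell2^-1 (momentum kappa2);
  run_s : forall t, (t < N)%N ->
    argmin (cubic_model (grad_est P lambda (x t) (y t) (w t))
                        (hess_est P lambda (x t) (y t) (w t)) M) (s t);
  run_x : forall t, (t < N)%N -> x t.+1 = x t + s t;
  run_length : (0 < N <= T)%N;
  run_continue : forall t, (t.+1 < N)%N ->
    ~ (enorm (s t) <= 2^-1 * Num.sqrt (eps / M));
  run_stop : N = T \/ enorm (s N.-1) <= 2^-1 * Num.sqrt (eps / M)
}.

(* An AGD step queries grad_y g once on g(x_t, .), and grad_y f and grad_y g on
   L_lambda(x_t, .); [grad_est] queries grad_x f at (x, y), and grad_x g at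
   (x, y) and at (x, w). *)
Definition first_order_calls (K1 K2 : nat -> nat) (N : nat) : nat :=
  \sum_(t < N) (K1 t + 2 * K2 t + 3).

(* [hess_est] queries the xx, xy and yy blocks of f at (x, y), and those of g at
   (x, y) and at (x, w). *)
Definition second_order_calls (N : nat) : nat := \sum_(t < N) 9.

Definition gap (R : realType) dx dy (P : bilevel R dx dy) (x0 : 'rV[R]_dx) : R :=
  phi P x0 - phistar P.

Definition init_radius (R : realType) dx dy (P : bilevel R dx dy) (lambda : R)
    (x0 : 'rV[R]_dx) : R :=
  Num.max (enorm (ystar P x0)) (enorm (ylstar P lambda x0)).

Definition eps_inner (R : realType) dx dy (P : bilevel R dx dy)
    (lambda M eps : R) : R :=
  Num.min (192^-1 * eps / (4 * lambda * ell P))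
          (48^-1 * Num.sqrt (M * eps) / (2 * C2 P lambda)).

(* A negative ceiling, i.e. a starting point that is already accurate enough,
   means no step. *)
Definition natceil (R : realType) (a : R) : nat := absz (Num.max 0 (Num.ceil a)).

Definition inner_steps (R : realType) dx dy (P : bilevel R dx dy)
    (x0 : 'rV[R]_dx) (lambda M eps kappa2 : R) (s : nat -> 'rV[R]_dx) (t : nat) :
    nat :=
  let et := eps_inner P lambda M eps in
  let d := if t is t'.+1 then et + 4 * kappa P * enorm (s t')
           else init_radius P lambda x0 in
  natceil (2 * Num.sqrt kappa2 * ln (Num.sqrt (kappa2 + 1) / et * d)).

(* Main.v *)
(* The penalty value is L* = Q* - lambda g*, where Q = f + lambda g and q* denotes the
   minimum of q over y.  For a function q that is strongly convex in y with minimizer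
   y*(x), let J = [I, -q_xy q_yy^-1] be the derivative of x |-> (x, y*(x)).  Then grad q*
   is the x-part of grad q, and hess q* = J (hess q) J^T is a Schur complement.  All
   derivatives involved are Lipschitz, so that differentiability is obtained from
   remainders bounded by C |u|^2.

   With delta = y_lambda* - y* = O(kappa / lambda) and v = f_y g_yy^-1, the optimality
   condition gives lambda delta + v = O(kappa^3 / lambda), while
   hess phi = J (hess f - D^3 g[(0, v)]) J^T.  Expanding hess g from y* to y_lambda* to
   second order, phi and L* have gradients within O(l kappa^3 / lambda) <= O(eps) and the
   quadratic form of hess phi is at least that of hess L* up to
   O(l kappa^5 / lambda) <= O(sqrt (M eps)).

   Nesterov's method keeps the inner errors below the tolerance, hence the gradient and
   Hessian estimates within C_g eps and C_H sqrt (M eps) of those of L*.  A long step then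
   decreases L* by at least M |s|^3 / 24, which can happen at most 288 Delta sqrt M
   eps^(-3/2) times; after a short step the optimality conditions of the cubic model make
   the new point stationary.  Finally the logarithms in the inner step counts are
   polynomial in the data, because T >= 1 bounds 1 / M. *)
From HB Require Import structures.
Require Import Defs.
From mathcomp Require Import all_boot all_order all_algebra.
From mathcomp Require Import all_classical all_reals all_analysis.
From mathcomp Require Import ring lra.

Set Implicit Arguments.
Unset Strict Implicit.
Unset Printing Implicit Defensive.

Import Order.TTheory GRing.Theory Num.Theory.
Import numFieldNormedType.Exports.

Local Open Scope classical_set_scope.
Local Open Scope ring_scope.

(** * Euclidean norms and operator bounds *)

(** No implicit function theorem is invoked: a minimizer enters only through the equation saying
    that the y-part of the gradient vanishes, and strong convexity inverts this equation with
    explicit constants. The derivative of y* is never differentiated. Instead, (hess q) J^T has zero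
    y-block, so it kills every vertical vector, in particular the shift from y* to y_lambda* and the
    increment of the multiplier. First-order errors in y therefore cancel, although lambda
    multiplies them, and the remaining quadratic ones are O(1 / lambda).

    Constants: lambda >= 2 ell / mu leaves the modulus lambda mu / 2, and 2 (1 + lambda) / lambda <=
    3 explains kappa_2 = 3 kappa. C_2 is the Lipschitz constant of the Schur complement of hess Q
    under a change of y; the factor 2 next to it pays for the error in w. L* starts below phi(x_0)
    and stays above phi* - Delta / 2, a drop of at most 3 Delta / 2, while a step longer than sigma
    / 2 costs M sigma^3 / 192: this is the count 288. Since M = O(l kappa^5), each sqrt M becomes
    sqrt l kappa^(5/2), and the sqrt kappa of the inner loops completes kappa^3. *)

Section Euclidean.
Variables (R : realType) (n : nat).
Implicit Types (u v w : 'rV[R]_n) (a : R).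

Lemma dotC u v : dot u v = dot v u.
Proof. by apply: eq_bigr => i _; rewrite mulrC. Qed.

Lemma dotDl u v w : dot (u + v) w = dot u w + dot v w.
Proof. by rewrite /dot -big_split; apply: eq_bigr => i _; rewrite mxE mulrDl. Qed.

Lemma dotZl a u v : dot (a *: u) v = a * dot u v.
Proof. by rewrite /dot mulr_sumr; apply: eq_bigr => i _; rewrite mxE mulrA. Qed.

Lemma dotNl u v : dot (- u) v = - dot u v.
Proof. by rewrite -scaleN1r dotZl mulN1r. Qed.

Lemma dotDr u v w : dot w (u + v) = dot w u + dot w v.
Proof. by rewrite ![dot w _]dotC dotDl. Qed.

Lemma dotZr a u v : dot u (a *: v) = a * dot u v.
Proof. by rewrite dotC dotZl dotC. Qed.

Lemma dotNr u v : dot u (- v) = - dot u v.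
Proof. by rewrite dotC dotNl dotC. Qed.

Lemma dot0l u : dot 0 u = 0.
Proof. by rewrite -(scale0r u) dotZl mul0r. Qed.

Lemma dot0r u : dot u 0 = 0.
Proof. by rewrite dotC dot0l. Qed.

Definition dotE := (dotDl, dotDr, dotNl, dotNr, dotZl, dotZr).

Lemma dot_ge0 u : 0 <= dot u u.
Proof. by apply: sumr_ge0 => i _; rewrite -expr2 sqr_ge0. Qed.

Lemma enorm_ge0 u : 0 <= enorm u.
Proof. exact: sqrtr_ge0. Qed.

Lemma enorm_sqr u : enorm u ^+ 2 = dot u u.
Proof. by rewrite sqr_sqrtr// dot_ge0. Qed.

Lemma enorm0 : enorm (0 : 'rV[R]_n) = 0.
Proof. by rewrite /enorm dot0l sqrtr0. Qed.

Lemma enormN u : enorm (- u) = enorm u.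
Proof. by rewrite /enorm dotNl dotNr opprK. Qed.

Lemma enormB u v : enorm (u - v) = enorm (v - u).
Proof. by rewrite -enormN opprB. Qed.

Lemma enormZ a u : enorm (a *: u) = `|a| * enorm u.
Proof. by rewrite /enorm dotZl dotZr mulrA -expr2 sqrtrM ?sqr_ge0// sqrtr_sqr. Qed.

Lemma enorm_eq0 u : enorm u = 0 -> u = 0.
Proof.
move=> u0; apply/rowP => i; rewrite mxE.
have /eqP : dot u u = 0 by rewrite -enorm_sqr u0 expr0n.
rewrite /dot psumr_eq0 => [|j _]; last by rewrite -expr2 sqr_ge0.
by move=> /allP /(_ i); rewrite mem_index_enum -expr2 sqrf_eq0 => /(_ isT)/eqP.
Qed.

Lemma enorm_gt0 u : u != 0 -> 0 < enorm u.
Proof.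
by rewrite lt_def enorm_ge0 andbT; apply: contra_neq; exact: enorm_eq0.
Qed.

(** Cauchy-Schwarz: expand the squared norm of [enorm v *: u - enorm u *: v] and cancel
    [2 |u| |v|]. *)
Lemma dot_le u v : dot u v <= enorm u * enorm v.
Proof.
have [->|u0] := eqVneq u 0; first by rewrite dot0l enorm0 mul0r.
have [->|v0] := eqVneq v 0; first by rewrite dot0r enorm0 mulr0.
have := dot_ge0 (enorm v *: u - enorm u *: v).
rewrite !dotE (dotC v u) -!enorm_sqr => H.
have := enorm_gt0 u0; have := enorm_gt0 v0; move: (enorm u) (enorm v) H => a b.
move: (dot u v) => d H b0 a0.
have H2 : 2 * (a * b) * d <= 2 * (a * b) * (a * b) by nra.
by rewrite ler_pM2l in H2 => //; rewrite !mulr_gt0.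
Qed.

Lemma normr_dot_le u v : `|dot u v| <= enorm u * enorm v.
Proof. by rewrite ler_norml dot_le andbT lerNl -dotNl -(enormN u) dot_le. Qed.

Lemma enormD u v : enorm (u + v) <= enorm u + enorm v.
Proof.
rewrite -ler_sqr ?nnegrE ?addr_ge0 ?enorm_ge0// enorm_sqr !dotE (dotC v u).
by rewrite -!enorm_sqr; have := dot_le u v; nra.
Qed.

Lemma ler_enormD u v a b : enorm u <= a -> enorm v <= b -> enorm (u + v) <= a + b.
Proof. by move=> ua vb; rewrite (le_trans (enormD _ _))// lerD. Qed.

Lemma ler_enormB u v a b : enorm u <= a -> enorm v <= b -> enorm (u - v) <= a + b.
Proof. by move=> ua vb; apply: ler_enormD => //; rewrite enormN. Qed.

Lemma enorm_leP u a : 0 <= a -> dot u u <= a * enorm u -> enorm u <= a.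
Proof.
move=> a0; rewrite -enorm_sqr; have [->//|u0] := eqVneq (enorm u) 0.
by rewrite expr2 ler_pM2r// lt_def u0 enorm_ge0.
Qed.

Lemma enorm_dual u a : 0 <= a -> (forall v, dot u v <= a * enorm v) -> enorm u <= a.
Proof. by move=> a0 H; apply: enorm_leP. Qed.

(** Together with [enorm_le_normr] this is the equivalence with the sup norm, in which derivatives
    are defined. The crude factor [n] there is harmless: it enters continuity and little-o
    arguments, never a final constant. *)
Lemma normr_le_enorm u : `|u| <= enorm u.
Proof.
rewrite /Num.Def.normr/= mx_normrE; apply: bigmax_le => [|[i j] _]; first exact: enorm_ge0.
rewrite -ler_sqr ?nnegrE ?enorm_ge0// enorm_sqr /dot (bigD1 j)//= ord1 real_normK ?num_real//.
by rewrite expr2 lerDl sumr_ge0// => k _; rewrite -expr2 sqr_ge0.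
Qed.

Lemma enorm_le_normr u : enorm u <= n%:R * `|u|.
Proof.
rewrite -ler_sqr ?nnegrE ?enorm_ge0 ?mulr_ge0// enorm_sqr.
have H : dot u u <= \sum_(i < n) `|u| ^+ 2.
  apply: ler_sum => i _; rewrite -expr2 -[leLHS]real_normK ?num_real// lerXn2r ?nnegrE//.
  rewrite [leRHS]/Num.Def.normr/= mx_normrE.
  exact: (le_bigmax _ (fun ij => `|u ij.1 ij.2|) (0, i)).
rewrite sumr_const card_ord in H; apply: (le_trans H).
rewrite exprMn -[leLHS]mulr_natl ler_wpM2r ?sqr_ge0//.
by rewrite expr2 -natrM ler_nat; case: (n) => // m; rewrite mulSn leq_addr.
Qed.

End Euclidean.

(** Norm bounds are stated vector by vector, so that the suprema in [spectral_norm] and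
    [tensor_norm] are met only when hypotheses are translated. *)
Definition opb (R : realType) m n (A : 'M[R]_(m, n)) (c : R) : Prop :=
  forall v : 'rV[R]_m, enorm (v *m A) <= c * enorm v.

Section OperatorBounds.
Variable R : realType.

Lemma dot_mulmx m n (u : 'rV[R]_m) (v : 'rV[R]_n) (A : 'M[R]_(m, n)) :
  dot (u *m A) v = dot u (v *m A^T).
Proof.
rewrite /dot; under eq_bigr do rewrite mxE mulr_suml.
rewrite exchange_big; apply: eq_bigr => i _; rewrite mxE mulr_sumr.
by apply: eq_bigr => j _; rewrite mxE; ring.
Qed.

Lemma dot_mulmx_tr m n (u : 'rV[R]_m) (v : 'rV[R]_n) (A : 'M[R]_(m, n)) :
  dot v (u *m A) = dot (v *m A^T) u.
Proof. by rewrite dotC dot_mulmx dotC. Qed.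

Lemma dot_inj n (u v : 'rV[R]_n) : (forall w, dot u w = dot v w) -> u = v.
Proof.
move=> H; apply/eqP; rewrite -subr_eq0; apply/eqP/enorm_eq0/eqP.
by rewrite -sqrf_eq0 enorm_sqr dotDl dotNl H subrr.
Qed.

Lemma mulmx_inj m n (A B : 'M[R]_(m, n)) : (forall u : 'rV[R]_m, u *m A = u *m B) -> A = B.
Proof. by move=> H; apply/row_matrixP => i; rewrite !rowE. Qed.

Lemma sym_mxP n (A : 'M[R]_n) : (forall u v, dot (u *m A) v = dot (v *m A) u) -> A^T = A.
Proof.
move=> H; apply: mulmx_inj => u; apply: dot_inj => v.
by rewrite dot_mulmx trmxK dotC H.
Qed.

Lemma opb_tr m n (A : 'M[R]_(m, n)) c : 0 <= c -> opb A c -> opb A^T c.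
Proof.
move=> c0 Ac v; apply: enorm_dual => [|u]; first by rewrite mulr_ge0 ?enorm_ge0.
rewrite dot_mulmx trmxK; apply: (le_trans (dot_le _ _)).
by rewrite (mulrC c) -mulrA ler_wpM2l ?enorm_ge0.
Qed.

Lemma opbD m n (A B : 'M[R]_(m, n)) a b : opb A a -> opb B b -> opb (A + B) (a + b).
Proof. by move=> Aa Bb v; rewrite mulmxDr mulrDl ler_enormD. Qed.

Lemma opbN m n (A : 'M[R]_(m, n)) a : opb A a -> opb (- A) a.
Proof. by move=> Aa v; rewrite mulmxN enormN. Qed.

Lemma opbB m n (A B : 'M[R]_(m, n)) a b : opb A a -> opb B b -> opb (A - B) (a + b).
Proof. by move=> Aa Bb; apply/opbD/opbN. Qed.

Lemma opbZ m n (A : 'M[R]_(m, n)) a t : opb A a -> opb (t *: A) (`|t| * a).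
Proof. by move=> Aa v; rewrite -scalemxAr enormZ -mulrA ler_wpM2l. Qed.

Lemma opbM m n p (A : 'M[R]_(m, n)) (B : 'M[R]_(n, p)) a b :
  0 <= b -> opb A a -> opb B b -> opb (A *m B) (a * b).
Proof.
move=> b0 Aa Bb v; rewrite mulmxA (le_trans (Bb _))// -mulrA [leRHS]mulrCA.
by rewrite ler_wpM2l.
Qed.

Lemma opbW m n (A : 'M[R]_(m, n)) a b : a <= b -> opb A a -> opb A b.
Proof. by move=> ab Aa v; rewrite (le_trans (Aa v))// ler_wpM2r ?enorm_ge0. Qed.

Lemma opb_exists m n (A : 'M[R]_(m, n)) : exists2 c, 0 <= c & opb A c.
Proof.
exists (\sum_i enorm (row i A)) => [|v]; first by apply: sumr_ge0 => i _; exact: enorm_ge0.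
rewrite mulmx_sum_row mulr_suml.
apply: (big_ind2 (fun u a => enorm u <= a)) => [|u a u' a'|i _]; first by rewrite enorm0.
- exact: ler_enormD.
- rewrite enormZ mulrC ler_wpM2l ?enorm_ge0// (le_trans _ (normr_le_enorm _))//.
  rewrite [leRHS]/Num.Def.normr/= mx_normrE.
  exact: (le_bigmax _ (fun ij => `|v ij.1 ij.2|) (0, i)).
Qed.

Lemma spectral_norm_le m n (A : 'M[R]_(m, n)) c : 0 <= c -> opb A c -> spectral_norm A <= c.
Proof.
move=> c0 Ac; apply: ge_sup; first by exists (enorm (0 *m A)); exists 0 => //=; rewrite enorm0.
by move=> _ [v /= v1 <-]; rewrite (le_trans (Ac v))// ler_piMr.
Qed.

Lemma opb_spectral_norm m n (A : 'M[R]_(m, n)) : opb A (spectral_norm A).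
Proof.
move=> v; have [->|v0] := eqVneq v 0; first by rewrite mul0mx !enorm0 mulr0.
have v1 := enorm_gt0 v0; rewrite -ler_pdivrMr// mulrC.
have -> : (enorm v)^-1 * enorm (v *m A) = enorm (((enorm v)^-1 *: v) *m A).
  by rewrite -scalemxAl enormZ ger0_norm// invr_ge0 ltW.
apply: ub_le_sup.
  have [c c0 Ac] := opb_exists A; exists c => _ [u /= u1 <-].
  by rewrite (le_trans (Ac u))// ler_piMr.
exists ((enorm v)^-1 *: v) => //=.
by rewrite enormZ gtr0_norm ?invr_gt0// mulVf ?gt_eqF.
Qed.

(** [f] is a bare function with a linearity proof because it will be a pointwise difference of two
    third derivatives. *)
Lemma tensor_norm_opb n (f : 'rV[R]_n -> 'M[R]_n) u :
  linear f -> opb (f u) (tensor_norm f * enorm u).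
Proof.
suff H (T : {linear 'rV[R]_n -> 'M[R]_n}) : opb (T u) (tensor_norm T * enorm u).
  move=> linf; pose fL := GRing.isLinear.Build _ _ _ _ _ linf.
  exact: (H (HB.pack f fL)).
have [->|u0] := eqVneq u 0.
  by rewrite linear0 enorm0 mulr0 => v; rewrite mulmx0 enorm0 mul0r.
have u1 := enorm_gt0 u0.
suff H : spectral_norm (T ((enorm u)^-1 *: u)) <= tensor_norm T.
  have -> : T u = enorm u *: T ((enorm u)^-1 *: u).
    by rewrite linearZ scalerA divff ?gt_eqF// scale1r.
  apply: opbW (opbZ (enorm u) (@opb_spectral_norm _ _ _)).
  by rewrite ger0_norm ?enorm_ge0// mulrC ler_wpM2r// ltW.
apply: ub_le_sup; last first.
  exists ((enorm u)^-1 *: u) => //=.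
  by rewrite enormZ gtr0_norm ?invr_gt0// mulVf ?gt_eqF.
(* An upper bound of the set whose supremum is [tensor_norm]: expand a unit vector in the canonical
   basis, where its coordinates are at most 1 in absolute value. *)
pose c := \sum_i spectral_norm (T (delta_mx 0 i)).
have sn0 m k (A : 'M[R]_(m, k)) : 0 <= spectral_norm A.
  apply: ub_le_sup; last by exists 0; rewrite /= ?enorm0// mul0mx enorm0.
  have [d d0 Ad] := opb_exists A; exists d => _ [v /= v1 <-].
  by rewrite (le_trans (Ad v))// ler_piMr.
have c0 : 0 <= c by apply: sumr_ge0.
exists c => _ [v /= v1 <-]; apply: spectral_norm_le => //.
rewrite [v]row_sum_delta linear_sum/= /c.
apply: (big_ind2 (@opb R n n)) => [w|A a B b|i _]; first by rewrite mulmx0 enorm0 mul0r.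
- exact: opbD.
- rewrite linearZ; apply: opbW (opbZ _ (@opb_spectral_norm _ _ _)).
  rewrite ler_piMl// (le_trans _ v1)// (le_trans _ (normr_le_enorm _))//.
  rewrite [leRHS]/Num.Def.normr/= mx_normrE.
  exact: (le_bigmax _ (fun ij => `|v ij.1 ij.2|) (0, i)).
Qed.

Lemma dot_row_mx m n (a c : 'rV[R]_m) (b d : 'rV[R]_n) :
  dot (row_mx a b) (row_mx c d) = dot a c + dot b d.
Proof.
rewrite /dot big_split_ord/=; congr (_ + _); apply: eq_bigr => i _.
- by rewrite !row_mxEl.
- by rewrite !row_mxEr.
Qed.

Lemma enorm_row_mx0 m n (a : 'rV[R]_m) : enorm (row_mx a (0 : 'rV[R]_n)) = enorm a.
Proof. by rewrite /enorm dot_row_mx dot0l addr0. Qed.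

Lemma enorm_row_0mx m n (b : 'rV[R]_n) : enorm (row_mx (0 : 'rV[R]_m) b) = enorm b.
Proof. by rewrite /enorm dot_row_mx dot0l add0r. Qed.

Lemma enorm_lsubmx m n (z : 'rV[R]_(m + n)) : enorm (lsubmx z) <= enorm z.
Proof.
by rewrite ler_wsqrtr// -{3 4}[z]hsubmxK dot_row_mx lerDl dot_ge0.
Qed.

Lemma enorm_rsubmx m n (z : 'rV[R]_(m + n)) : enorm (rsubmx z) <= enorm z.
Proof.
by rewrite ler_wsqrtr// -{3 4}[z]hsubmxK dot_row_mx lerDr dot_ge0.
Qed.

Lemma enorm_row_mx_le m n (a : 'rV[R]_m) (b : 'rV[R]_n) :
  enorm (row_mx a b) <= enorm a + enorm b.
Proof.
have -> : row_mx a b = row_mx a 0 + row_mx 0 b by rewrite add_row_mx addr0 add0r.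
by rewrite ler_enormD ?enorm_row_mx0 ?enorm_row_0mx.
Qed.

Lemma opb_blocks m n (A : 'M[R]_(m + n)) c : 0 <= c -> opb A c ->
  [/\ opb (ulsubmx A) c, opb (ursubmx A) c, opb (dlsubmx A) c & opb (drsubmx A) c].
Proof.
move=> c0 Ac.
have H1 (v : 'rV_m) : row_mx v 0 *m A = row_mx (v *m ulsubmx A) (v *m ursubmx A).
  by rewrite -{1}[A]submxK mul_row_block !mul0mx !addr0.
have H2 (v : 'rV_n) : row_mx 0 v *m A = row_mx (v *m dlsubmx A) (v *m drsubmx A).
  by rewrite -{1}[A]submxK mul_row_block !mul0mx !add0r.
split=> v.
- by have := Ac (row_mx v 0); rewrite H1 enorm_row_mx0; apply/le_trans;
    rewrite -{1}(row_mxKl (v *m ulsubmx A) (v *m ursubmx A)) enorm_lsubmx.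
- by have := Ac (row_mx v 0); rewrite H1 enorm_row_mx0; apply/le_trans;
    rewrite -{1}(row_mxKr (v *m ulsubmx A) (v *m ursubmx A)) enorm_rsubmx.
- by have := Ac (row_mx 0 v); rewrite H2 enorm_row_0mx; apply/le_trans;
    rewrite -{1}(row_mxKl (v *m dlsubmx A) (v *m drsubmx A)) enorm_lsubmx.
- by have := Ac (row_mx 0 v); rewrite H2 enorm_row_0mx; apply/le_trans;
    rewrite -{1}(row_mxKr (v *m dlsubmx A) (v *m drsubmx A)) enorm_rsubmx.
Qed.

Lemma coercive_unitmx n (B : 'M[R]_n) m : 0 < m ->
  (forall v, m * enorm v ^+ 2 <= dot v (v *m B)) -> B \in unitmx.
Proof.
move=> m0 H; rewrite -row_free_unit -kermx_eq0; apply/eqP/row_matrixP => i.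
rewrite row0; apply: enorm_eq0; apply/eqP; rewrite -sqrf_eq0 eq_le sqr_ge0 andbT.
have := H (row i (kermx B)); rewrite -row_mul mulmx_ker row0 dot0r.
by rewrite pmulr_rle0.
Qed.

(** With [u = v *m invmx B], coercivity and Cauchy-Schwarz give [m |u|^2 <= |u| |v|]. *)
Lemma opb_coercive_inv n (B : 'M[R]_n) m : 0 < m ->
  (forall v, m * enorm v ^+ 2 <= dot v (v *m B)) -> opb (invmx B) m^-1.
Proof.
move=> m0 H v; have uB := coercive_unitmx m0 H.
have := H (v *m invmx B); rewrite mulmxKV// => H1.
have := le_trans H1 (dot_le _ _); move: (enorm_ge0 v) (enorm_ge0 (v *m invmx B)).
move: (enorm v) (enorm (v *m _)) => a b a0 b0 H2.
rewrite mulrC ler_pdivlMr//; have [->|b1] := eqVneq b 0; first by rewrite mul0r.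
have {}b1 : 0 < b by rewrite lt_def b1.
by rewrite -(ler_pM2l b1); nra.
Qed.

End OperatorBounds.

(** * Taylor estimates *)

Section Calculus.
Variable R : realType.

(** Stands in for integrating the remainder: the mean value theorem applied to [psi] minus
    [c t^(k+1) / (k+1)], whose derivative is nonpositive on the unit interval. *)
Lemma le_deriv_unit (psi dpsi : R -> R) (c : R) (k : nat) :
  (forall t : R, is_derive t 1 psi (dpsi t)) ->
  (forall t, 0 <= t <= 1 -> dpsi t <= c * t ^+ k) ->
  psi 1 <= psi 0 + c / k.+1%:R.
Proof.
move=> dp H; pose d := c / k.+1%:R; pose F := psi - d *: (fun t : R => t ^+ k.+1).
have dF (t : R) : is_derive t 1 F (dpsi t - d *: (k.+1%:R *: (t ^+ k)%R)).
  have := dp t => ?; apply: is_deriveB; apply: is_deriveZ.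
  apply: DeriveDef; first exact: exprn_derivable.
  by rewrite exp_derive /GRing.scale/= mulr1.
have cF : {within `[0, 1], continuous F}.
  apply: continuous_subspaceT => t; apply: differentiable_continuous.
  by apply/derivable1_diffP; have [] := dF t.
have [t0] := MVT ltr01 (fun t _ => dF t) cF.
rewrite in_itv/= => t01.
have : dpsi t0 <= c * t0 ^+ k by apply: H; case/andP: t01 => *; rewrite !ltW.
rewrite /F !fctE expr1n expr0n/= /GRing.scale/= mulr0 subr0 subr0 !mulr1 mulrA /d.
rewrite mulfVK ?pnatr_eq0// => H1 H2.
by move: (c / _) (c * _) H1 H2 => a b; lra.
Qed.

Lemma bounded_linear_cont (V W : normedModType R) (f : {linear V -> W}) c :
  (forall u, `|f u| <= c * `|u|) -> continuous f.
Proof.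
move=> fc; apply/bounded_linear_continuous/linear_boundedP.
exists c; split=> [|r cr u]; first exact: num_real.
by rewrite (le_trans (fc u))// ler_wpM2r// ltW.
Qed.

Lemma quad_differentiable (V W : normedModType R) (F : V -> W) (L : {linear V -> W})
    x c C : (forall u, `|L u| <= c * `|u|) ->
  (forall u, `|F (x + u) - F x - L u| <= C * `|u| ^+ 2) ->
  differentiable F x /\ 'd F x = L :> (V -> W).
Proof.
move=> Lc FL; have cL := bounded_linear_cont Lc.
have E : F \o shift x = cst (F x) + L +o_ 0 id.
  apply/eqaddoP => e e0.
  have d0 : 0 < e / (`|C| + 1) by rewrite divr_gt0// ltr_wpDl.
  apply/nbhs_normP; exists (e / (`|C| + 1)) => //= u.
  rewrite /ball_/= sub0r normrN => ud.
  change (`|F (u + x) - (F x + L u)| <= e * `|u|).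
  rewrite opprD [F _ + _]addrA (addrC u) (le_trans (FL u))// expr2 mulrA ler_wpM2r//.
  rewrite (@le_trans _ _ ((`|C| + 1) * `|u|))//.
    by rewrite ler_wpM2r// (le_trans (ler_norm _))// lerDl.
  by rewrite mulrC -ler_pdivlMr ?ltr_wpDl// ltW.
have dE : 'd F x = L :> (V -> W) by apply: diff_unique.
by split=> //; apply/diff_locallyP; rewrite dE.
Qed.

(** Composing with a linear functional [L] turns a vector or matrix valued map into a real function
    of [t], to which the mean value estimates apply; norms are then recovered by duality. *)
Lemma is_derive_line n (W : normedModType R) (F : 'rV[R]_n -> W)
    (L : W -> R^o) c (z u : 'rV[R]_n) (t : R) :
  linear L -> (forall w, `|L w| <= c * `|w|) -> differentiable F (z + t *: u) ->
  is_derive t 1 (fun t : R => L (F (z + t *: u))) (L ('d F (z + t *: u) u)).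
Proof.
move=> linL Lc dF.
pose HL := GRing.isLinear.Build _ _ _ _ _ linL.
pose L' : {linear W -> R^o} := HB.pack L HL.
have cL : continuous L' by exact: (@bounded_linear_cont W R^o L' c).
pose l := (fun t : R => z + t *: u).
have dl : is_diff t l (fun s : R => s *: u).
  have := is_diffD (is_diff_cst z t) (is_diff_scalel t u).
  by rewrite add0r.
have dlt : differentiable l t by [].
have dL p : differentiable L' p by apply: linear_differentiable.
have dc : differentiable (L' \o (F \o l)) t.
  by apply: differentiable_comp => //; apply: differentiable_comp.
have -> : (fun t : R => L (F (z + t *: u))) = L' \o (F \o l) by [].
apply: DeriveDef; first exact: diff_derivable.
rewrite deriveE// diff_comp ?diff_lin//; last exact: differentiable_comp.
by rewrite diff_comp//= diff_val scale1r.
Qed.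

Lemma normr_mx_coord m n (A : 'M[R]_(m, n)) i j : `|A i j| <= `|A|.
Proof.
rewrite [leRHS]/Num.Def.normr/= mx_normrE.
exact: (le_bigmax _ (fun ij => `|A ij.1 ij.2|) (i, j)).
Qed.

Lemma diff_grad n (h : 'rV[R]_n -> R) z u : differentiable h z ->
  'd h z u = dot (grad h z) u.
Proof.
move=> dh; rewrite [in LHS](row_sum_delta u) linear_sum/=; apply: eq_bigr => i _.
by rewrite linearZ/= /grad mxE deriveE// mulrC.
Qed.

Lemma diff_jacobian n m (F : 'rV[R]_n -> 'rV[R]_m) z u : 'd F z u = u *m jacobian F z.
Proof. by rewrite /jacobian mul_rV_lin1. Qed.

Lemma is_derive_line_fun n (h : 'rV[R]_n -> R) (z u : 'rV[R]_n) (t : R) :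
  differentiable h (z + t *: u) ->
  is_derive t 1 (fun t : R => h (z + t *: u)) (dot (grad h (z + t *: u)) u).
Proof.
move=> dh; rewrite -diff_grad//.
by apply: (@is_derive_line _ _ h idfun 1) => // w; rewrite mul1r.
Qed.

Lemma is_derive_line_dot n m (F : 'rV[R]_n -> 'rV[R]_m) (z u : 'rV[R]_n) b (t : R) :
  differentiable F (z + t *: u) ->
  is_derive t 1 (fun t : R => dot (F (z + t *: u)) b)
    (dot (u *m jacobian F (z + t *: u)) b).
Proof.
move=> dF; rewrite -diff_jacobian.
apply: (@is_derive_line _ _ F (fun w => dot w b) (m%:R * enorm b)) => //.
  by move=> a v w; rewrite dotDl dotZl.
move=> w; rewrite (le_trans (normr_dot_le _ _))// mulrAC ler_wpM2r ?enorm_ge0//.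
exact: enorm_le_normr.
Qed.

Lemma is_derive_line_quad n m p (F : 'rV[R]_n -> 'M[R]_(m, p)) (z u : 'rV[R]_n) a b
    (t : R) : differentiable F (z + t *: u) ->
  is_derive t 1 (fun t : R => dot (b *m F (z + t *: u)) a)
    (dot (b *m 'd F (z + t *: u) u) a).
Proof.
move=> dF.
apply: (@is_derive_line _ _ F (fun w => dot (b *m w) a)
  (\sum_(j < p) (\sum_(i < m) `|b 0 i|) * `|a 0 j|)) => //.
  by move=> s v w; rewrite mulmxDr -scalemxAr dotDl dotZl.
move=> w; rewrite /dot (le_trans (ler_norm_sum _ _ _))// mulr_suml ler_sum// => j _.
rewrite normrM mulrAC ler_wpM2r// mxE (le_trans (ler_norm_sum _ _ _))// mulr_suml.
by apply: ler_sum => i _; rewrite normrM ler_wpM2l// normr_mx_coord.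
Qed.

(** Subtract the primitive of [a + b t] and apply the one-sided estimate to [psi - q] and to
    [q - psi]. *)
Lemma abs_deriv_unit (psi dpsi : R -> R) (a b c : R) (k : nat) :
  (forall t : R, is_derive t 1 psi (dpsi t)) ->
  (forall t, 0 <= t <= 1 -> `|dpsi t - (a + b * t)| <= c * t ^+ k) ->
  `|psi 1 - psi 0 - a - b / 2| <= c / k.+1%:R.
Proof.
move=> dp H.
pose q := fun t : R => a * t + b / 2 * t ^+ 2.
have dq (t : R) : is_derive t 1 q (a + b * t).
  pose q' := a *: (id : R -> R) + (b / 2) *: (fun t : R => t ^+ 2).
  have -> : q = q' by [].
  have dX : is_derive t 1 (fun t : R => t ^+ 2) (2 * t).
    apply: DeriveDef; first exact: exprn_derivable.
    by rewrite exp_derive /GRing.scale/= mulr1.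
  have := is_deriveD (is_deriveZ a (is_derive_id t 1)) (is_deriveZ (b / 2) dX).
  by rewrite /GRing.scale/= mulr1 mulrA divfK.
have B t : 0 <= t <= 1 -> _ := fun Ht => andP (etrans (esym (ler_norml _ _)) (H t Ht)).
have D1 : forall t : R, is_derive t 1 (psi - q) (dpsi t - (a + b * t)).
  by move=> t; apply: is_deriveB.
have D2 : forall t : R, is_derive t 1 (q - psi) (a + b * t - dpsi t).
  by move=> t; apply: is_deriveB.
have H1 := @le_deriv_unit _ _ c k D1 (fun t Ht => proj2 (B t Ht)).
have H2 : (q - psi) 1 <= (q - psi) 0 + c / k.+1%:R.
  by apply: (le_deriv_unit D2) => t /B[] h1 _; rewrite -opprB lerNl.
move: H1 H2; rewrite !fctE /q !mulr0 !mulr1 expr1n expr0n/= !mulr0 mulr1 ler_norml.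
by move: (c / _) => d H1 H2; apply/andP; split; lra.
Qed.

Lemma abs_deriv_unit0 (psi dpsi : R -> R) (a c : R) (k : nat) :
  (forall t : R, is_derive t 1 psi (dpsi t)) ->
  (forall t, 0 <= t <= 1 -> `|dpsi t - a| <= c * t ^+ k) ->
  `|psi 1 - psi 0 - a| <= c / k.+1%:R.
Proof.
move=> D H; have := @abs_deriv_unit _ _ a 0 c k D.
by rewrite mul0r subr0; apply=> t t01; rewrite mul0r addr0 H.
Qed.

(** The passage to the limit [t -> 0] used throughout: an inequality along a short displacement is
    divided by [t] or [t ^+ 2], and the remainder left is at most [c * t]. *)
Lemma le_limit0 (a b c : R) : (forall t, 0 < t <= 1 -> a <= b + c * t) -> a <= b.
Proof.
move=> H; apply/ler_addgt0Pr => e e0.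
pose t := Num.min 1 (e / (`|c| + 1)).
have c1 : 0 < `|c| + 1 by rewrite ltr_wpDl.
have t0 : 0 < t <= 1 by rewrite /t lt_min ltr01 divr_gt0//= ge_min lexx.
apply: (le_trans (H t t0)); rewrite lerD2l.
have : t <= e / (`|c| + 1) by rewrite /t ge_min lexx orbT.
rewrite ler_pdivlMr// => H1; have := ler_norm c; case/andP: t0 => t0 _; nra.
Qed.

End Calculus.

Section Taylor.
Variables (R : realType) (n : nat).

Lemma twice_differentiable_fun (h : 'rV[R]_n -> R) z :
  twice_differentiable_at h z -> differentiable h z.
Proof. by case=> /nbhs_singleton. Qed.

Lemma twice_differentiable_grad (h : 'rV[R]_n -> R) z :
  twice_differentiable_at h z -> differentiable (grad h) z.
Proof. by case. Qed.

Lemma thrice_differentiable_twice (h : 'rV[R]_n -> R) z :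
  thrice_differentiable_at h z -> twice_differentiable_at h z.
Proof. by case=> /nbhs_singleton. Qed.

Lemma thrice_differentiable_hess (h : 'rV[R]_n -> R) z :
  thrice_differentiable_at h z -> differentiable (hess h) z.
Proof. by case. Qed.

Lemma line_sub (z u : 'rV[R]_n) (t : R) : 0 <= t -> enorm (z + t *: u - z) = t * enorm u.
Proof. by move=> t0; rewrite addrAC subrr add0r enormZ ger0_norm. Qed.

Lemma taylor_grad (h : 'rV[R]_n -> R) L : (forall z, differentiable h z) ->
  lipschitz_for (@enorm R n) L (grad h) ->
  forall z u, `|h (z + u) - h z - dot (grad h z) u| <= L / 2 * enorm u ^+ 2.
Proof.
move=> dh lip z u.
have D (t : R) := is_derive_line_fun (dh (z + t *: u)).
have := @abs_deriv_unit0 _ _ _ (dot (grad h z) u) (L * enorm u ^+ 2) 1%N D.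
rewrite scale1r scale0r addr0 mulrAC; apply=> t /andP[t0 _].
rewrite -dotNl -dotDl (le_trans (normr_dot_le _ _))//.
rewrite (le_trans (ler_wpM2r (enorm_ge0 _) (lip _ _)))// line_sub//.
by rewrite le_eqVlt; apply/orP; left; apply/eqP; ring.
Qed.

Lemma taylor_jacobian m (F : 'rV[R]_n -> 'rV[R]_m) rho :
  (forall z, differentiable F z) -> 0 <= rho ->
  (forall z z', opb (jacobian F z - jacobian F z') (rho * enorm (z - z'))) ->
  forall z u, enorm (F (z + u) - F z - u *m jacobian F z) <= rho / 2 * enorm u ^+ 2.
Proof.
move=> dF rho0 lip z u; apply: enorm_dual => [|b].
  by rewrite mulr_ge0 ?sqr_ge0 ?divr_ge0.
have D (t : R) := is_derive_line_dot b (dF (z + t *: u)).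
have := @abs_deriv_unit0 _ _ _ (dot (u *m jacobian F z) b)
  (rho * enorm u ^+ 2 * enorm b) 1%N D.
rewrite scale1r scale0r addr0 -!dotNl -!dotDl => H.
apply: (le_trans (ler_norm _)); refine (le_trans (H _) _) => [t /andP[t0 _]|].
  rewrite -?dotNl -?dotDl -?mulmxBr (le_trans (normr_dot_le _ _))//.
  rewrite (le_trans (ler_wpM2r (enorm_ge0 _) (lip _ _ _)))// line_sub//.
  by rewrite le_eqVlt; apply/orP; left; apply/eqP; ring.
by rewrite le_eqVlt; apply/orP; left; apply/eqP; ring.
Qed.

Lemma taylor_hess (h : 'rV[R]_n -> R) rho :
  (forall z, differentiable h z) -> (forall z, differentiable (grad h) z) -> 0 <= rho ->
  (forall z z', opb (hess h z - hess h z') (rho * enorm (z - z'))) ->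
  forall z u, `|h (z + u) - h z - dot (grad h z) u - dot (u *m hess h z) u / 2|
    <= rho / 6 * enorm u ^+ 3.
Proof.
move=> dh dG rho0 lip z u.
have D (t : R) := is_derive_line_fun (dh (z + t *: u)).
have := @abs_deriv_unit _ _ _ (dot (grad h z) u) (dot (u *m hess h z) u)
  (rho / 2 * enorm u ^+ 3) 2%N D.
rewrite scale1r scale0r addr0 => H.
refine (le_trans (H _) _) => [t /andP[t0 _]|].
  rewrite opprD addrA (mulrC _ t) -dotZl -!dotNl -!dotDl scalemxAl.
  rewrite (le_trans (normr_dot_le _ _))//.
  rewrite (le_trans (ler_wpM2r (enorm_ge0 _) (taylor_jacobian dG rho0 lip _ _)))//.
  rewrite enormZ ger0_norm//.
  by rewrite le_eqVlt; apply/orP; left; apply/eqP; ring.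
by rewrite le_eqVlt; apply/orP; left; apply/eqP; field.
Qed.

Lemma taylor_third (h : 'rV[R]_n -> R) nu : (forall z, differentiable (hess h) z) ->
  0 <= nu ->
  (forall z z' u, opb (third h z u - third h z' u) (nu * enorm (z - z') * enorm u)) ->
  forall z u, opb (hess h (z + u) - hess h z - third h z u) (nu / 2 * enorm u ^+ 2).
Proof.
move=> dH nu0 lip z u b; apply: enorm_dual => [|a].
  by rewrite !mulr_ge0 ?sqr_ge0 ?enorm_ge0 ?invr_ge0.
have D (t : R) : is_derive t 1 (fun t0 : R => dot (b *m hess h (z + t0 *: u)) a)
    (dot (b *m third h (z + t *: u) u) a) := is_derive_line_quad a b (dH (z + t *: u)).
have := @abs_deriv_unit0 _ _ _ (dot (b *m third h z u) a)
  (nu * enorm u ^+ 2 * enorm a * enorm b) 1%N D.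
rewrite scale1r scale0r addr0 -!dotNl -!dotDl -!mulmxN -!mulmxDr => H.
apply: (le_trans (ler_norm _)); refine (le_trans (H _) _) => [t /andP[t0 _]|].
  rewrite -?dotNl -?dotDl -?mulmxBr (le_trans (normr_dot_le _ _))//.
  rewrite -mulmxDr.
  rewrite (le_trans (ler_wpM2r (enorm_ge0 _) (lip _ _ _ _)))// line_sub//.
  by rewrite le_eqVlt; apply/orP; left; apply/eqP; ring.
by rewrite le_eqVlt; apply/orP; left; apply/eqP; ring.
Qed.

(** The difference quotients of [F] along [u] are bounded by [L |u|] and differ from
    [u *m jacobian F z] by O(t). *)
Lemma lipschitz_jacobian_bound m (F : 'rV[R]_n -> 'rV[R]_m) L rho :
  (forall z, differentiable F z) -> 0 <= rho ->
  (forall z z', opb (jacobian F z - jacobian F z') (rho * enorm (z - z'))) ->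
  lipschitz_for (@enorm R m) L F -> forall z, opb (jacobian F z) L.
Proof.
move=> dF rho0 lip FL z u; apply: (@le_limit0 _ _ _ (rho / 2 * enorm u ^+ 2)) => t /andP[t0 _].
rewrite -(ler_pM2l t0); have := taylor_jacobian dF rho0 lip z (t *: u).
rewrite -scalemxAl => H1.
have -> : t * enorm (u *m jacobian F z) = enorm (t *: (u *m jacobian F z)).
  by rewrite enormZ gtr0_norm.
have -> : t *: (u *m jacobian F z) =
    (F (z + t *: u) - F z) - (F (z + t *: u) - F z - t *: (u *m jacobian F z)).
  by rewrite opprB addrC subrK.
rewrite (le_trans (ler_enormB (FL _ _) H1))// (line_sub _ _ (ltW t0)) enormZ gtr0_norm//.

by rewrite le_eqVlt; apply/orP; left; apply/eqP; ring.
Qed.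

(* Expanding F (z + u + v) by moving first along u, then along v, and the other way
   round, gives the two mixed second-order terms up to a cubic remainder. *)
Lemma second_derivative_sym (F : 'rV[R]_n -> R) (G : 'rV[R]_n -> 'rV[R]_n)
    (H : 'M[R]_n) z c :
  (forall z u (t : R), is_derive t 1 (fun t : R => F (z + t *: u)) (dot (G (z + t *: u)) u)) ->
  (forall u, enorm (G (z + u) - G z - u *m H) <= c * enorm u ^+ 2) ->
  forall u v, dot (u *m H) v = dot (v *m H) u.
Proof.
move=> DF GH u0 v0.
suff le u v : dot (u *m H) v <= dot (v *m H) u by apply/le_anti; rewrite !le.
have E a b : `|F (z + a + b) - F (z + a) - dot (G z + a *m H) b - dot (b *m H) b / 2|
    <= `|c| * (enorm a + enorm b) ^+ 2 * enorm b.
  have := @abs_deriv_unit _ _ _ (dot (G z + a *m H) b) (dot (b *m H) b)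
    (`|c| * (enorm a + enorm b) ^+ 2 * enorm b) 0%N (DF (z + a) b).
  rewrite scale1r scale0r addr0 divr1; apply => t /andP[t0 t1].
  rewrite expr0 mulr1 opprD addrA mulrC -dotZl -!dotNl -!dotDl scalemxAl.
  rewrite (le_trans (normr_dot_le _ _))// ler_wpM2r ?enorm_ge0//.
  have := GH (a + t *: b); rewrite mulmxDl !opprD !addrA => /le_trans; apply.
  rewrite (le_trans (ler_wpM2r (sqr_ge0 _) (ler_norm _)))// ler_wpM2l// lerXn2r//.
  - by rewrite nnegrE enorm_ge0.
  - by rewrite nnegrE addr_ge0 ?enorm_ge0.
  - by rewrite ler_enormD// enormZ ger0_norm// ler_piMl ?enorm_ge0.
(* Four expansions are combined ([u] then [v], [v] then [u], [u] alone, [v] alone); each remainder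
   is at most [t^3 |c| (|u| + |v|)^3], so 6 is a comfortable factor. *)
pose K := 6 * `|c| * (enorm u + enorm v) ^+ 3.
apply: (@le_limit0 _ _ _ K) => t /andP[t0 t1].
rewrite -(@ler_pM2l _ (t ^+ 2)) ?exprn_gt0//.
have E0 b := E 0 b.
have Euv := E (t *: u) (t *: v).
have Evu := E (t *: v) (t *: u).
have Eu := E0 (t *: u); have Ev := E0 (t *: v).
move: Euv Evu Eu Ev; rewrite addr0 mul0mx addr0 enorm0 !add0r !enormZ (gtr0_norm t0).
rewrite (addrAC z (t *: v)) -!scalemxAl !dotE /K.
have := normr_ge0 c; have := enorm_ge0 u; have := enorm_ge0 v.
move: (enorm u) (enorm v) `|c| => a b d b0 a0 d0.
set X1 := F (z + t *: u + _); set X2 := F _; set X3 := F _; set X4 := F _.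
move: (dot (u *m H) v) (dot (v *m H) u) (dot (u *m H) u) (dot (v *m H) v) => uv vu uu vv.
have c1 : d * (t * a + t * b) ^+ 2 * (t * b) <= t ^+ 3 * (d * (a + b) ^+ 3).
  have -> : d * (t * a + t * b) ^+ 2 * (t * b) = t ^+ 3 * (d * ((a + b) ^+ 2 * b)) by ring.
  rewrite ler_wpM2l ?exprn_ge0 ?(ltW t0)// ler_wpM2l// [leRHS]exprSr ler_wpM2l ?sqr_ge0//.
  by rewrite lerDr.
have c2 : d * (t * b + t * a) ^+ 2 * (t * a) <= t ^+ 3 * (d * (a + b) ^+ 3).
  have -> : d * (t * b + t * a) ^+ 2 * (t * a) = t ^+ 3 * (d * ((a + b) ^+ 2 * a)) by ring.
  rewrite ler_wpM2l ?exprn_ge0 ?(ltW t0)// ler_wpM2l// [leRHS]exprSr ler_wpM2l ?sqr_ge0//.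
  by rewrite lerDl.
have c3 : d * (t * a) ^+ 2 * (t * a) <= t ^+ 3 * (d * (a + b) ^+ 3).
  have -> : d * (t * a) ^+ 2 * (t * a) = t ^+ 3 * (d * a ^+ 3) by ring.
  by rewrite ler_wpM2l ?exprn_ge0 ?(ltW t0)// ler_wpM2l// lerXn2r ?nnegrE ?addr_ge0 ?lerDl.
have c4 : d * (t * b) ^+ 2 * (t * b) <= t ^+ 3 * (d * (a + b) ^+ 3).
  have -> : d * (t * b) ^+ 2 * (t * b) = t ^+ 3 * (d * b ^+ 3) by ring.
  by rewrite ler_wpM2l ?exprn_ge0 ?(ltW t0)// ler_wpM2l// lerXn2r ?nnegrE ?addr_ge0 ?lerDr.
move=> /le_trans/(_ c1) + /le_trans/(_ c2) + /le_trans/(_ c3) + /le_trans/(_ c4).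
rewrite mulrDr; have -> : t ^+ 2 * (6 * d * (a + b) ^+ 3 * t) =
  6 * (t ^+ 3 * (d * (a + b) ^+ 3)) by ring.
move: (t ^+ 3 * _) => W; rewrite !ler_norml expr2 => /andP[? ?] /andP[? ?] /andP[? ?] /andP[? ?].
by lra.
Qed.

End Taylor.

(** * Strong convexity and accelerated gradient descent *)

(** First-order form of strong convexity. [G] is free so that it can be the y-part of a joint
    gradient rather than the gradient of a slice. *)
Definition sc_lower (R : realType) n (m : R) (h : 'rV[R]_n -> R)
    (G : 'rV[R]_n -> 'rV[R]_n) : Prop :=
  forall u v, h v + dot (G v) (u - v) + m / 2 * enorm (u - v) ^+ 2 <= h u.

Definition smooth_upper (R : realType) n (L : R) (h : 'rV[R]_n -> R)
    (G : 'rV[R]_n -> 'rV[R]_n) : Prop :=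
  forall u v, h u <= h v + dot (G v) (u - v) + L / 2 * enorm (u - v) ^+ 2.

Section Minimization.
Variables (R : realType) (n : nat).
Implicit Types (h : 'rV[R]_n -> R) (G : 'rV[R]_n -> 'rV[R]_n) (m L : R).

(** Write strong convexity at [v + t (u - v)], expand [h] there to first order, divide by [t] and
    let [t] tend to 0. *)
Lemma strongly_convex_sc_lower h G m L :
  (forall u v, `|h (v + u) - h v - dot (G v) u| <= L / 2 * enorm u ^+ 2) ->
  strongly_convex m h -> sc_lower m h G.
Proof.
move=> T SC u v.
apply: (@le_limit0 _ _ _ ((L / 2 + m / 2) * enorm (u - v) ^+ 2)) => t /andP[t0 t1].
have t01 : 0 <= t <= 1 by rewrite t1 ltW.
have := SC u v t t01.
have -> : t *: u + (1 - t) *: v = v + t *: (u - v).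
  by rewrite scalerBl scale1r scalerBr addrC -addrA (addrC (- _)).
have := T (t *: (u - v)) v; rewrite ler_norml enormZ (gtr0_norm t0) dotZr => /andP[T1 _] S1.
rewrite -(ler_pM2l t0); move: T1 S1.
move: (enorm _) (dot _ _) (h (v + _)) => e d x; nra.
Qed.

Lemma sc_lower_monotone h G m u v : sc_lower m h G ->
  m * enorm (u - v) ^+ 2 <= dot (G u - G v) (u - v).
Proof.
move=> sc; have := sc u v; have := sc v u; rewrite (enormB v u).
by rewrite -(opprB u v) dotNr dotDl dotNl; move: (enorm _ ^+ 2) => e; lra.
Qed.

(** A short step along [- G z] would decrease [h] if [G z] were nonzero. *)
Lemma argmin_grad0 h G L z : smooth_upper L h G -> argmin h z -> G z = 0.
Proof.
move=> sm hz; apply: enorm_eq0; apply/eqP; rewrite -sqrf_eq0 eq_le sqr_ge0 andbT.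
apply: (@le_limit0 _ _ _ (L / 2 * enorm (G z) ^+ 2)) => t /andP[t0 _].
rewrite -(ler_pM2l t0).
have := le_trans (hz _) (sm (z + (- t) *: G z) z).
rewrite (addrC z) addrK enormZ normrN (gtr0_norm t0) dotZr -enorm_sqr.
by move: (enorm _) => e; nra.
Qed.

Lemma sc_lower_argmin_exists h G m : 0 < m -> sc_lower m h G -> continuous h ->
  exists z, argmin h z.
Proof.
(* At Euclidean distance [r] from 0 the quadratic term of the lower bound at 0 compensates the
   linear one, so outside the sup-norm ball of radius [r] the values are at least [h 0]; inside it
   compactness applies. *)
move=> m0 sc ch; pose r := 2 * enorm (G 0) / m.
have r0 : 0 <= r by rewrite !mulr_ge0 ?enorm_ge0 ?invr_ge0 ?ltW.
pose A := [set u : 'rV[R]_n | `|u| <= r].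
have A0 : A !=set0 by exists 0; rewrite /A /= normr0.
have cA : compact A.
  apply: bounded_closed_compact.
    by exists r; split; [exact: num_real|move=> x rx u /= /le_trans; apply; exact: ltW].
  have -> : A = (fun u : 'rV[R]_n => `|u|) @^-1` [set x | x <= r] by [].
  apply: closed_comp; last exact: closed_le.
  by move=> u _; exact: norm_continuous.
have [z zA hz] := EVT_min_rV A0 cA (continuous_subspaceT ch).
exists z => u; have [uA|uA] := lerP `|u| r; first by rewrite hz ?inE.
have h0 : h z <= h 0 by apply: hz; rewrite inE /A /= normr0.
apply: (le_trans h0); have := sc u 0; rewrite subr0.
have := dot_le (- G 0) u; rewrite dotNl enormN.
have : r <= enorm u by rewrite (le_trans (ltW uA))// normr_le_enorm.
rewrite /r ler_pdivrMr//; have := enorm_ge0 u.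
by move: (enorm u) (enorm _) (dot _ _) => a b d; nra.
Qed.

End Minimization.

(** * Nesterov's method for a strongly convex function of condition number [k] *)

Section AcceleratedGradient.
Variables (R : realType) (n : nat) (h : 'rV[R]_n -> R) (m k : R) (zs : 'rV[R]_n).
Hypotheses (m0 : 0 < m) (k1 : 1 <= k) (sc : sc_lower m h (grad h))
  (sm : smooth_upper (k * m) h (grad h)) (zs0 : grad h zs = 0).

Let r := Num.sqrt k.

(* Lyapunov function, the mirror sequence of the method being zt + r (zt - z). *)
Let V (p : 'rV[R]_n * 'rV[R]_n) : R :=
  h p.1 - h zs + m / 2 * enorm (p.2 + r *: (p.2 - p.1) - zs) ^+ 2.

(** One step multiplies the Lyapunov function by at most [1 - 1/r]. Weight the descent inequality
    [i1] by [r], strong convexity towards the previous point [i2] by [r - 1] and towards the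
    minimizer [i3] by 1; what is left over is [m/2 (r - 1)(r + 1) |y - z|^2 >= 0]. Initially both
    components are [z0], and smoothness gives the factor [k + 1]. *)
Lemma agd_lyapunov z0 K :
  V (agd_state h z0 (k * m)^-1 (momentum k) K) <=
  (1 - r^-1) ^+ K * ((k + 1) * m / 2 * enorm (z0 - zs) ^+ 2).
Proof.
have k0 : 0 < k by apply: lt_le_trans k1.
have r1 : 1 <= r by rewrite /r -(sqrtr1 R) ler_wsqrtr.
have r0 : 0 < r by apply: lt_le_trans r1.
have rr : r ^+ 2 = k by rewrite /r sqr_sqrtr ?ltW.
elim: K => [|K IH].
  rewrite expr0 mul1r /V/= subrr scaler0 addr0.
  have := sm z0 zs; rewrite zs0 dot0l addr0.
  by move: (enorm _ ^+ 2) (h z0) (h zs) => e a b; lra.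
rewrite [_ ^+ K.+1]exprS -[X in _ <= X]mulrA /=; move: IH; case: (agd_state _ _ _ _ _) => z y IH.
have q0 : 0 <= 1 - r^-1 by rewrite subr_ge0 invf_le1.
apply: (le_trans _ (ler_wpM2l q0 IH)) => {IH}.
rewrite /V /=; set g := grad h y.
set z' := y - (k * m)^-1 *: g; set y' := z' + _.
(* Update of the mirror sequence; the momentum is chosen so that [momentum k * (r + 1) = r - 1]. *)
have Ey : y' + r *: (y' - z') - zs =
    (y - zs) + (r - 1) *: (y - z) - (r / (k * m)) *: g.
  have -> : y' - z' = momentum k *: (z' - z) by rewrite /y' addrAC subrr add0r.
  have mr : momentum k * (r + 1) = r - 1.
    by rewrite /momentum -/r divfK// gt_eqF// ltr_wpDl// ltW.
  have -> : y' + r *: (momentum k *: (z' - z)) = z' + (r - 1) *: (z' - z).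
    by rewrite -mr mulrDr mulr1 scalerDl scalerA /y' -addrA (addrC (_ *: _)) mulrC.
  rewrite /z'; apply/rowP => i; rewrite !mxE; field.
  by rewrite !gt_eqF.
have Ez : y + r *: (y - z) - zs = (y - zs) + r *: (y - z) by rewrite addrAC.
have i1 : h z' <= h y - (k * m)^-1 / 2 * dot g g.
  have zy : z' - y = - ((k * m)^-1 *: g) by rewrite /z' addrAC subrr add0r.
  have := sm z' y; rewrite zy enorm_sqr !dotE -/g.
  move=> /le_trans; apply; rewrite le_eqVlt; apply/orP; left; apply/eqP; field.
  by rewrite !gt_eqF.
have i2 : h y - dot g (y - z) + m / 2 * dot (y - z) (y - z) <= h z.
  by have := sc z y; rewrite enormB enorm_sqr -(opprB y z) dotNr.
have i3 : h y - dot g (y - zs) + m / 2 * dot (y - zs) (y - zs) <= h zs.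
  by have := sc zs y; rewrite enormB enorm_sqr -(opprB y zs) dotNr.
rewrite Ey Ez; move: (y - zs) (y - z) i2 i3 => a b i2 i3.
have b0 := dot_ge0 b.
rewrite !enorm_sqr !dotE (dotC g a) (dotC g b) (dotC b a) in i2 i3 *.
move: (dot a a) (dot a b) (dot a g) (dot b b) (dot b g) (dot g g) b0 i1 i2 i3.
move=> aa ab ag bb bg gg b0.
move: (h z') (h z) (h zs) (h y) => hz' hz hs hy i1 i2 i3.
rewrite -rr in i1 *.
have rq : r * (1 - r^-1) = r - 1 by rewrite mulrBr mulr1 divff ?gt_eqF.
rewrite -(ler_pM2l r0) [X in _ <= X]mulrA rq.
have i2' := ler_wpM2l (_ : 0 <= r - 1) i2.
rewrite subr_ge0 in i2'; have {}i2' := i2' r1.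
have i1' := ler_wpM2l (ltW r0) i1.
have i4 : 0 <= m / 2 * (r - 1) * (r + 1) * bb.
  by rewrite !mulr_ge0 ?subr_ge0 ?addr_ge0 ?invr_ge0 ?(ltW m0) ?(ltW r0).
rewrite -subr_ge0.
apply: (le_trans (_ : 0 <= (r * (hy - (r ^+ 2 * m)^-1 / 2 * gg) - r * hz') +
  ((r - 1) * hz - (r - 1) * (hy - bg + m / 2 * bb)) + (hs - (hy - ag + m / 2 * aa)) +
  m / 2 * (r - 1) * (r + 1) * bb)); first by move: i1' i2' i3 i4; lra.
rewrite le_eqVlt; apply/orP; left; apply/eqP; field.
by rewrite !gt_eqF.
Qed.

Lemma agd_rate z0 K :
  enorm (AGD h z0 K (k * m)^-1 (momentum k) - zs) ^+ 2 <=
  (k + 1) * (1 - (Num.sqrt k)^-1) ^+ K * enorm (z0 - zs) ^+ 2.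
Proof.
have := agd_lyapunov z0 K; rewrite /V /AGD.
have := sc (agd_state h z0 (k * m)^-1 (momentum k) K).1 zs; rewrite zs0 dot0l addr0.
set e := enorm (_ - zs) ^+ 2; set x := h _; set e2 := enorm _ ^+ 2; set e3 := enorm _ ^+ 2.
rewrite -/r; move: (_ ^+ K) => c H1 H2.
have : m / 2 * e <= m / 2 * ((k + 1) * c * e3).
  have : 0 <= m / 2 * e2 by rewrite mulr_ge0 ?sqr_ge0 ?divr_ge0 ?ltW.
  by move: H1 H2; move: (m / 2 * e2) => w; lra.
by rewrite ler_pM2l// divr_gt0.
Qed.

End AcceleratedGradient.

Lemma natceil_ge (R : realType) (a : R) : a <= (natceil a)%:R.
Proof.
rewrite /natceil; set c := Num.max _ _.
have c0 : 0 <= c by rewrite le_max lexx.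
rewrite -[X in _ <= X]/((absz c)%:~R) gez0_abs//.
by rewrite (le_trans (ceil_ge _))// ler_int le_max lexx orbT.
Qed.

(** [k] is the condition number that sets the momentum and [k2 >= k] the one in the step count: both
    inner loops share the count for [3 kappa], while the lower-level loop runs with [kappa]. *)
Lemma agd_accuracy (R : realType) n (h : 'rV[R]_n -> R) (m k k2 e d : R) zs z0 :
  0 < m -> 1 <= k -> k <= k2 -> sc_lower m h (grad h) ->
  smooth_upper (k * m) h (grad h) -> grad h zs = 0 -> 0 < e ->
  enorm (z0 - zs) <= d ->
  enorm (AGD h z0 (natceil (2 * Num.sqrt k2 * ln (Num.sqrt (k2 + 1) / e * d)))
    (k * m)^-1 (momentum k) - zs) <= e.
Proof.
move=> m0 k1 kk2 sc sm zs0 e0 zd; set K := natceil _.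
have k0 : 0 < k by apply: lt_le_trans k1.
have k20 : 0 < k2 by apply: lt_le_trans kk2.
have sk0 : 0 < Num.sqrt k by rewrite sqrtr_gt0.
have sk20 : 0 < Num.sqrt k2 by rewrite sqrtr_gt0.
have sk1 : 1 <= Num.sqrt k by rewrite -(sqrtr1 R) ler_wsqrtr.
rewrite -ler_sqr ?nnegrE ?enorm_ge0 ?(ltW e0)//.
apply: (le_trans (agd_rate m0 k1 sc sm zs0 z0 K)).
(* If [d <= 0] the start is already the minimizer, so the value of the logarithm is irrelevant. *)
have [d0|d0] := lerP d 0.
  have -> : enorm (z0 - zs) = 0.
    by apply/le_anti; rewrite enorm_ge0 (le_trans zd d0).
  by rewrite expr0n mulr0 sqr_ge0.
set A := Num.sqrt (k2 + 1) / e * d.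
have s0 : 0 < Num.sqrt (k2 + 1) by rewrite sqrtr_gt0 ltr_wpDl// ltW.
have A0 : 0 < A by rewrite !mulr_gt0 ?invr_gt0.
have q0 : 0 <= 1 - (Num.sqrt k)^-1 by rewrite subr_ge0 invf_le1.
(* [(1 - 1/sqrt k)^K <= exp (- K / sqrt k)]. The rate bounds a squared norm, hence the target [A^-2]
   and the 2 in the step count; for [ln A < 0] the bound holds with any [K]. *)
have qK : (1 - (Num.sqrt k)^-1) ^+ K <= (A ^+ 2)^-1.
  apply: (@le_trans _ _ (expR (- (Num.sqrt k)^-1) ^+ K)).
    by rewrite lerXn2r ?nnegrE ?expR_ge0// expR_ge1Dx.
  rewrite -expRM_natl mulrN expRN lef_pV2 ?posrE ?expR_gt0 ?exprn_gt0//.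
  rewrite -[A in leLHS]lnK ?posrE// -expRM_natl ler_expR.
  rewrite ler_pdivlMr//; have [lA|lA] := lerP 0 (ln A).
    apply: (le_trans _ (natceil_ge _)); rewrite -/A.
    by rewrite [leLHS]mulrC mulrA [_ * 2]mulrC ler_wpM2r// ler_wpM2l// ler_wsqrtr.
  by rewrite (@le_trans _ _ 0)// mulrAC pmulr_rle0 ?mulr_gt0// ltW.
have A2 : A ^+ 2 = (k2 + 1) / e ^+ 2 * d ^+ 2.
  by rewrite !exprMn exprVn sqr_sqrtr// addr_ge0 ?(ltW k20).
have zd2 : enorm (z0 - zs) ^+ 2 <= d ^+ 2 by rewrite lerXn2r ?nnegrE ?enorm_ge0 ?(ltW d0).
have k10 : 0 <= k + 1 by rewrite addr_ge0 ?(ltW k0).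
apply: (@le_trans _ _ ((k + 1) * (A ^+ 2)^-1 * d ^+ 2)).
  by rewrite ler_pM ?sqr_ge0 ?(mulr_ge0 k10) ?exprn_ge0// ler_wpM2l.
have -> : (k + 1) * (A ^+ 2)^-1 * d ^+ 2 = (k + 1) / (k2 + 1) * e ^+ 2.
  by rewrite A2; field; rewrite !gt_eqF// ltr_wpDl// ltW.
rewrite ler_piMl ?sqr_ge0// ler_pdivrMr ?mul1r ?lerD2r//.
by rewrite ltr_wpDl ?(ltW k20).
Qed.

(** * Derivatives identified from quadratic remainders *)

Section QuadraticRemainder.
Variable R : realType.

Lemma quad_grad n (h : 'rV[R]_n -> R) x G C :
  (forall u, `|h (x + u) - h x - dot G u| <= C * enorm u ^+ 2) ->
  differentiable h x /\ grad h x = G.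
Proof.
move=> H.
have linG : linear (fun u => dot G u : R^o) by move=> a u v; rewrite dotDr dotZr.
pose GL := GRing.isLinear.Build _ _ _ _ _ linG.
pose L : {linear 'rV[R]_n -> R^o} := HB.pack (fun u => dot G u : R^o) GL.
have [||dh dE] := @quad_differentiable R _ _ (h : _ -> R^o) L x (enorm G * n%:R) (`|C| * n%:R ^+ 2).
- move=> u; rewrite (le_trans (normr_dot_le _ _))// -mulrA ler_wpM2l ?enorm_ge0//.
  exact: enorm_le_normr.
- move=> u; apply: (le_trans (H u)); rewrite (le_trans (ler_wpM2r (sqr_ge0 _) (ler_norm _)))//.
  rewrite -mulrA ler_wpM2l// -exprMn lerXn2r ?nnegrE ?enorm_ge0 ?mulr_ge0//.
  exact: enorm_le_normr.
split=> //; apply/rowP => i; rewrite mxE deriveE// dE /= /dot (bigD1 i)//= big1.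
  by rewrite mxE !eqxx mulr1 addr0.
by move=> j ji; rewrite mxE (negbTE ji) andbF mulr0.
Qed.

Lemma quad_jacobian n m (F : 'rV[R]_n -> 'rV[R]_m) x J C :
  (forall u, enorm (F (x + u) - F x - u *m J) <= C * enorm u ^+ 2) ->
  differentiable F x /\ jacobian F x = J.
Proof.
move=> H; have [c c0 Jc] := opb_exists J.
have [||dF dE] := @quad_differentiable R _ _ F (mulmxr J) x (c * n%:R) (`|C| * n%:R ^+ 2).
- move=> u; rewrite (le_trans (normr_le_enorm _))// (le_trans (Jc _))// -mulrA ler_wpM2l//.
  exact: enorm_le_normr.
- move=> u; rewrite (le_trans (normr_le_enorm _))//.
  apply: (le_trans (H u)); rewrite (le_trans (ler_wpM2r (sqr_ge0 _) (ler_norm _)))//.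
  rewrite -mulrA ler_wpM2l// -exprMn lerXn2r ?nnegrE ?enorm_ge0 ?mulr_ge0//.
  exact: enorm_le_normr.
by split=> //; apply: mulmx_inj => u; rewrite -diff_jacobian dE.
Qed.

Lemma lipschitz_for_ge0 n m (F : 'rV[R]_n -> 'rV[R]_m) L : (0 < n)%N ->
  lipschitz_for (@enorm R m) L F -> 0 <= L.
Proof.
case: n F => // n F _ FL; pose e : 'rV[R]_n.+1 := delta_mx 0 ord0.
have e0 : e != 0.
  by apply/eqP => /rowP/(_ ord0)/eqP; rewrite !mxE !eqxx oner_eq0.
have := FL e 0; rewrite subr0 => /(le_trans (enorm_ge0 _)).
by rewrite pmulr_lge0// enorm_gt0.
Qed.

End QuadraticRemainder.

(* G and H are the gradient and Hessian of h; keeping them as free functions stops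
   unification from unfolding the library's derivatives. *)
Record C2fun (R : realType) n (h : 'rV[R]_n -> R) (G : 'rV[R]_n -> 'rV[R]_n)
    (H : 'rV[R]_n -> 'M[R]_n) (L r : R) : Prop := {
  c2_L0 : 0 <= L;
  c2_r0 : 0 <= r;
  c2_taylor1 : forall z u, `|h (z + u) - h z - dot (G z) u| <= L / 2 * enorm u ^+ 2;
  c2_taylor2 : forall z u, enorm (G (z + u) - G z - u *m H z) <= r / 2 * enorm u ^+ 2;
  c2_lip : forall z z', enorm (G z - G z') <= L * enorm (z - z');
  c2_hlip : forall z z', opb (H z - H z') (r * enorm (z - z'));
  c2_bound : forall z, opb (H z) L;
  c2_sym : forall z, (H z)^T = H z
}.

Lemma c2_intro (R : realType) n (h : 'rV[R]_n -> R) (L r : R) : 0 <= L -> 0 <= r ->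
  (forall z, differentiable h z) -> (forall z, differentiable (grad h) z) ->
  lipschitz_for (@enorm R n) L (grad h) ->
  (forall z z', opb (hess h z - hess h z') (r * enorm (z - z'))) ->
  C2fun h (grad h) (hess h) L r.
Proof.
move=> L0 r0 dh dG lip hlip.
have T2 z u : enorm (grad h (z + u) - grad h z - u *m hess h z) <= r / 2 * enorm u ^+ 2.
  by apply: (taylor_jacobian dG r0); exact: hlip.
split=> //.
- by move=> z u; apply: taylor_grad.
- by apply: (lipschitz_jacobian_bound dG r0); [exact: hlip|exact: lip].
- move=> z; apply/sym_mxP/(@second_derivative_sym _ _ h (grad h) _ z (r / 2)); last exact: T2.
  by move=> z' u t; apply/is_derive_line_fun/dh.
Qed.

Section C2Theory.
Variables (R : realType) (n : nat) (h : 'rV[R]_n -> R).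
Variables (G : 'rV[R]_n -> 'rV[R]_n) (H : 'rV[R]_n -> 'M[R]_n) (L r : R).
Hypothesis C : C2fun h G H L r.

Lemma c2_grad_bound c z : (forall z z', `|h z - h z'| <= c * enorm (z - z')) -> 0 <= c ->
  enorm (G z) <= c.
Proof.
move=> hc c0; apply: enorm_leP => //; set v := G z.
apply: (@le_limit0 _ _ _ (L / 2 * enorm v ^+ 2)) => t /andP[t0 _].
rewrite -(ler_pM2l t0).
have := c2_taylor1 C z (t *: v); have := hc (z + t *: v) z.
rewrite (addrC z) addrK enormZ (gtr0_norm t0) dotZr -/v !ler_norml.
move=> /andP[_ h1] /andP[h2 _]; move: h1 h2; move: (h _) (h z) (dot _ _) (enorm v) => a b d e.
by nra.
Qed.

End C2Theory.

Lemma scalerB2 (R : pzRingType) (V : lmodType R) (a : R) (x x' y y' : V) :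
  x + a *: y - (x' + a *: y') = (x - x') + a *: (y - y').
Proof. by rewrite scalerBr opprD addrACA. Qed.

Lemma c2_add (R : realType) n (f g : 'rV[R]_n -> R) Gf Gg Hf Hg (Lf Lg rf rg a : R) :
  0 <= a -> C2fun f Gf Hf Lf rf -> C2fun g Gg Hg Lg rg ->
  C2fun (fun z => f z + a * g z) (fun z => Gf z + a *: Gg z) (fun z => Hf z + a *: Hg z)
    (Lf + a * Lg) (rf + a * rg).
Proof.
move=> a0 Cf Cg; split.
- by rewrite addr_ge0 ?mulr_ge0 ?(c2_L0 Cf) ?(c2_L0 Cg).
- by rewrite addr_ge0 ?mulr_ge0 ?(c2_r0 Cf) ?(c2_r0 Cg).
- move=> z u; rewrite dotDl dotZl.
  have -> : f (z + u) + a * g (z + u) - (f z + a * g z) -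
     (dot (Gf z) u + a * dot (Gg z) u) =
     (f (z + u) - f z - dot (Gf z) u) + a * (g (z + u) - g z - dot (Gg z) u) by ring.
  have -> : (Lf + a * Lg) / 2 * enorm u ^+ 2 =
    Lf / 2 * enorm u ^+ 2 + a * (Lg / 2 * enorm u ^+ 2) by ring.
  rewrite (le_trans (ler_normD _ _))// lerD//; first exact: c2_taylor1 Cf z u.
  rewrite normrM (ger0_norm a0) ler_wpM2l//; exact: c2_taylor1 Cg z u.
- move=> z u; rewrite mulmxDr -scalemxAr !scalerB2.
  have -> : (rf + a * rg) / 2 * enorm u ^+ 2 =
    rf / 2 * enorm u ^+ 2 + a * (rg / 2 * enorm u ^+ 2) by ring.
  rewrite ler_enormD//; first exact: c2_taylor2 Cf z u.
  rewrite enormZ (ger0_norm a0) ler_wpM2l//; exact: c2_taylor2 Cg z u.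
- move=> z z'; rewrite scalerB2 mulrDl ler_enormD//; first exact: (c2_lip Cf).
  rewrite enormZ (ger0_norm a0) -mulrA ler_wpM2l//; exact: (c2_lip Cg).
- move=> z z'; rewrite scalerB2 mulrDl; apply: opbD; first exact: (c2_hlip Cf).
  by rewrite -mulrA -{2}(ger0_norm a0); apply: opbZ; exact: (c2_hlip Cg).
- move=> z; apply: opbD; first exact: (c2_bound Cf).
  by rewrite -{2}(ger0_norm a0); apply: opbZ; exact: (c2_bound Cg).
- by move=> z; rewrite linearD linearZ/= (c2_sym Cf) (c2_sym Cg).
Qed.

(** [T z u] is the third derivative contracted once with [u]. With linearity, [c3_sym] and [c3_swap]
    make it a fully symmetric trilinear form; its bound [r] is the Lipschitz constant of the
    Hessian. *)
Record C3fun (R : realType) n (H : 'rV[R]_n -> 'M[R]_n)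
    (T : 'rV[R]_n -> 'rV[R]_n -> 'M[R]_n) (r nu : R) : Prop := {
  c3_taylor : forall z u, opb (H (z + u) - H z - T z u) (nu / 2 * enorm u ^+ 2);
  c3_linear : forall z, linear (T z);
  c3_bound : forall z u, opb (T z u) (r * enorm u);
  c3_sym : forall z u, (T z u)^T = T z u;
  c3_swap : forall z u v, u *m T z v = v *m T z u
}.

Section ThirdDerivative.
Variables (R : realType) (n : nat).
Variables (G : 'rV[R]_n -> 'rV[R]_n) (H : 'rV[R]_n -> 'M[R]_n).
Variables (T : 'rV[R]_n -> {linear 'rV[R]_n -> 'M[R]_n}) (r nu : R).
Hypotheses
  (dG : forall z u b (t : R), is_derive t 1 (fun t : R => dot (G (z + t *: u)) b)
    (dot (u *m H (z + t *: u)) b))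
  (Hlip : forall z z', opb (H z - H z') (r * enorm (z - z')))
  (Hsym : forall z, (H z)^T = H z)
  (HT : forall z u, opb (H (z + u) - H z - T z u) (nu / 2 * enorm u ^+ 2)).

Let Tbound z u : opb (T z u) (r * enorm u).
Proof.
move=> v; apply: (@le_limit0 _ _ _ (nu / 2 * enorm u ^+ 2 * enorm v)) => t /andP[t0 _].
rewrite -(ler_pM2l t0).
have -> : t * enorm (v *m T z u) = enorm (v *m T z (t *: u)).
  by rewrite linearZ -scalemxAr enormZ gtr0_norm.
have -> : T z (t *: u) = (H (z + t *: u) - H z) -
    (H (z + t *: u) - H z - T z (t *: u)) by rewrite opprB addrC subrK.
rewrite mulmxBr (le_trans (ler_enormB (Hlip _ _ _) (HT _ _ _)))//.
rewrite (line_sub _ _ (ltW t0)) enormZ gtr0_norm//.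
by rewrite le_eqVlt; apply/orP; left; apply/eqP; ring.
Qed.

Let Tsym z u : (T z u)^T = T z u.
Proof.
apply: sym_mxP => a b.
suff le v w : dot (v *m T z u) w <= dot (w *m T z u) v by apply/le_anti; rewrite !le.
apply: (@le_limit0 _ _ _ (nu * enorm u ^+ 2 * enorm v * enorm w)) => t /andP[t0 _].
rewrite -(ler_pM2l t0).
have B v' w' : `|dot (v' *m (H (z + t *: u) - H z)) w' -
    t * dot (v' *m T z u) w'| <= nu / 2 * (t ^+ 2 * enorm u ^+ 2) * enorm v' * enorm w'.
  rewrite -dotZl scalemxAr -linearZ -dotNl -dotDl -mulmxBr (le_trans (normr_dot_le _ _))//.
  rewrite ler_wpM2r ?enorm_ge0// (le_trans (HT _ _ _))//.
  by rewrite enormZ gtr0_norm// exprMn.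
have S z1 z2 v' w' : dot (v' *m (H z1 - H z2)) w' = dot (w' *m (H z1 - H z2)) v'.
  by rewrite dot_mulmx dotC linearB/= !Hsym.
have := B v w; have := B w v; rewrite (S _ _ w v) !ler_norml => /andP[h1 h2] /andP[h3 h4].
by nra.
Qed.

(** For the swap, fix [b] and view [b *m H z] as the gradient of the scalar function
    [z |-> dot (G z) b]; its second derivative [w |-> b *m T z w] is then symmetric by
    [second_derivative_sym]. *)
Lemma c3_intro : C3fun H T r nu.
Proof.
split=> // [z a u v|z u v]; first exact: linearP.
apply: dot_inj => b.
have D a c : dot (c *m T z a) b = dot (b *m T z a) c.
  by rewrite dot_mulmx Tsym dotC.
rewrite (D v u) (D u v).
pose J := lin1_mx (mulmx b \o T z).
have SJ w : w *m J = b *m T z w by rewrite mul_rV_lin1.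
rewrite -(SJ v) -(SJ u).
have D1 z' w (t : R) : is_derive t 1 (fun t : R => dot (G (z' + t *: w)) b)
    (dot (b *m H (z' + t *: w)) w).
  by rewrite dot_mulmx Hsym dotC; exact: dG.
have D2 w : enorm (b *m H (z + w) - b *m H z - w *m J) <= nu / 2 * enorm b * enorm w ^+ 2.
  by rewrite SJ -!mulmxBr mulrAC; exact: HT.
exact: (@second_derivative_sym _ _ (fun z => dot (G z) b) (fun z => b *m H z) J z _ D1 D2).
Qed.

End ThirdDerivative.

(** * Parametric minimization *)

Lemma row_mxB (R : pzRingType) m n p (a c : 'M[R]_(m, n)) (b d : 'M[R]_(m, p)) :
  row_mx a b - row_mx c d = row_mx (a - c) (b - d).
Proof. by rewrite opp_row_mx add_row_mx. Qed.

Lemma rsubmxB (R : pzRingType) m n p (a b : 'M[R]_(m, n + p)) :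
  rsubmx (a - b) = rsubmx a - rsubmx b.
Proof. exact: linearB. Qed.

Lemma sub_telescope (V : zmodType) (x x' p q r s : V) :
  x - p - (x' - s) = (x - x') - ((p - q) + (q - r) + (r - s)).
Proof. by rewrite !addrA !subrK !opprB addrACA [RHS]addrACA (addrC (- p)). Qed.

(** The lower left block is replaced by the transpose of the upper right one, as in the Hessian
    estimator; on symmetric matrices this is the Schur complement of the yy block. *)
Definition schur_mx (R : realType) dx dy (M : 'M[R]_(dx + dy)) : 'M[R]_dx :=
  ulsubmx M - ursubmx M *m invmx (drsubmx M) *m (ursubmx M)^T.

(** Telescope the product, with [B^-1 - B'^-1 = B^-1 (B' - B) B'^-1] in the middle. The factor is
    [(1 + a b)^2], which for the Hessian of the penalty reproduces [C2]. *)
Lemma schur_mx_lip (R : realType) dx dy (M M' : 'M[R]_(dx + dy)) a b e :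
  0 <= a -> 0 <= b -> 0 <= e -> opb M a -> opb M' a -> opb (M - M') e ->
  drsubmx M \in unitmx -> drsubmx M' \in unitmx ->
  opb (invmx (drsubmx M)) b -> opb (invmx (drsubmx M')) b ->
  opb (schur_mx M - schur_mx M') (e * (1 + 2 * (a * b) + (a * b) ^+ 2)).
Proof.
move=> a0 b0 e0 Ma Ma' Me uM uM' Mb Mb'.
have [_ Aa _ _] := opb_blocks a0 Ma; have [_ Aa' _ _] := opb_blocks a0 Ma'.
have [] := opb_blocks e0 Me.
have E1 : ulsubmx (M - M') = ulsubmx M - ulsubmx M'
    by apply/matrixP => i j; rewrite !mxE.
have E2 : ursubmx (M - M') = ursubmx M - ursubmx M'
    by apply/matrixP => i j; rewrite !mxE.
have E3 : drsubmx (M - M') = drsubmx M - drsubmx M'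
    by apply/matrixP => i j; rewrite !mxE.
rewrite E1 E2 E3 /schur_mx; move: (ulsubmx M) (ulsubmx M') => X X'.
move: (ursubmx M) (ursubmx M') (drsubmx M) (drsubmx M') uM uM' Mb Mb' Aa Aa'.
move=> A A' B B' uB uB' Bb Bb' Aa Aa' Xe Ae _ Be.
have -> : X - A *m invmx B *m A^T - (X' - A' *m invmx B' *m A'^T) =
   (X - X') - ((A - A') *m invmx B *m A^T + A' *m (invmx B *m (B' - B) *m invmx B') *m A^T
   + A' *m invmx B' *m (A - A')^T).
  have -> : invmx B *m (B' - B) *m invmx B' = invmx B - invmx B'.
    by rewrite mulmxBr mulmxBl mulVmx// mul1mx mulmxK.
  have -> : (A - A')^T = A^T - A'^T by exact: linearB.
  rewrite !mulmxBl !mulmxBr !mulmxBl.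
  exact: sub_telescope.
have Be' : opb (B' - B) e by rewrite -opprB; apply: opbN.
have -> : e * (1 + 2 * (a * b) + (a * b) ^+ 2) =
  e + (e * b * a + a * (b * e * b) * a + a * b * e) by ring.
have At := opb_tr a0 Aa; have ABt := opb_tr e0 Ae.
apply: opbB => //; apply: opbD; first apply: opbD.
- by apply: (opbM a0 _ At); exact: opbM.
- apply: (opbM a0 _ At); apply: opbM => //; first by rewrite !mulr_ge0.
  by apply: opbM => //; exact: opbM.
- by apply: opbM => //; exact: opbM.
Qed.

Section ParametricMinimization.
Variables (R : realType) (dx dy : nat) (q : 'rV[R]_(dx + dy) -> R).
Variables (G : 'rV[R]_(dx + dy) -> 'rV[R]_(dx + dy)) (H : 'rV[R]_(dx + dy) -> 'M[R]_(dx + dy)).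
Variables (L r m : R) (ysol : 'rV[R]_dx -> 'rV[R]_dy).
Hypotheses (C : C2fun q G H L r) (m0 : 0 < m)
  (sc : forall x, sc_lower m (fun y => q (row_mx x y)) (fun y => rsubmx (G (row_mx x y))))
  (hys : forall x, rsubmx (G (row_mx x (ysol x))) = 0).

Definition graph_pt x := row_mx x (ysol x).

Local Notation Z := graph_pt.
Local Notation A x := (ursubmx (H (Z x))).
Local Notation B x := (drsubmx (H (Z x))).

(* The derivative of [graph_pt]. *)
Definition graph_jac x : 'M[R]_(dx, dx + dy) := row_mx 1%:M (- (A x *m invmx (B x))).

Local Notation J := graph_jac.

Definition schur x : 'M[R]_dx := schur_mx (H (Z x)).

(** Strong monotonicity of the gradient for the displacement [t v], linearized, divided by [t^2], as
    [t] tends to 0. *)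
Lemma hess_yy_coercive z v : m * enorm v ^+ 2 <= dot v (v *m drsubmx (H z)).
Proof.
apply: (@le_limit0 _ _ _ (r / 2 * enorm v ^+ 3)) => t /andP[t0 _].
have t2 : 0 < t ^+ 2 by rewrite exprn_gt0.
rewrite -(ler_pM2l t2).
pose x := lsubmx z; pose y := rsubmx z; pose w := row_mx (0 : 'rV[R]_dx) (t *: v).
have Ez : z = row_mx x y by rewrite hsubmxK.
have := sc_lower_monotone (y + t *: v) y (sc x).
have -> : y + t *: v - y = t *: v by rewrite addrAC subrr add0r.
have Ew : row_mx x (y + t *: v) = z + w by rewrite Ez add_row_mx addr0.
rewrite Ew -Ez enormZ (gtr0_norm t0) => h1.
have h2 := c2_taylor2 C z w.
have h3 : dot (rsubmx (G (z + w)) - rsubmx (G z)) (t *: v) = dot (G (z + w) - G z) w.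
  by rewrite -[G (z + w)]hsubmxK -[G z]hsubmxK row_mxB dot_row_mx dot0r add0r !row_mxKr.
have h4 : dot (w *m H z) w = t ^+ 2 * dot v (v *m drsubmx (H z)).
  rewrite /w -{1}[H z]submxK mul_row_block !mul0mx !add0r dot_row_mx dot0r add0r.
  by rewrite -scalemxAl dotZl dotZr dotC; ring.
have h5 : dot (G (z + w) - G z) w - dot (w *m H z) w <= r / 2 * enorm w ^+ 2 * enorm w.
  rewrite -dotNl -dotDl (le_trans (dot_le _ _))// ler_wpM2r ?enorm_ge0//.
have ew : enorm w = t * enorm v by rewrite enorm_row_0mx enormZ gtr0_norm.
rewrite h3 in h1; rewrite h4 ew in h5; move: h1 h5.
by move: (dot v _) (dot _ w) (enorm v) => a b e; nra.
Qed.

Lemma hess_yy_unit z : drsubmx (H z) \in unitmx.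
Proof. by apply: (coercive_unitmx m0) => v; exact: hess_yy_coercive. Qed.

Lemma hess_yy_inv z : opb (invmx (drsubmx (H z))) m^-1.
Proof. by apply: (opb_coercive_inv m0) => v; exact: hess_yy_coercive. Qed.

Lemma hess_yy_ge z v : m * enorm v <= enorm (v *m drsubmx (H z)).
Proof.
have := hess_yy_inv z (v *m drsubmx (H z)); rewrite mulmxK ?hess_yy_unit//.
by rewrite mulrC ler_pdivlMr// mulrC.
Qed.

Lemma grad_y_ge x y y' :
  m * enorm (y - y') <= enorm (rsubmx (G (row_mx x y)) - rsubmx (G (row_mx x y'))).
Proof.
have := le_trans (sc_lower_monotone y y' (sc x)) (dot_le _ _).
have := enorm_ge0 (y - y'); have := enorm_ge0 (rsubmx (G (row_mx x y)) - rsubmx (G (row_mx x y'))).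
move: (enorm (y - y')) (enorm (rsubmx _ - _)) => e a a0 e0.
have [->|e1] := eqVneq e 0; first by move=> _; rewrite mulr0.
have {}e1 : 0 < e by rewrite lt_def e1.
by rewrite expr2 mulrA ler_pM2r.
Qed.

(** Measure both solutions at the same [x]: the gradient at [ysol x] vanishes, and the one at
    [ysol x'] differs from its zero value at [x'] by at most [L |x - x'|]. *)
Lemma ysol_lip x x' : enorm (ysol x - ysol x') <= L / m * enorm (x - x').
Proof.
rewrite mulrAC ler_pdivlMr// mulrC (le_trans (grad_y_ge x _ _))// hys sub0r enormN.
rewrite -[rsubmx _]subr0 -(hys x') -rsubmxB.
rewrite (le_trans (enorm_rsubmx _))// (le_trans (c2_lip C _ _))//.
by rewrite row_mxB subrr enorm_row_mx0.
Qed.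

Lemma hess_block x : H (Z x) = block_mx (ulsubmx (H (Z x))) (A x) (A x)^T (B x).
Proof. by rewrite trmx_ursub (c2_sym C) submxK. Qed.

Lemma hess_yy_sym x : (B x)^T = B x.
Proof. by rewrite trmx_drsub (c2_sym C). Qed.

(** Block elimination: [graph_jac] is exactly the choice that annihilates the y-block. Hence
    vertical vectors die in [vert_hess_jac], the cancellation behind all second-order estimates
    below. *)
Lemma hess_graph_jac x : H (Z x) *m (J x)^T = col_mx (schur x) 0.
Proof.
rewrite {1}hess_block /J tr_row_mx trmx1 linearN/= trmx_mul trmx_inv hess_yy_sym.
rewrite mul_block_col !mulmx1 !mulmxN !mulmxA mulmxV ?hess_yy_unit// mul1mx subrr.
by [].
Qed.

Lemma graph_jac_hess x : J x *m H (Z x) *m (J x)^T = schur x.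
Proof. by rewrite -mulmxA hess_graph_jac mul_row_col mul1mx mulmx0 addr0. Qed.

Lemma vert_hess_jac x (b : 'rV[R]_dy) : row_mx (0 : 'rV_dx) b *m H (Z x) *m (J x)^T = 0.
Proof. by rewrite -mulmxA hess_graph_jac mul_row_col mul0mx mulmx0 addr0. Qed.

Lemma horiz_hess_jac x (u : 'rV[R]_dx) : row_mx u (0 : 'rV_dy) *m H (Z x) *m (J x)^T = u *m schur x.
Proof. by rewrite -mulmxA hess_graph_jac mul_row_col mul0mx addr0. Qed.

Lemma horiz_jac x (u : 'rV[R]_dx) : row_mx u (0 : 'rV_dy) *m (J x)^T = u.
Proof. by rewrite tr_row_mx mul_row_col trmx1 mulmx1 mul0mx addr0. Qed.

Lemma graph_jac_bound x : opb (J x) (1 + L / m).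
Proof.
move=> u; rewrite mul_mx_row mulmx1 mulrDl mul1r (le_trans (enorm_row_mx_le _ _))// lerD2l.
have [_ Ab _ _] := opb_blocks (c2_L0 C) (c2_bound C (Z x)).
by rewrite mulmxN enormN; apply: (opbM _ Ab (hess_yy_inv _)); rewrite invr_ge0 ltW.
Qed.

Lemma graph_jac_tr_bound x : opb (J x)^T (1 + L / m).
Proof.
by apply: opb_tr (graph_jac_bound x); rewrite addr_ge0// divr_ge0 ?(c2_L0 C) ?ltW.
Qed.

Lemma graph_lip x x' : enorm (Z x - Z x') <= (1 + L / m) * enorm (x - x').
Proof.
rewrite row_mxB (le_trans (enorm_row_mx_le _ _))// mulrDl mul1r lerD2l.
exact: ysol_lip.
Qed.

(** A quantitative implicit function theorem. The error [b] is purely vertical, and [b *m B x] is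
    minus the y-part of the Taylor remainder of [G] because [G] has zero y-part at both graph
    points; then divide by the coercivity constant. *)
Lemma graph_quad x u : enorm (Z (x + u) - Z x - u *m J x) <=
  r / 2 * (1 + L / m) ^+ 2 / m * enorm u ^+ 2.
Proof.
set w := Z (x + u) - Z x.
have Ew : w = row_mx u (ysol (x + u) - ysol x) by rewrite /w row_mxB addrAC subrr add0r.
set d := ysol _ - ysol _ in Ew.
have -> : w - u *m J x = row_mx (0 : 'rV_dx) (d + u *m A x *m invmx (B x)).
  by rewrite Ew mul_mx_row mulmx1 row_mxB subrr mulmxN opprK mulmxA.
rewrite enorm_row_0mx; set b := d + _.
rewrite mulrAC ler_pdivlMr// mulrC (le_trans (hess_yy_ge (Z x) _))//.
have -> : b *m B x = - rsubmx (G (Z x + w) - G (Z x) - w *m H (Z x)).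
  have E1 : Z x + w = Z (x + u) by rewrite /w addrC subrK.
  rewrite E1 !rsubmxB !hys subrr sub0r opprK.
  rewrite /b mulmxDl mulmxKV ?hess_yy_unit//.
  by rewrite Ew [X in rsubmx (_ *m X)]hess_block mul_row_block row_mxKr addrC.
rewrite enormN (le_trans (enorm_rsubmx _))// (le_trans (c2_taylor2 C _ _))//.
rewrite -[leRHS]mulrA -exprMn ler_wpM2l ?divr_ge0 ?(c2_r0 C)//.
have := graph_lip (x + u) x; rewrite addrAC subrr add0r => h.
by rewrite lerXn2r ?nnegrE ?enorm_ge0// (le_trans (enorm_ge0 _) h).
Qed.

Lemma value_quad x u : `|q (Z (x + u)) - q (Z x) - dot (lsubmx (G (Z x))) u| <=
  L / 2 * (1 + L / m) ^+ 2 * enorm u ^+ 2.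
Proof.
have := c2_taylor1 C (Z x) (Z (x + u) - Z x); rewrite (addrC (Z x)) subrK.
have -> : dot (G (Z x)) (Z (x + u) - Z x) = dot (lsubmx (G (Z x))) u.
  rewrite -{1}[G _]hsubmxK hys row_mxB dot_row_mx dot0l addr0.
  by rewrite (addrAC x) subrr add0r.
move=> /le_trans; apply; rewrite -[leRHS]mulrA -exprMn ler_wpM2l ?divr_ge0 ?(c2_L0 C)//.
have := graph_lip (x + u) x; rewrite (addrAC x) subrr add0r => h.
by rewrite lerXn2r ?nnegrE ?enorm_ge0// (le_trans (enorm_ge0 _) h).
Qed.

(** On the graph [G] is horizontal, so multiplying its Taylor remainder by the fixed matrix
    [(J x)^T] leaves the x-gradients unchanged, while the unknown vertical part of the increment is
    killed. *)
Lemma value_grad_quad x u :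
  enorm (lsubmx (G (Z (x + u))) - lsubmx (G (Z x)) - u *m schur x) <=
  r / 2 * (1 + L / m) ^+ 3 * enorm u ^+ 2.
Proof.
set w := Z (x + u) - Z x.
have Ew : w = row_mx u (0 : 'rV_dy) + row_mx (0 : 'rV_dx) (ysol (x + u) - ysol x).
  by rewrite /w row_mxB (addrAC x) subrr !add0r add_row_mx addr0 add0r.
have -> : lsubmx (G (Z (x + u))) - lsubmx (G (Z x)) - u *m schur x =
    (G (Z x + w) - G (Z x) - w *m H (Z x)) *m (J x)^T.
  have wJ : w *m H (Z x) *m (J x)^T = u *m schur x.
    by rewrite Ew !mulmxDl horiz_hess_jac vert_hess_jac addr0.
  rewrite mulmxBl mulmxBl wJ /w (addrC (Z x)) subrK; congr (_ - _ - _).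
  - by rewrite -{2}[G _]hsubmxK hys horiz_jac.
  - by rewrite -{2}[G _]hsubmxK hys horiz_jac.
rewrite (le_trans (graph_jac_tr_bound _ _))//.
have c0 : 0 <= 1 + L / m by rewrite addr_ge0// divr_ge0 ?(c2_L0 C) ?(ltW m0).
have -> : r / 2 * (1 + L / m) ^+ 3 * enorm u ^+ 2 =
  (1 + L / m) * (r / 2 * ((1 + L / m) * enorm u) ^+ 2) by ring.
rewrite ler_wpM2l// (le_trans (c2_taylor2 C _ _))//.
rewrite ler_wpM2l ?divr_ge0 ?(c2_r0 C)//.
have := graph_lip (x + u) x; rewrite (addrAC x) subrr add0r => h.
by rewrite lerXn2r ?nnegrE ?enorm_ge0// (le_trans (enorm_ge0 _) h).
Qed.

Lemma slice_quad x y u : `|q (row_mx x (y + u)) - q (row_mx x y)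
    - dot (rsubmx (G (row_mx x y))) u| <= L / 2 * enorm u ^+ 2.
Proof.
have := c2_taylor1 C (row_mx x y) (row_mx 0 u).
by rewrite add_row_mx addr0 enorm_row_0mx -{1}[G _]hsubmxK dot_row_mx dot0r add0r.
Qed.

(** The additive constant accommodates the term [- lambda g(x, ys x)] of the penalty function, which
    does not depend on [y]. *)
Lemma slice_smooth x c :
  smooth_upper L (fun y => q (row_mx x y) + c) (fun y => rsubmx (G (row_mx x y))).
Proof.
move=> y y'; have := slice_quad x y' (y - y'); rewrite (addrC y') subrK ler_norml => /andP[_].
by move: (q _) (q _) (dot _ _) (L / 2 * _) => a b d e; lra.
Qed.

Lemma slice_grad x c y : differentiable (fun y => q (row_mx x y) + c) y /\
  grad (fun y => q (row_mx x y) + c) y = rsubmx (G (row_mx x y)).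
Proof.
apply: (@quad_grad _ _ _ _ _ (L / 2)) => u; have := slice_quad x y u.
by rewrite opprD addrACA subrr addr0.
Qed.

Lemma slice_argmin x c : argmin (fun y => q (row_mx x y) + c) (ysol x).
Proof.
move=> y; rewrite lerD2r; have := sc x y (ysol x); rewrite hys dot0l addr0.
by apply: le_trans; rewrite lerDl mulr_ge0 ?sqr_ge0// divr_ge0 ?(ltW m0).
Qed.

(** Completing the square: [h *m J x] is orthogonal to vertical vectors for the form [H], and the
    vertical remainder contributes a nonnegative term. *)
Lemma schur_le x h b : dot h (h *m schur x) <= dot (row_mx h b) (row_mx h b *m H (Z x)).
Proof.
set p := h *m J x; pose c := b + h *m A x *m invmx (B x).
have -> : row_mx h b = p + row_mx (0 : 'rV_dx) c.
  rewrite /p mul_mx_row mulmx1 mulmxN mulmxA add_row_mx addr0 /c.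
  by rewrite addrC addrK.
have pc : dot p (row_mx (0 : 'rV_dx) c *m H (Z x)) = 0.
  by rewrite /p dot_mulmx vert_hess_jac dot0r.
have cp : dot (row_mx (0 : 'rV_dx) c) (p *m H (Z x)) = 0.
  by rewrite dotC dot_mulmx (c2_sym C).
have pp : dot p (p *m H (Z x)) = dot h (h *m schur x).
  by rewrite {1}/p dot_mulmx /p -(graph_jac_hess x) !mulmxA.
have cc : dot (row_mx (0 : 'rV_dx) c) (row_mx (0 : 'rV_dx) c *m H (Z x)) = dot c (c *m B x).
  by rewrite {1}hess_block mul_row_block !mul0mx !add0r dot_row_mx dot0l add0r.
rewrite mulmxDl !dotDl !dotDr pc cp pp cc addr0 add0r lerDl.
by rewrite (le_trans _ (hess_yy_coercive _ _))// mulr_ge0 ?sqr_ge0 ?(ltW m0).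
Qed.

End ParametricMinimization.

(** * The penalty function and the hyper-objective *)

Section Penalty.
Variables (R : realType) (dx dy : nat).
Variables (f g : 'rV[R]_(dx + dy) -> R) (Gf Gg : 'rV[R]_(dx + dy) -> 'rV[R]_(dx + dy)).
Variables (Hf Hg : 'rV[R]_(dx + dy) -> 'M[R]_(dx + dy)).
Variables (T : 'rV[R]_(dx + dy) -> 'rV[R]_(dx + dy) -> 'M[R]_(dx + dy)).
Variables (c ell rho nu mu lam : R) (ys yl : 'rV[R]_dx -> 'rV[R]_dy).
Hypotheses (Cf : C2fun f Gf Hf ell rho) (Cg : C2fun g Gg Hg ell rho)
  (C3 : C3fun Hg T rho nu) (nu0 : 0 <= nu).
Hypotheses (mu0 : 0 < mu) (lam0 : 0 < lam) (c0 : 0 <= c) (lam_ge : 2 * ell / mu <= lam)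
  (flip : forall z z', `|f z - f z'| <= c * enorm (z - z'))
  (scg : forall x, sc_lower mu (fun y => g (row_mx x y)) (fun y => rsubmx (Gg (row_mx x y))))
  (hys : forall x, rsubmx (Gg (row_mx x (ys x))) = 0).

Definition pen z := f z + lam * g z.
Definition pen_grad z := Gf z + lam *: Gg z.
Definition pen_hess z := Hf z + lam *: Hg z.

Local Notation Q := pen.
Local Notation GQ := pen_grad.
Local Notation HQ := pen_hess.

Hypothesis hyl : forall x, rsubmx (GQ (row_mx x (yl x))) = 0.

Lemma pen_c2 : C2fun Q GQ HQ (ell + lam * ell) (rho + lam * rho).
Proof. by apply: c2_add => //; exact: ltW. Qed.

(** The curvature of [f] is at least [- ell], and [lam mu - ell >= lam mu / 2] by [lam_ge]. *)
Lemma pen_sc x :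
  sc_lower (lam * mu / 2) (fun y => Q (row_mx x y)) (fun y => rsubmx (GQ (row_mx x y))).
Proof.
move=> u v; have := slice_quad Cf x v (u - v); rewrite (addrC v) subrK ler_norml => /andP[+ _].
have := scg x u v.
have -> : rsubmx (GQ (row_mx x v)) =
    rsubmx (Gf (row_mx x v)) + lam *: rsubmx (Gg (row_mx x v)).
  by apply/rowP => i; rewrite !mxE.
rewrite dotDl dotZl /Q.
have e0 := sqr_ge0 (enorm (u - v)).
move: lam_ge; rewrite ler_pdivrMr// => lm.
move: (f _) (f _) (g _) (g _) (dot _ _) (dot _ _) (_ ^+ 2) e0 => fu fv gu gv dg df e e0.
move=> h1 h2; have := ler_wpM2l (ltW lam0) h1; have := ler_wpM2r e0 lm; nra.
Qed.

Let lm0 : 0 < lam * mu / 2. Proof. by rewrite divr_gt0// mulr_gt0. Qed.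

Local Notation Zs := (graph_pt ys).
Local Notation Zl := (graph_pt yl).
Local Notation Js := (graph_jac Hg ys).
Local Notation r1 := (1 + ell / mu).

Let ell0 : 0 <= ell := c2_L0 Cf.
Let rho0 : 0 <= rho := c2_r0 Cf.
Let r1_ge0 : 0 <= r1. Proof. by rewrite addr_ge0// divr_ge0// ltW. Qed.

Lemma grad_f_bound z : enorm (Gf z) <= c.
Proof. exact: (c2_grad_bound Cf). Qed.

(** At [ys x] only [f] contributes to the y-gradient of the penalty, so that gradient is at most [c]
    and is divided by the modulus [lam mu / 2]. *)
Lemma ys_yl_dist x : enorm (yl x - ys x) <= 2 * c / (lam * mu).
Proof.
have := grad_y_ge pen_sc x (yl x) (ys x); rewrite hyl sub0r enormN.
have -> : rsubmx (GQ (row_mx x (ys x))) = rsubmx (Gf (row_mx x (ys x))).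
  apply/rowP => i; rewrite !mxE.
  by have /rowP/(_ i) := hys x; rewrite !mxE => ->; rewrite mulr0 addr0.
move=> /le_trans/(_ (le_trans (enorm_rsubmx _) (grad_f_bound _))).
rewrite ler_pdivlMr ?mulr_gt0//; lra.
Qed.

Definition pen_value x := Q (Zl x) - lam * g (Zs x).
Definition pen_value_grad x := lsubmx (GQ (Zl x)) - lam *: lsubmx (Gg (Zs x)).
Definition pen_value_hess x := schur HQ yl x - lam *: schur Hg ys x.

Lemma pen_value_differentiable x :
  differentiable pen_value x /\ grad pen_value x = pen_value_grad x.
Proof.
pose K1 := (ell + lam * ell) / 2 * (1 + (ell + lam * ell) / (lam * mu / 2)) ^+ 2.
pose K2 := ell / 2 * r1 ^+ 2.
apply: (@quad_grad _ _ _ _ _ (K1 + lam * K2)) => u.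
have := value_quad pen_c2 lm0 pen_sc hyl x u.
have := value_quad Cg mu0 scg hys x u.
rewrite -/K1 -/K2 /pen_value /pen_value_grad dotDl dotNl dotZl.
move: (Q _) (Q _) (g _) (g _) (dot _ _) (dot _ _) (enorm u ^+ 2).
move=> q' q g' g0 d1 d2 e; rewrite !ler_norml => /andP[h1 h2] /andP[h3 h4].
have := ler_wpM2l (ltW lam0) h1; have := ler_wpM2l (ltW lam0) h2 => k1 k2.
by apply/andP; split; lra.
Qed.

Lemma pen_value_grad_differentiable x :
  differentiable (grad pen_value) x /\ hess pen_value x = pen_value_hess x.
Proof.
have E : grad pen_value = pen_value_grad.
  by apply: funext => z; case: (pen_value_differentiable z).
pose K1 := (rho + lam * rho) / 2 * (1 + (ell + lam * ell) / (lam * mu / 2)) ^+ 3.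
pose K2 := rho / 2 * r1 ^+ 3.
rewrite /hess E; apply: (@quad_jacobian _ _ _ _ _ _ (K1 + lam * K2)) => u.
have h1 := value_grad_quad pen_c2 lm0 pen_sc hyl x u.
have h2 := value_grad_quad Cg mu0 scg hys x u.
rewrite /pen_value_grad /pen_value_hess mulmxBr -scalemxAr.
have -> : forall a a' b b' p q : 'rV[R]_dx,
    a - lam *: b - (a' - lam *: b') - (p - lam *: q) =
    (a - a' - p) - lam *: (b - b' - q).
  by move=> *; apply/rowP => i; rewrite !mxE; ring.
rewrite mulrDl ler_enormB// enormZ gtr0_norm// -mulrA ler_wpM2l// ltW//.
Qed.

Definition phi_grad x := Gf (Zs x) *m (Js x)^T.

(* The Lagrange multiplier of the lower-level optimality condition. *)
Definition multiplier x : 'rV[R]_dy := rsubmx (Gf (Zs x)) *m invmx (drsubmx (Hg (Zs x))).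

Definition phi_hess x :=
  Js x *m (Hf (Zs x) - T (Zs x) (row_mx 0 (multiplier x))) *m (Js x)^T.

Lemma phi_differentiable x : differentiable (fun x => f (Zs x)) x /\
  grad (fun x => f (Zs x)) x = phi_grad x.
Proof.
pose K1 := ell / 2 * r1 ^+ 2; pose K2 := rho / 2 * r1 ^+ 2 / mu.
apply: (@quad_grad _ _ _ _ _ (K1 + c * K2)) => u.
have h1 := c2_taylor1 Cf (Zs x) (Zs (x + u) - Zs x).
rewrite (addrC (Zs x)) subrK in h1.
have h2 := graph_quad Cg mu0 scg hys x u.
have -> : f (Zs (x + u)) - f (Zs x) - dot (phi_grad x) u =
   (f (Zs (x + u)) - f (Zs x) - dot (Gf (Zs x)) (Zs (x + u) - Zs x)) +
   dot (Gf (Zs x)) (Zs (x + u) - Zs x - u *m Js x).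
  by rewrite /phi_grad [dot _ (_ - _ - _)]dotDr dotNr dot_mulmx trmxK; ring.
rewrite (le_trans (ler_normD _ _))// mulrDl lerD//.
  apply: (le_trans h1); rewrite -[leRHS]mulrA -exprMn ler_wpM2l ?divr_ge0//.
  have h := graph_lip Cg mu0 scg hys (x + u) x.
  rewrite (addrAC x) subrr add0r in h.
  by rewrite lerXn2r ?nnegrE ?enorm_ge0// (le_trans (enorm_ge0 _) h).
rewrite (le_trans (normr_dot_le _ _))// -mulrA ler_pM ?enorm_ge0//.
exact: grad_f_bound.
Qed.

(* This form of the gradient of phi makes phi_grad_differentiable easy: the increment of
   the multiplier is killed by vert_hess_jac. *)
Lemma grad_multiplier x :
  Gf (Zs x) - row_mx 0 (multiplier x) *m Hg (Zs x) = row_mx (phi_grad x) 0.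
Proof.
have E : rsubmx (Gf (Zs x) - row_mx 0 (multiplier x) *m Hg (Zs x)) = 0.
  rewrite rsubmxB (hess_block ys Cg x) mul_row_block row_mxKr mul0mx add0r.
  by rewrite /multiplier mulmxKV ?subrr// (hess_yy_unit Cg mu0 scg).
have E2 : (Gf (Zs x) - row_mx 0 (multiplier x) *m Hg (Zs x)) *m (Js x)^T = phi_grad x.
  by rewrite mulmxBl (vert_hess_jac ys Cg mu0 scg) subr0.
rewrite -E2 -[LHS]hsubmxK E; congr row_mx.
by rewrite -{2}[Gf _ - _]hsubmxK E horiz_jac.
Qed.

Lemma multiplier_bound x : enorm (multiplier x) <= c / mu.
Proof.
rewrite /multiplier (le_trans (hess_yy_inv Cg mu0 scg _ _))// mulrC ler_pM2r ?invr_gt0//.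
by rewrite (le_trans (enorm_rsubmx _))// grad_f_bound.
Qed.

(** Multiply the increment by the invertible block at [x]: it becomes the increment of the
    y-gradient of [f] minus the new multiplier times the increment of the block. *)
Lemma multiplier_lip x u :
  enorm (multiplier (x + u) - multiplier x) <= (ell + rho * (c / mu)) * r1 / mu * enorm u.
Proof.
rewrite mulrAC ler_pdivlMr// mulrC.
rewrite (le_trans (hess_yy_ge Cg mu0 scg (Zs x) _))//.
have vB x' : multiplier x' *m drsubmx (Hg (Zs x')) = rsubmx (Gf (Zs x')).
  by rewrite /multiplier mulmxKV// (hess_yy_unit Cg mu0 scg).
have -> : (multiplier (x + u) - multiplier x) *m drsubmx (Hg (Zs x)) =
    rsubmx (Gf (Zs (x + u)) - Gf (Zs x)) -
    multiplier (x + u) *m drsubmx (Hg (Zs (x + u)) - Hg (Zs x)).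
  have -> : drsubmx (Hg (Zs (x + u)) - Hg (Zs x)) =
      drsubmx (Hg (Zs (x + u))) - drsubmx (Hg (Zs x)).
    by apply/matrixP => i j; rewrite !mxE.
  by rewrite rsubmxB mulmxBl mulmxBr !vB opprB [RHS]addrC addrA subrK.
have h := graph_lip Cg mu0 scg hys (x + u) x; rewrite (addrAC x) subrr add0r in h.
rewrite -mulrA mulrDl ler_enormB//.
  rewrite (le_trans (enorm_rsubmx _))// (le_trans (c2_lip Cf _ _))// ler_wpM2l//.
have k0 : 0 <= rho * enorm (Zs (x + u) - Zs x) by rewrite mulr_ge0 ?enorm_ge0.
have [_ _ _ hB] := opb_blocks k0 (c2_hlip Cg (Zs (x + u)) (Zs x)).
rewrite (le_trans (hB _))// mulrAC.
rewrite ler_pM ?mulr_ge0 ?enorm_ge0// ler_wpM2l//.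
exact: multiplier_bound.
Qed.

Lemma phi_grad_differentiable x :
  differentiable (grad (fun x => f (Zs x))) x /\ hess (fun x => f (Zs x)) x = phi_hess x.
Proof.
have E : grad (fun x => f (Zs x)) = phi_grad.
  by apply: funext => z; case: (phi_differentiable z).
rewrite /hess E.
pose Lv := (ell + rho * (c / mu)) * r1 / mu.
pose b := c / mu.
pose K := rho / 2 * r1 ^+ 2 + nu / 2 * r1 ^+ 2 * b + rho * r1 * Lv +
  (ell + rho * b) * (rho / 2 * r1 ^+ 2 / mu).
apply: (@quad_jacobian _ _ _ _ _ _ (r1 * K)) => u.
set Z' := Zs (x + u); set Z := Zs x; set w := Z' - Z.
set v' := multiplier (x + u); set v := multiplier x.
have w1 : enorm w <= r1 * enorm u.
  by have := graph_lip Cg mu0 scg hys (x + u) x; rewrite (addrAC x) subrr add0r.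
have w2 : enorm (w - u *m Js x) <= rho / 2 * r1 ^+ 2 / mu * enorm u ^+ 2.
  exact: graph_quad Cg mu0 scg hys x u.
have lT a : linear (T a) by exact: c3_linear C3 a.
pose V (a : 'rV[R]_dy) : 'rV[R]_(dx + dy) := row_mx 0 a.
have VD a a' : V (a - a') = V a - V a' by rewrite /V row_mxB subrr.
have EV a : enorm (V a) = enorm a by exact: enorm_row_0mx.
pose F := Hf Z - T Z (V v).
(* By [grad_multiplier] both gradients are horizontal rows, so the same [(Js x)^T] serves at [x + u]
   and at [x]. Subtracting the vanishing term [V (v' - v) *m Hg Z *m (Js x)^T] and swapping
   arguments of [T] leaves four groups, each of second order in [u]. *)
have key : phi_grad (x + u) - phi_grad x - u *m phi_hess x =
   ((Gf Z' - Gf Z - w *m Hf Z) - V v' *m (Hg Z' - Hg Z - T Z w) - V (v' - v) *m T Z w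
    + (w - u *m Js x) *m F) *m (Js x)^T.
  have e1 : phi_grad (x + u) - phi_grad x =
      (Gf Z' - V v' *m Hg Z' - (Gf Z - V v *m Hg Z)) *m (Js x)^T.
    by rewrite !grad_multiplier row_mxB subrr horiz_jac.
  have e2 : V (v' - v) *m Hg Z *m (Js x)^T = 0 by exact: (vert_hess_jac ys Cg mu0 scg).
  have e3 : u *m phi_hess x = u *m Js x *m F *m (Js x)^T by rewrite /phi_hess !mulmxA.
  rewrite e1 e3 -mulmxBl -[LHS]addr0 -e2 -mulmxDl; congr (_ *m _).
  have e4 : w *m F = w *m Hf Z - V v *m T Z w by rewrite /F mulmxBr (c3_swap C3).
  rewrite [(w - _) *m F]mulmxBl e4 !VD !mulmxBl !mulmxBr.
  move: (V v' *m Hg Z') (V v' *m Hg Z) (V v *m Hg Z) => a1 a2 a3.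
  move: (V v' *m T Z w) (V v *m T Z w) => a4 a5.
  move: (w *m Hf Z) (u *m Js x *m F) (Gf Z') (Gf Z) => a6 a7 a8 a9.
  by apply/rowP => i; rewrite !mxE; ring.
rewrite key (le_trans (graph_jac_tr_bound ys Cg mu0 scg x _))// -mulrA ler_wpM2l//.
have w1s : enorm w ^+ 2 <= r1 ^+ 2 * enorm u ^+ 2.
  by rewrite -exprMn lerXn2r ?nnegrE ?enorm_ge0 ?mulr_ge0 ?enorm_ge0.
have bv' : enorm v' <= b by exact: multiplier_bound.
have bv : enorm v <= b by exact: multiplier_bound.
have b0 : 0 <= b := le_trans (enorm_ge0 _) bv.
rewrite /K 3!mulrDl; apply: ler_enormD; first apply: ler_enormB; first apply: ler_enormB.
- have := c2_taylor2 Cf Z w; rewrite (addrC Z) subrK => /le_trans; apply.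
  by rewrite -[leRHS]mulrA ler_wpM2l// divr_ge0.
- have := c3_taylor C3 Z w (V v'); rewrite (addrC Z) subrK => /le_trans; apply.
  rewrite EV; have -> : nu / 2 * r1 ^+ 2 * b * enorm u ^+ 2 =
    nu / 2 * (r1 ^+ 2 * enorm u ^+ 2) * b by ring.
  apply: ler_pM => //; last by rewrite ler_wpM2l ?divr_ge0.
    by rewrite mulr_ge0 ?sqr_ge0 ?divr_ge0.
  exact: enorm_ge0.
- rewrite (le_trans (c3_bound C3 _ _ _))// EV.
  have -> : rho * r1 * Lv * enorm u ^+ 2 = (rho * (r1 * enorm u)) * (Lv * enorm u) by ring.
  rewrite ler_pM ?enorm_ge0 ?mulr_ge0 ?enorm_ge0//; first by rewrite ler_wpM2l.
  exact: multiplier_lip.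
- have Fb : opb F (ell + rho * b).
    apply: opbB; first exact: (c2_bound Cf).
    apply: opbW (c3_bound C3 _ _); first by rewrite EV ler_wpM2l.
  rewrite (le_trans (Fb _))// -[leRHS]mulrA ler_wpM2l// addr_ge0// mulr_ge0//.
Qed.

Local Notation dist x := (enorm (yl x - ys x)).

Lemma pen_value_le_phi x : pen_value x <= f (Zs x).
Proof.
have := slice_argmin lm0 pen_sc hyl x 0 (ys x); rewrite !addr0 /pen_value /pen /graph_pt.
lra.
Qed.

Lemma phi_le_pen_value x : f (Zs x) <= pen_value x + c ^+ 2 / (2 * (lam * mu)).
Proof.
have h1 := scg x (yl x) (ys x); rewrite hys dot0l addr0 in h1.
have := flip (Zs x) (Zl x); rewrite row_mxB subrr enorm_row_0mx enormB ler_norml.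
move=> /andP[_ h2]; rewrite /pen_value /pen.
have lm : 0 < lam * mu by rewrite mulr_gt0.
have h3 := ler_wpM2l (ltW lam0) h1.
(* The possible gain of [f] against the quadratic growth of [lam * g]: Young's inequality. *)
have h4 : c * dist x <= c ^+ 2 / (2 * (lam * mu)) + lam * mu / 2 * dist x ^+ 2.
  rewrite -subr_ge0.
  have -> : c ^+ 2 / (2 * (lam * mu)) + lam * mu / 2 * dist x ^+ 2 - c * dist x =
    (c - lam * mu * dist x) ^+ 2 / (2 * (lam * mu)) by field; rewrite !gt_eqF.
  by rewrite divr_ge0 ?sqr_ge0// mulr_ge0// ltW.
move: h2 h3 h4; rewrite /graph_pt.
by move: (f _) (f _) (g _) (g _) (dist x) (c ^+ 2 / _) => a1 a2 a3 a4 a5 a6; nra.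
Qed.

Lemma pen_value_grad_row x :
  GQ (Zl x) - lam *: Gg (Zs x) = row_mx (pen_value_grad x) 0.
Proof.
rewrite -[LHS]hsubmxK; congr row_mx; first by apply/rowP => i; rewrite !mxE.
by rewrite rsubmxB hyl sub0r; apply/rowP => i; have /rowP/(_ i) := hys x; rewrite !mxE => ->;
  rewrite mulr0 oppr0.
Qed.

Lemma Zl_sub_Zs x : Zl x - Zs x = row_mx 0 (yl x - ys x).
Proof. by rewrite row_mxB subrr. Qed.

(** After multiplication by [(Js x)^T] the term [W *m Hg (Zs x)] can be inserted for free, since [W]
    is vertical; it turns the increment of [Gg] into a Taylor remainder, so that [lam] multiplies
    only [dist^2]. *)
Lemma grad_gap x : enorm (pen_value_grad x - phi_grad x) <=
  r1 * (ell * dist x + lam * (rho / 2 * dist x ^+ 2)).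
Proof.
set W := Zl x - Zs x.
have -> : pen_value_grad x - phi_grad x =
    ((Gf (Zl x) - Gf (Zs x)) + lam *: (Gg (Zl x) - Gg (Zs x) - W *m Hg (Zs x))) *m (Js x)^T.
  have e0 : W *m Hg (Zs x) *m (Js x)^T = 0.
    by rewrite /W Zl_sub_Zs (vert_hess_jac ys Cg mu0 scg).
  have e1 : pen_value_grad x = row_mx (pen_value_grad x) 0 *m (Js x)^T by rewrite horiz_jac.
  rewrite scalerBr addrA mulmxBl -scalemxAl e0 scaler0 subr0.
  rewrite e1 -pen_value_grad_row /phi_grad -mulmxBl; congr (_ *m _).
  rewrite /pen_grad; move: (Gf (Zl x)) (Gf (Zs x)) (Gg (Zl x)) (Gg (Zs x)) => *.
  by apply/rowP => i; rewrite !mxE; ring.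
rewrite (le_trans (graph_jac_tr_bound ys Cg mu0 scg x _))// ler_wpM2l// ler_enormD//.
  by rewrite (le_trans (c2_lip Cf _ _))// Zl_sub_Zs enorm_row_0mx.
rewrite enormZ gtr0_norm// ler_wpM2l ?(ltW lam0)//.
have := c2_taylor2 Cg (Zs x) W; rewrite (addrC (Zs x)) subrK => /le_trans; apply.
by rewrite /W Zl_sub_Zs enorm_row_0mx.
Qed.

(** The optimality conditions at [yl x] and [ys x], linearized at [Zs x]: multiplied by the yy block
    of [Hg], the left side is minus the y-part of the remainder met in [grad_gap]. *)
Lemma multiplier_gap x : enorm (lam *: (yl x - ys x) + multiplier x) <=
  (ell * dist x + lam * (rho / 2 * dist x ^+ 2)) / mu.
Proof.
rewrite ler_pdivlMr// mulrC (le_trans (hess_yy_ge Cg mu0 scg (Zs x) _))//.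
set W := Zl x - Zs x; set B := drsubmx _.
have vB : multiplier x *m B = rsubmx (Gf (Zs x)).
  by rewrite /multiplier mulmxKV// (hess_yy_unit Cg mu0 scg).
have WB : (yl x - ys x) *m B = rsubmx (W *m Hg (Zs x)).
  by rewrite /W Zl_sub_Zs (hess_block ys Cg x) mul_row_block row_mxKr mul0mx add0r.
have -> : (lam *: (yl x - ys x) + multiplier x) *m B =
   - rsubmx ((Gf (Zl x) - Gf (Zs x)) + lam *: (Gg (Zl x) - Gg (Zs x) - W *m Hg (Zs x))).
  rewrite mulmxDl -scalemxAl WB vB.
  have E1 := hyl x; have E2 := hys x; rewrite -/(Zl x) -/(Zs x) in E1 E2.
  move: E1 E2; rewrite /pen_grad.
  move: (W *m _) (Gf (Zl x)) (Gf (Zs x)) (Gg (Zl x)) (Gg (Zs x)) => w a1 a2 b1 b2 E1 E2.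
  apply/rowP => i; have /rowP/(_ i) := E1; have /rowP/(_ i) := E2; rewrite !mxE => e1 e2.
  by rewrite e1; lra.
rewrite enormN (le_trans (enorm_rsubmx _))// ler_enormD//.
  by rewrite (le_trans (c2_lip Cf _ _))// Zl_sub_Zs enorm_row_0mx.
rewrite enormZ gtr0_norm// ler_wpM2l ?(ltW lam0)//.
have := c2_taylor2 Cg (Zs x) W; rewrite (addrC (Zs x)) subrK => /le_trans; apply.
by rewrite /W Zl_sub_Zs enorm_row_0mx.
Qed.

(* The Schur complement minimizes the quadratic form over the y-component, so testing the
   penalty Hessian along the graph of ys can only increase it; the reverse inequality is
   not needed for a lower bound on phi_hess. *)
Lemma hess_gap x h : dot h (h *m pen_value_hess x) <= dot h (h *m phi_hess x) +
  r1 ^+ 2 * (rho * dist x + lam * (nu / 2 * dist x ^+ 2) +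
    rho * ((ell * dist x + lam * (rho / 2 * dist x ^+ 2)) / mu)) * enorm h ^+ 2.
Proof.
set err := (X in _ ^+ 2 * X * _).
set W := Zl x - Zs x; set p := h *m Js x.
pose V := row_mx (0 : 'rV[R]_dx) (multiplier x).
have [b pb] : exists b, p = row_mx h b.
  exists (h *m - (ursubmx (Hg (Zs x)) *m invmx (drsubmx (Hg (Zs x))))).
  by rewrite /p mul_mx_row mulmx1.
have h1 := schur_le yl pen_c2 lm0 pen_sc x h b; rewrite -pb in h1.
have h2 : dot h (h *m schur Hg ys x) = dot p (p *m Hg (Zs x)).
  by rewrite -(graph_jac_hess ys Cg mu0 scg x) !mulmxA dot_mulmx_tr trmxK dotC.
have h3 : dot h (h *m phi_hess x) = dot p (p *m (Hf (Zs x) - T (Zs x) V)).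
  by rewrite /phi_hess !mulmxA dot_mulmx_tr trmxK dotC.
rewrite [p *m (_ - _)]mulmxBr dotDr dotNr in h3.
(* The first-order term [lam T W] of the expansion of [lam Hg] joins the multiplier term [T V] of
   the Hessian of phi; neither is small, but their sum is, by [multiplier_gap]. *)
pose D := (Hf (Zl x) - Hf (Zs x)) + lam *: (Hg (Zl x) - Hg (Zs x) - T (Zs x) W)
  + T (Zs x) (lam *: W + V).
have ED : HQ (Zl x) - lam *: Hg (Zs x) - (Hf (Zs x) - T (Zs x) V) = D.
  rewrite /D (c3_linear C3) /pen_hess.
  move: (Hf (Zl x)) (Hf (Zs x)) (Hg (Zl x)) (Hg (Zs x)) (T _ W) (T _ V) => *.
  by apply/matrixP => i j; rewrite !mxE; ring.
have W0 : enorm W = dist x by rewrite /W Zl_sub_Zs enorm_row_0mx.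
have Db : opb D err.
  apply: opbD; first apply: opbD.
  - by have := c2_hlip Cf (Zl x) (Zs x); rewrite -/W W0.
  - rewrite -{2}(gtr0_norm lam0); apply: opbZ.
    by have := c3_taylor C3 (Zs x) W; rewrite (addrC (Zs x)) subrK W0.
  - apply: opbW (c3_bound C3 _ _); rewrite ler_wpM2l//.
    have -> : lam *: W + V = row_mx 0 (lam *: (yl x - ys x) + multiplier x).
      by rewrite /W Zl_sub_Zs /V scale_row_mx scaler0 add_row_mx addr0.
    by rewrite enorm_row_0mx; exact: multiplier_gap.
have err0 : 0 <= err.
  have := ell0; have := rho0; have := enorm_ge0 (yl x - ys x) => *.
  by rewrite !addr_ge0 ?mulr_ge0 ?addr_ge0 ?mulr_ge0 ?invr_ge0 ?(ltW mu0) ?(ltW lam0) ?exprn_ge0.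
have pD : dot p (p *m D) <= r1 ^+ 2 * err * enorm h ^+ 2.
  have ph : enorm p <= r1 * enorm h by exact: (graph_jac_bound ys Cg mu0 scg).
  rewrite (le_trans (dot_le _ _))//.
  have -> : r1 ^+ 2 * err * enorm h ^+ 2 = (r1 * enorm h) * (err * (r1 * enorm h)) by ring.
  rewrite ler_pM ?enorm_ge0// (le_trans (Db _))// ler_wpM2l//.
rewrite /pen_value_hess mulmxBr -scalemxAr dotDr dotNr dotZr h2 h3.
rewrite -ED !mulmxBr -scalemxAr !dotDr !dotNr dotZr in pD.
by move: h1 pD; rewrite (dotDr (p *m Hf (Zs x))) dotNr; lra.
Qed.

Definition grad_approx x y w :=
  lsubmx (GQ (row_mx x y)) - lam *: lsubmx (Gg (row_mx x w)).

Definition hess_approx x y w :=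
  schur_mx (HQ (row_mx x y)) - lam *: schur_mx (Hg (row_mx x w)).

Lemma grad_approx_error x y w : enorm (grad_approx x y w - pen_value_grad x) <=
  (ell + lam * ell) * enorm (y - yl x) + lam * (ell * enorm (w - ys x)).
Proof.
have -> : grad_approx x y w - pen_value_grad x =
    lsubmx (GQ (row_mx x y) - GQ (Zl x)) - lam *: lsubmx (Gg (row_mx x w) - Gg (Zs x)).
  rewrite /grad_approx /pen_value_grad.
  move: (GQ _) (GQ _) (Gg _) (Gg _) => *.
  by apply/rowP => i; rewrite !mxE; ring.
rewrite ler_enormB ?enormZ ?(gtr0_norm lam0) ?ler_wpM2l ?(ltW lam0)//.
  rewrite (le_trans (enorm_lsubmx _))// (le_trans (c2_lip pen_c2 _ _))//.
  by rewrite row_mxB subrr enorm_row_0mx.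
rewrite (le_trans (enorm_lsubmx _))// (le_trans (c2_lip Cg _ _))//.
by rewrite row_mxB subrr enorm_row_0mx.
Qed.

Lemma hess_approx_error x y w : opb (hess_approx x y w - pen_value_hess x)
  ((rho + lam * rho) * enorm (y - yl x) *
    (1 + 2 * ((ell + lam * ell) * (lam * mu / 2)^-1) + ((ell + lam * ell) * (lam * mu / 2)^-1) ^+ 2)
   + lam * (rho * enorm (w - ys x) * (1 + 2 * (ell * mu^-1) + (ell * mu^-1) ^+ 2))).
Proof.
have -> : hess_approx x y w - pen_value_hess x =
    (schur_mx (HQ (row_mx x y)) - schur_mx (HQ (Zl x))) -
    lam *: (schur_mx (Hg (row_mx x w)) - schur_mx (Hg (Zs x))).
  rewrite /hess_approx /pen_value_hess /schur.
  move: (schur_mx _) (schur_mx _) (schur_mx _) (schur_mx _) => *.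
  by apply/matrixP => i j; rewrite !mxE; ring.
apply: opbB.
  apply: schur_mx_lip.
  - exact: (c2_L0 pen_c2).
  - by rewrite invr_ge0 ltW.
  - by rewrite mulr_ge0 ?enorm_ge0 ?(c2_r0 pen_c2).
  - exact: (c2_bound pen_c2).
  - exact: (c2_bound pen_c2).
  - by have := c2_hlip pen_c2 (row_mx x y) (Zl x); rewrite row_mxB subrr enorm_row_0mx.
  - exact: (hess_yy_unit pen_c2 lm0 pen_sc).
  - exact: (hess_yy_unit pen_c2 lm0 pen_sc).
  - exact: (hess_yy_inv pen_c2 lm0 pen_sc).
  - exact: (hess_yy_inv pen_c2 lm0 pen_sc).
rewrite -[X in opb _ (X * _)](gtr0_norm lam0); apply: opbZ.
apply: schur_mx_lip.
- exact: (c2_L0 Cg).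
- by rewrite invr_ge0 ltW.
- by rewrite mulr_ge0 ?enorm_ge0.
- exact: (c2_bound Cg).
- exact: (c2_bound Cg).
- by have := c2_hlip Cg (row_mx x w) (Zs x); rewrite row_mxB subrr enorm_row_0mx.
- exact: (hess_yy_unit Cg mu0 scg).
- exact: (hess_yy_unit Cg mu0 scg).
- exact: (hess_yy_inv Cg mu0 scg).
- exact: (hess_yy_inv Cg mu0 scg).
Qed.

End Penalty.

(** * Cubic regularization *)

Section CubicModel.
Variables (R : realType) (n : nat) (g : 'rV[R]_n) (H : 'M[R]_n) (M : R) (s : 'rV[R]_n).
Hypotheses (M0 : 0 <= M) (Hsym : H^T = H) (smin : argmin (cubic_model g H M) s).

Local Notation e := (enorm s).

Lemma cubic_modelZ t : 0 <= t -> cubic_model g H M (t *: s) =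
  t * dot g s + 2^-1 * (t ^+ 2 * dot s (s *m H)) + M / 6 * (t ^+ 3 * e ^+ 3).
Proof.
by move=> t0; rewrite /cubic_model dotZr -scalemxAl dotZl dotZr enormZ ger0_norm// exprMn; ring.
Qed.

Lemma cubic_descent_direction : dot g s <= 0.
Proof.
have := smin (- s); rewrite /cubic_model mulNmx !dotE opprK enormN.
by move: (2^-1 * _) (M / 6 * _) (dot g s) => a b d; lra.
Qed.

(** Stationarity of the model along the ray through [s]: compare [s] with [(1 - t) s] for one
    inequality and with [(1 + t) s] for the other. *)
Lemma cubic_radial : dot g s + dot s (s *m H) + M / 2 * e ^+ 3 = 0.
Proof.
set a := dot g s; set b := dot s (s *m H).
have e0 := enorm_ge0 s.
have e3 : 0 <= e ^+ 3 by rewrite exprn_ge0.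
have P t : 0 <= t -> a + 2^-1 * b + M / 6 * e ^+ 3 <=
    t * a + 2^-1 * (t ^+ 2 * b) + M / 6 * (t ^+ 3 * e ^+ 3).
  move=> t0; rewrite -cubic_modelZ//; exact: smin.
have K0 : 0 <= `|b| + M * e ^+ 3 by rewrite addr_ge0 ?mulr_ge0.
have bn := ler_norm b; have bn' := ler_norm (- b); rewrite normrN in bn'.
have Me : 0 <= M * e ^+ 3 by rewrite mulr_ge0.
apply/le_anti/andP; split.
- apply: (@le_limit0 _ _ _ (`|b| + M * e ^+ 3)) => t /andP[t0 t1].
  have := P (1 - t); rewrite subr_ge0 => /(_ t1) h.
  rewrite -(ler_pM2l t0) add0r.
  have t2 : t ^+ 3 <= t ^+ 2 by rewrite [leLHS]exprS ler_piMl// sqr_ge0.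
  have t20 : 0 <= t ^+ 2 by rewrite sqr_ge0.
  have t30 : 0 <= t ^+ 3 by rewrite exprn_ge0 ?(ltW t0).
  have h2 : t ^+ 2 * b <= t ^+ 2 * `|b| by rewrite ler_wpM2l.
  have h3 : M * e ^+ 3 * t ^+ 3 >= 0 by rewrite mulr_ge0.
  have h4 : M * e ^+ 3 * t ^+ 2 >= 0 by rewrite mulr_ge0.
  have h5 : 0 <= t ^+ 2 * `|b| by rewrite mulr_ge0.
  by move: h h2 h3 h4 h5; move: (`|b|) (e ^+ 3) => x y; lra.
- rewrite -oppr_le0.
  apply: (@le_limit0 _ _ _ (`|b| + M * e ^+ 3)) => t /andP[t0 t1].
  have := P (1 + t); rewrite addr_ge0 ?(ltW t0)// => /(_ isT) h.
  rewrite -(ler_pM2l t0) add0r.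
  have t2 : t ^+ 3 <= t ^+ 2 by rewrite [leLHS]exprS ler_piMl// sqr_ge0.
  have t20 : 0 <= t ^+ 2 by rewrite sqr_ge0.
  have h2 : t ^+ 2 * b <= t ^+ 2 * `|b| by rewrite ler_wpM2l.
  have h3 : M * e ^+ 3 * t ^+ 3 <= M * e ^+ 3 * t ^+ 2 by rewrite ler_wpM2l.
  have h4 : M * e ^+ 3 * t ^+ 2 >= 0 by rewrite mulr_ge0.
  have h5 : 0 <= t ^+ 2 * `|b| by rewrite mulr_ge0.
  by move: h h2 h3 h4 h5; move: (`|b|) (e ^+ 3) => x y; lra.
Qed.

(** Eliminating the quadratic term with [cubic_radial] leaves [(g . s) / 2 - M |s|^3 / 12], and
    [g . s <= 0]. *)
Lemma cubic_model_min_le : cubic_model g H M s <= - (M / 12 * e ^+ 3).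
Proof.
have := cubic_radial; have := cubic_descent_direction; rewrite /cubic_model.
by move: (dot g s) (dot s _) (e ^+ 3) => a b x; nra.
Qed.

(** The optimality condition [g + s H = - (M/2) |s| s] in norm form. Testing [s + t v] and bounding
    [|s + t v|] by [|s| + t |v|] avoids differentiating the cubed norm. *)
Lemma cubic_stationary : enorm (g + s *m H) <= M / 2 * e ^+ 2.
Proof.
have e0 := enorm_ge0 s.
rewrite -enormN; apply: enorm_dual => [|v]; first by rewrite mulr_ge0 ?sqr_ge0 ?divr_ge0.
pose K := 2^-1 * `|dot v (v *m H)| + M / 6 * (3 * e * enorm v ^+ 2 + enorm v ^+ 3).
apply: (@le_limit0 _ _ _ K) => t /andP[t0 t1].
rewrite -(ler_pM2l t0).
have := smin (s + t *: v).
have vs : dot v (s *m H) = dot s (v *m H) by rewrite dot_mulmx_tr Hsym dotC.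
rewrite /cubic_model dotDr mulmxDl -scalemxAl !dotDl !dotDr !dotZl !dotZr vs.
rewrite dotNl dotDl (dotC (s *m H)) vs => h.
have n3 : enorm (s + t *: v) ^+ 3 <= (e + t * enorm v) ^+ 3.
  rewrite lerXn2r ?nnegrE ?enorm_ge0 ?addr_ge0 ?mulr_ge0 ?enorm_ge0 ?(ltW t0)//.
  by rewrite ler_enormD// enormZ gtr0_norm.
have h1 := ler_wpM2l (divr_ge0 M0 (ler0n R 6)) n3.
have v0 := enorm_ge0 v.
have t20 : 0 <= t ^+ 2 by rewrite sqr_ge0.
have h2 : t ^+ 2 * dot v (v *m H) <= t ^+ 2 * `|dot v (v *m H)|.
  by rewrite ler_wpM2l// ler_norm.
have h3 : M * enorm v ^+ 3 * t ^+ 3 <= M * enorm v ^+ 3 * t ^+ 2.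
  by rewrite ler_wpM2l ?mulr_ge0 ?exprn_ge0// [leLHS]exprS ler_piMl.
move: h h1 h2 h3; rewrite /K.
move: (dot g s) (dot g v) (dot s (v *m H)) (dot s (s *m H)) (dot v (v *m H)) `|_|.
move: (enorm v) (enorm s) (enorm (s + t *: v) ^+ 3).
move=> a1 a2 a3 a4 a5 a6 a7 a8 a9; lra.
Qed.

(* Compare s with s + t h and s - t h, where t is such that t |h| = r: the first-order
   terms cancel. *)
Lemma cubic_curvature r h : 0 < r -> e <= r ->
  - (8 / 3 * M * r) * enorm h ^+ 2 <= dot h (h *m H).
Proof.
move=> r0 er; have [->|h0] := eqVneq h 0.
  by rewrite enorm0 mul0mx dot0l expr0n mulr0.
have h1 := enorm_gt0 h0; pose t := r / enorm h.
have t0 : 0 < t by rewrite divr_gt0.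
have tr : t * enorm h = r by rewrite /t divfK// gt_eqF.
have e0 := enorm_ge0 s.
(* Both [s + U] and [s - U] have norm at most [2 r]; adding the two comparisons, the two cubic terms
   total at most [2 (M/6) (2 r)^3 = 8/3 M r^3]. Using a bound [r] for [|s|] makes [s = 0] no
   exception. *)
have P u : enorm u <= 2 * r -> M / 6 * enorm u ^+ 3 <= M / 6 * (8 * r ^+ 3).
  move=> ur; rewrite ler_wpM2l ?divr_ge0//.
  have -> : 8 * r ^+ 3 = (2 * r) ^+ 3 by ring.
  by rewrite lerXn2r ?nnegrE ?enorm_ge0 ?mulr_ge0 ?(ltW r0).
have th : enorm (t *: h) = r by rewrite enormZ gtr0_norm.
set U := t *: h in th.
have k1 : M / 6 * enorm (s + U) ^+ 3 <= M / 6 * (8 * r ^+ 3).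
  by apply/P/(le_trans (enormD _ _)); rewrite th; lra.
have k2 : M / 6 * enorm (s - U) ^+ 3 <= M / 6 * (8 * r ^+ 3).
  by apply/P/(le_trans (enormD _ _)); rewrite enormN th; lra.
rewrite -(@ler_pM2l _ (t ^+ 2)) ?exprn_gt0//.
have -> : t ^+ 2 * (- (8 / 3 * M * r) * enorm h ^+ 2) = - (8 / 3 * M * r * r ^+ 2).
  by rewrite -tr; ring.
have -> : t ^+ 2 * dot h (h *m H) = dot U (U *m H).
  by rewrite /U -scalemxAl dotZl dotZr; ring.
have s3 : 0 <= M / 6 * e ^+ 3 by rewrite mulr_ge0 ?exprn_ge0 ?divr_ge0.
have := smin (s + U); have := smin (s - U).
move: k1 k2 s3; rewrite /cubic_model; move: U {th} => U.
rewrite !mulmxDl !mulNmx !dotE.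
move: (M / 6 * enorm (s + U) ^+ 3) (M / 6 * enorm (s - U) ^+ 3) (M / 6 * e ^+ 3).
move: (dot g s) (dot g U) (dot s (s *m H)) (dot s (U *m H)) (dot U (s *m H)) (dot U (U *m H)).
move=> *; lra.
Qed.

End CubicModel.

(* With sigma = sqrt (eps / M) the tolerances below are C_g eps and C_H sqrt (M eps). *)
Section CubicStep.
Variables (R : realType) (n : nat) (F : 'rV[R]_n -> R) (GF : 'rV[R]_n -> 'rV[R]_n).
Variables (HF : 'rV[R]_n -> 'M[R]_n) (g : 'rV[R]_n) (H : 'M[R]_n) (M sg : R).
Variables (x s : 'rV[R]_n).
Hypotheses (M0 : 0 < M) (sg0 : 0 < sg) (Hsym : H^T = H) (smin : argmin (cubic_model g H M) s).
Hypotheses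
  (T3 : forall u, `|F (x + u) - F x - dot (GF x) u - dot (u *m HF x) u / 2|
    <= M / 6 * enorm u ^+ 3)
  (T2 : forall u, enorm (GF (x + u) - GF x - u *m HF x) <= M / 2 * enorm u ^+ 2)
  (T1 : forall u, opb (HF (x + u) - HF x) (M * enorm u))
  (gerr : enorm (g - GF x) <= 192^-1 * (M * sg ^+ 2))
  (Herr : opb (H - HF x) (48^-1 * (M * sg))).

Local Notation e := (enorm s).

(** The model gains [M |s|^3 / 12]. For [sg <= 2 |s|] the gradient error costs [4/192 = 1/48] and
    the Hessian error, halved, [1/48], so [1/24] remains. *)
Lemma cubic_step_descent : sg / 2 <= e -> F (x + s) <= F x - M / 24 * e ^+ 3.
Proof.
move=> se; have e0 := enorm_ge0 s.
have := T3 s; rewrite ler_norml => /andP[_ h1].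
have h2 := cubic_model_min_le (ltW M0) smin.
have h3 : dot (GF x - g) s <= 192^-1 * (M * sg ^+ 2) * e.
  by rewrite (le_trans (dot_le _ _))// enormB ler_wpM2r.
have h4 : dot s (s *m (HF x - H)) <= 48^-1 * (M * sg) * e ^+ 2.
  rewrite (le_trans (dot_le _ _))// expr2 mulrA mulrC ler_wpM2r//.
  by rewrite -opprB mulmxN enormN.
rewrite dotDl dotNl in h3; rewrite mulmxBr dotDr dotNr in h4.
rewrite (dotC (s *m _)) in h1; rewrite /cubic_model in h2.
have h5 : M * sg ^+ 2 * e <= 4 * (M * e ^+ 3).
  have -> : 4 * (M * e ^+ 3) = M * (2 * e) ^+ 2 * e by ring.
  by rewrite ler_wpM2r// ler_wpM2l ?(ltW M0)// lerXn2r ?nnegrE ?(ltW sg0) ?mulr_ge0//; lra.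
have h6 : M * sg * e ^+ 2 <= 2 * (M * e ^+ 3).
  have -> : 2 * (M * e ^+ 3) = M * (2 * e) * e ^+ 2 by ring.
  by rewrite ler_wpM2r ?sqr_ge0// ler_wpM2l ?(ltW M0)//; lra.
move: h1 h2 h3 h4 h5 h6.
move: (dot (GF x) s) (dot g s) (dot s (s *m H)) (dot s (s *m HF x)) (F x) (F (x + s)).
by move=> *; lra.
Qed.

Lemma cubic_step_grad : e <= sg / 2 -> enorm (GF (x + s)) <= M * sg ^+ 2.
Proof.
move=> se; have e0 := enorm_ge0 s.
have h1 := T2 s; have h2 := cubic_stationary (ltW M0) Hsym smin.
have h3 := Herr s.
have -> : GF (x + s) = (GF (x + s) - GF x - s *m HF x) + (g + s *m H) - (g - GF x) -
    s *m (H - HF x).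
  rewrite mulmxBr; move: (GF _) (GF _) (s *m H) (s *m HF x) => *.
  by apply/rowP => i; rewrite !mxE; ring.
have := ler_enormB (ler_enormB (ler_enormD h1 h2) gerr) h3 => /le_trans; apply.
have e2 : M * e ^+ 2 <= M * (sg ^+ 2 / 4).
  rewrite ler_wpM2l ?(ltW M0)//; have -> : sg ^+ 2 / 4 = (sg / 2) ^+ 2 by field.
  by rewrite lerXn2r ?nnegrE ?divr_ge0 ?(ltW sg0).
have e3 : M * sg * e <= M * sg * (sg / 2) by rewrite ler_wpM2l// mulr_ge0 ?ltW.
have ms : 0 <= M * sg ^+ 2 by rewrite mulr_ge0 ?sqr_ge0 ?(ltW M0).
lra.
Qed.

(** In units of [M sg |h|^2] the losses are [4/3] from the model, [1/2] from moving to [x + s] and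
    [1/48] from the Hessian error, less than 2 in all. *)
Lemma cubic_step_curvature h : e <= sg / 2 ->
  - (2 * (M * sg)) * enorm h ^+ 2 <= dot h (h *m HF (x + s)).
Proof.
move=> se; have e0 := enorm_ge0 s.
have h1 := cubic_curvature (ltW M0) smin h (divr_gt0 sg0 (ltr0n R 2)) se.
have h2 : dot h (h *m (HF x - HF (x + s))) <= M * e * enorm h ^+ 2.
  rewrite (le_trans (dot_le _ _))// expr2 mulrA mulrC ler_wpM2r ?enorm_ge0//.
  by rewrite -opprB mulmxN enormN T1.
have h3 : dot h (h *m (H - HF x)) <= 48^-1 * (M * sg) * enorm h ^+ 2.
  by rewrite (le_trans (dot_le _ _))// expr2 mulrA mulrC ler_wpM2r ?enorm_ge0.
have h4 : M * e * enorm h ^+ 2 <= M * (sg / 2) * enorm h ^+ 2.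
  by rewrite ler_wpM2r ?sqr_ge0// ler_wpM2l// ltW.
have h5 : 0 <= M * sg * enorm h ^+ 2 by rewrite !mulr_ge0 ?enorm_ge0 ?(ltW M0) ?(ltW sg0).
move: h1 h2 h3 h4 h5; rewrite !mulmxBr !dotDr !dotNr.
by move: (dot h _) (dot h _) (dot h _) (enorm h ^+ 2) => *; lra.
Qed.

End CubicStep.

(** * Bilevel problems *)

(** The method is tuned to the modulus smoothness / condition number, which may lie below the true
    modulus. *)
Lemma sc_lowerW (R : realType) n (m m' : R) (h : 'rV[R]_n -> R) G :
  m' <= m -> sc_lower m h G -> sc_lower m' h G.
Proof.
move=> mm sc u v; apply: le_trans (sc u v).
by rewrite lerD2l ler_wpM2r ?sqr_ge0// ler_pM2r ?invr_gt0.
Qed.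

Lemma linear_sub (R : pzRingType) (V W : lmodType R) (A B : V -> W) :
  linear A -> linear B -> linear (A - B).
Proof. by move=> lA lB a v w; rewrite !fctE lA lB scalerBr opprD addrACA. Qed.

Section Bilevel.
Variables (R : realType) (dx dy : nat) (P : bilevel R dx dy).
Hypotheses (SA : standing_assumption P) (dy0 : (0 < dy)%N).

Local Notation f := (fobj P).
Local Notation g := (gobj P).
Local Notation mu := (mu P).
Local Notation ell := (ell P).
Local Notation rho := (rho P).
Local Notation nu := (nu P).
Local Notation l := (lbar P).
Local Notation k := (kappa P).

Let mu0 : 0 < mu := mu_gt0 SA.
Let dxy0 : (0 < dx + dy)%N. Proof. by rewrite addn_gt0 dy0 orbT. Qed.

Lemma ell_ge0 : 0 <= ell.
Proof. exact: lipschitz_for_ge0 dxy0 (gradf_lip SA). Qed.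

Lemma enorm_delta n (i : 'I_n) : enorm (delta_mx 0 i : 'rV[R]_n) = 1.
Proof.
rewrite /enorm /dot (bigD1 i)//= big1 ?addr0 ?mxE ?eqxx ?mulr1 ?sqrtr1// => j ji.
by rewrite mxE (negbTE ji) andbF mul0r.
Qed.

Lemma lipf_ge0 : 0 <= lipf P.
Proof.
pose i := Ordinal dxy0; have := f_lip SA (delta_mx 0 i) 0.
by rewrite subr0 enorm_delta mulr1; apply: le_trans.
Qed.

Lemma third_opb z z' u :
  opb (third g z u - third g z' u) (nu * enorm (z - z') * enorm u).
Proof.
have lin : linear (third g z - third g z').
  by apply: linear_sub; exact: linearP.
apply: opbW (tensor_norm_opb u lin).
by rewrite ler_wpM2r ?enorm_ge0//; exact: (thirdg_lip SA).
Qed.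

Lemma nu_ge0 : 0 <= nu.
Proof.
pose i := Ordinal dxy0; pose e : 'rV[R]_(dx + dy) := delta_mx 0 i.
have := third_opb e 0 e e; rewrite subr0 enorm_delta !mulr1; apply: le_trans.
exact: enorm_ge0.
Qed.

Let hess_opb (h : 'rV[R]_(dx + dy) -> R) :
  lipschitz_for (@spectral_norm R _ _) rho (hess h) ->
  forall z z', opb (hess h z - hess h z') (rho * enorm (z - z')).
Proof. by move=> H z z'; apply: opbW (@opb_spectral_norm _ _ _ _); exact: H. Qed.

Lemma f_c2 : C2fun f (grad f) (hess f) ell rho.
Proof.
apply: c2_intro.
- exact: ell_ge0.
- exact: ltW (rho_gt0 SA).
- by move=> z; apply: twice_differentiable_fun; exact: (f_diff SA).
- by move=> z; apply: twice_differentiable_grad; exact: (f_diff SA).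
- exact: (gradf_lip SA).
- exact: hess_opb (hessf_lip SA).
Qed.

Let g_grad_diff z : differentiable (grad g) z.
Proof.
by apply: twice_differentiable_grad; apply: thrice_differentiable_twice; exact: (g_diff SA).
Qed.

Lemma g_c2 : C2fun g (grad g) (hess g) ell rho.
Proof.
apply: c2_intro.
- exact: ell_ge0.
- exact: ltW (rho_gt0 SA).
- move=> z; apply: twice_differentiable_fun; apply: thrice_differentiable_twice.
  exact: (g_diff SA).
- exact: g_grad_diff.
- exact: (gradg_lip SA).
- exact: hess_opb (hessg_lip SA).
Qed.

Lemma g_c3 : C3fun (hess g) (third g) rho nu.
Proof.
apply: (@c3_intro R (dx + dy) (grad g) (hess g) (fun z => 'd (hess g) z) rho nu).
- move=> z u b t; apply: is_derive_line_dot; exact: g_grad_diff.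
- exact: hess_opb (hessg_lip SA).
- exact: (c2_sym g_c2).
- apply: taylor_third; last exact: third_opb.
  + by move=> z; apply: thrice_differentiable_hess; exact: (g_diff SA).
  + exact: nu_ge0.
Qed.

Lemma g_sc_lower x :
  sc_lower mu (fun y => g (row_mx x y)) (fun y => rsubmx (grad g (row_mx x y))).
Proof.
apply: (@strongly_convex_sc_lower _ _ _ _ _ ell); last exact: (g_sc SA).
by move=> u v; exact: slice_quad g_c2 x v u.
Qed.

Lemma slice0 (q : 'rV[R]_(dx + dy) -> R) x :
  (fun y => q (row_mx x y)) = (fun y => q (row_mx x y) + 0).
Proof. by apply: funext => y; rewrite addr0. Qed.

Lemma sc_lowerD n m (h : 'rV[R]_n -> R) G c :
  sc_lower m h G -> sc_lower m (fun y => h y + c) G.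
Proof. by move=> sc u v; have := sc u v; lra. Qed.

(** Here the default value of [xget] is discharged: a minimizer exists, so the chosen point is one,
    and all later arguments see only the stationarity equation. *)
Lemma slice_minimizer (q : 'rV[R]_(dx + dy) -> R) G H L r m c x : C2fun q G H L r -> 0 < m ->
  sc_lower m (fun y => q (row_mx x y)) (fun y => rsubmx (G (row_mx x y))) ->
  rsubmx (G (row_mx x (xget 0 (argmin (fun y => q (row_mx x y) + c))))) = 0.
Proof.
move=> C m0 sc; set h := fun y => _.
have [z hz] : exists z, argmin h z.
  apply: (sc_lower_argmin_exists m0 (sc_lowerD c sc)) => y.
  by apply: differentiable_continuous; case: (slice_grad C x c y).
have : argmin h (xget 0 (argmin h)) by apply: xgetPex; exists z.
exact: (argmin_grad0 (slice_smooth C x c)).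
Qed.

Lemma ystar_grad x : rsubmx (grad g (row_mx x (ystar P x))) = 0.
Proof.
by rewrite /ystar slice0; exact: slice_minimizer g_c2 mu0 (g_sc_lower x).
Qed.

(** Test the yy block on a unit vector, which exists since [0 < dy]; this is the source of
    [kappa >= 1]. *)
Lemma mu_le_ell : mu <= ell.
Proof.
pose v : 'rV[R]_dy := delta_mx 0 (Ordinal dy0).
have := hess_yy_coercive g_c2 g_sc_lower 0 v.
have [_ _ _ hb] := opb_blocks ell_ge0 (c2_bound g_c2 0).
move=> /le_trans/(_ (dot_le _ _))/le_trans/(_ (ler_wpM2l (enorm_ge0 _) (hb v))).
by rewrite enorm_delta expr1n !mulr1 mul1r.
Qed.

Lemma ell_gt0 : 0 < ell. Proof. exact: lt_le_trans mu_le_ell. Qed.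

Lemma ell_le_lbar : ell <= l. Proof. by rewrite /lbar !le_max lexx orbT. Qed.
Lemma lipf_le_lbar : lipf P <= l. Proof. by rewrite /lbar !le_max lexx. Qed.
Lemma rho_le_lbar : rho <= l. Proof. by rewrite /lbar !le_max lexx !orbT. Qed.
Lemma nu_le_lbar : nu <= l. Proof. by rewrite /lbar !le_max lexx !orbT. Qed.

Lemma lbar_gt0 : 0 < l. Proof. exact: lt_le_trans ell_gt0 ell_le_lbar. Qed.

Lemma lbarE : l = k * mu. Proof. by rewrite /kappa divfK// gt_eqF. Qed.

Lemma kappa_ge1 : 1 <= k.
Proof. by rewrite /kappa ler_pdivlMr// mul1r (le_trans mu_le_ell ell_le_lbar). Qed.

Section Penalized.
Variable lam : R.
Hypothesis lam_ge : 2 * ell / mu <= lam.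

Lemma lam_ge2 : 2 <= lam.
Proof.
apply: le_trans lam_ge; rewrite ler_pdivlMr//.
by rewrite ler_wpM2l// mu_le_ell.
Qed.

Let lam0 : 0 < lam. Proof. by apply: lt_le_trans lam_ge2. Qed.

Local Notation Q := (pen f g lam).
Local Notation GQ := (pen_grad (grad f) (grad g) lam).
Local Notation HQ := (pen_hess (hess f) (hess g) lam).

Lemma Q_c2 : C2fun Q GQ HQ (ell + lam * ell) (rho + lam * rho).
Proof. exact: pen_c2 f_c2 g_c2 lam0. Qed.

Lemma Q_sc_lower x :
  sc_lower (lam * mu / 2) (fun y => Q (row_mx x y)) (fun y => rsubmx (GQ (row_mx x y))).
Proof. exact: pen_sc f_c2 mu0 lam0 lam_ge g_sc_lower x. Qed.

Lemma Q_sc_gt0 : 0 < lam * mu / 2. Proof. by rewrite divr_gt0// mulr_gt0. Qed.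

Lemma LpenE x : Lpen P lam x =
  (fun y => Q (row_mx x y) + - (lam * g (row_mx x (ystar P x)))).
Proof. by apply: funext => y; rewrite /Lpen /pen; ring. Qed.

Lemma ylstar_grad x : rsubmx (GQ (row_mx x (ylstar P lam x))) = 0.
Proof.
by rewrite /ylstar LpenE; exact: slice_minimizer Q_c2 Q_sc_gt0 (Q_sc_lower x).
Qed.

Local Notation pval := (pen_value f g lam (ystar P) (ylstar P lam)).
Local Notation pgrad := (pen_value_grad (grad f) (grad g) lam (ystar P) (ylstar P lam)).
Local Notation phess := (pen_value_hess (hess f) (hess g) lam (ystar P) (ylstar P lam)).

Lemma LstarE : Lstar P lam = pval.
Proof. by apply: funext => x; rewrite /Lstar /Lpen /pen_value /pen /graph_pt; ring. Qed.

Lemma grad_estE : grad_est P lam = grad_approx (grad f) (grad g) lam.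
Proof.
apply: funext => x; apply: funext => y; apply: funext => w.
rewrite /grad_est /grad_approx /grad_x /pen_grad.
move: (grad f _) (grad g _) (grad g _) => *.
by apply/rowP => i; rewrite !mxE; ring.
Qed.

Lemma hess_estE : hess_est P lam = hess_approx (hess f) (hess g) lam.
Proof.
apply: funext => x; apply: funext => y; apply: funext => w.
rewrite /hess_est /hess_approx /hessL_xy /hessL_yy /hess_xx /hess_xy /hess_yy /pen_hess /schur_mx.
move: (hess f _) (hess g _) (hess g _) => A C B.
have -> : ursubmx (A + lam *: B) = ursubmx A + lam *: ursubmx B.
  by apply/matrixP => i j; rewrite !mxE.
have -> : drsubmx (A + lam *: B) = drsubmx A + lam *: drsubmx B.
  by apply/matrixP => i j; rewrite !mxE.
move: (_ *m _ *m _) (_ *m _ *m _) => D E.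
by apply/matrixP => i j; rewrite !mxE; ring.
Qed.

Lemma hess_est_sym x y w : (hess_est P lam x y w)^T = hess_est P lam x y w.
Proof.
have S (M : 'M[R]_(dx + dy)) : M^T = M -> (schur_mx M)^T = schur_mx M.
  move=> Ms; rewrite /schur_mx linearB/= !trmx_mul trmxK trmx_inv mulmxA.
  by rewrite trmx_drsub trmx_ulsub Ms.
rewrite hess_estE /hess_approx linearB linearZ/= !S//.
- exact: (c2_sym g_c2).
- exact: (c2_sym Q_c2).
Qed.

End Penalized.
End Bilevel.

(** * Penalty gaps and estimator errors in terms of [lbar], [kappa] and [lam] *)

Section Gaps.
Variables (R : realType) (dx dy : nat) (P : bilevel R dx dy) (lam : R).
Hypotheses (SA : standing_assumption P) (dy0 : (0 < dy)%N).
Hypothesis lam_ge : 2 * ell P / mu P <= lam.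

Local Notation f := (fobj P).
Local Notation g := (gobj P).
Local Notation mu := (mu P).
Local Notation ell := (ell P).
Local Notation rho := (rho P).
Local Notation l := (lbar P).
Local Notation k := (kappa P).
Local Notation ys := (ystar P).
Local Notation yl := (ylstar P lam).
Local Notation pgrad := (pen_value_grad (grad f) (grad g) lam ys yl).
Local Notation phess := (pen_value_hess (hess f) (hess g) lam ys yl).
Local Notation fgrad := (phi_grad (grad f) (hess g) ys).
Local Notation fhess := (phi_hess (grad f) (hess f) (hess g) (third g) ys).

Let mu0 : 0 < mu := mu_gt0 SA.
Let lam0 : 0 < lam. Proof. by apply: lt_le_trans (lam_ge2 SA dy0 lam_ge). Qed.
Let l0 : 0 < l := lbar_gt0 SA dy0.
Let k1 : 1 <= k := kappa_ge1 SA dy0.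
Let k0 : 0 < k. Proof. exact: lt_le_trans k1. Qed.
Let ell0 : 0 <= ell := ell_ge0 SA dy0.
Let rho0 : 0 <= rho. Proof. exact: ltW (rho_gt0 SA). Qed.
Let c0 : 0 <= lipf P := lipf_ge0 SA dy0.
Let nu0 : 0 <= nu P := nu_ge0 SA dy0.
Let Cf := f_c2 SA dy0.
Let Cg := g_c2 SA dy0.
Let scg := g_sc_lower SA dy0.
Let hys := ystar_grad SA dy0.
Let hyl := ylstar_grad SA dy0 lam_ge.

Local Notation dist x := (enorm (yl x - ys x)).

Let ellmu : ell / mu <= k. Proof. by rewrite /kappa ler_pM2r ?invr_gt0// ell_le_lbar. Qed.

Let r1_ge0 : 0 <= 1 + ell / mu.
Proof. by rewrite addr_ge0// divr_ge0// ltW. Qed.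

Let r1_le : 1 + ell / mu <= 2 * k.
Proof. by have := ellmu; have := k1; lra. Qed.

Lemma dist_le x : dist x <= 2 * k / lam.
Proof.
apply: (le_trans (ys_yl_dist Cf mu0 lam0 c0 lam_ge (f_lip SA) scg hys hyl x)).
have -> : 2 * k / lam = 2 * l / (lam * mu) by rewrite /kappa; field; rewrite !gt_eqF.
by rewrite ler_pM2r ?invr_gt0 ?mulr_gt0// ler_wpM2l// lipf_le_lbar.
Qed.

Lemma Lstar_le_phi x : Lstar P lam x <= phi P x.
Proof.
rewrite LstarE; exact: (pen_value_le_phi ys Cf mu0 lam0 lam_ge scg hyl).
Qed.

Lemma phi_le_Lstar x : phi P x <= Lstar P lam x + l * k / (2 * lam).
Proof.
rewrite LstarE; apply: (le_trans (phi_le_pen_value yl mu0 lam0 (f_lip SA) scg hys x)).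
rewrite lerD2l.
have -> : l * k / (2 * lam) = l ^+ 2 / (2 * (lam * mu)).
  by rewrite /kappa; field; rewrite !gt_eqF.
rewrite ler_pM2r ?invr_gt0 ?mulr_gt0//.
by rewrite lerXn2r ?nnegrE ?(ltW l0)// lipf_le_lbar.
Qed.

(** As [dist] is O(k / lam), the linear term and [lam] times the quadratic one have the same order:
    together they are at most [2 l / lam] times [k + k^2]. *)
Let quad_le x c b : 0 <= c -> c <= l -> 0 <= b -> b <= l ->
  c * dist x + lam * (b / 2 * dist x ^+ 2) <= 4 * (l * k ^+ 2 / lam).
Proof.
move=> c1 cl b0 bl; have d0 := enorm_ge0 (yl x - ys x); have d1 := dist_le x.
have K0 : 0 <= 2 * k / lam by exact: le_trans d1.
have h1 : c * dist x <= l * (2 * k / lam) by rewrite ler_pM.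
have h2 : lam * (b / 2 * dist x ^+ 2) <= lam * (l / 2 * (2 * k / lam) ^+ 2).
  rewrite ler_wpM2l ?(ltW lam0)// ler_pM ?divr_ge0 ?sqr_ge0// ?ler_pM2r ?invr_gt0//.
  by rewrite lerXn2r ?nnegrE.
apply: (le_trans (lerD h1 h2)).
have -> : l * (2 * k / lam) + lam * (l / 2 * (2 * k / lam) ^+ 2) =
    2 * l / lam * (k + k ^+ 2) by field; rewrite gt_eqF.
have -> : 4 * (l * k ^+ 2 / lam) = 2 * l / lam * (2 * k ^+ 2) by field; rewrite gt_eqF.
rewrite ler_wpM2l ?divr_ge0 ?mulr_ge0 ?(ltW l0) ?(ltW lam0)//.
by have := k1; nra.
Qed.

Lemma grad_gap_le x : enorm (pgrad x - fgrad x) <= 8 * (l * k ^+ 3 / lam).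
Proof.
apply: (le_trans (grad_gap Cf Cg mu0 lam0 scg hys hyl x)).
have -> : 8 * (l * k ^+ 3 / lam) = 2 * k * (4 * (l * k ^+ 2 / lam)) by field; rewrite gt_eqF.
rewrite ler_pM//; last by rewrite quad_le ?ell_le_lbar ?rho_le_lbar.
by rewrite addr_ge0 ?mulr_ge0 ?enorm_ge0 ?(ltW lam0) ?sqr_ge0 ?divr_ge0.
Qed.

Lemma hess_gap_le x h :
  dot h (h *m phess x) <= dot h (h *m fhess x) + 32 * (l * k ^+ 5 / lam) * enorm h ^+ 2.
Proof.
apply: (le_trans (hess_gap Cf Cg (g_c3 SA dy0) nu0 mu0 lam0 lam_ge scg hys hyl x h)).
rewrite lerD2l ler_wpM2r ?sqr_ge0//.
have -> : 32 * (l * k ^+ 5 / lam) = (2 * k) ^+ 2 * (8 * (l * k ^+ 3 / lam)).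
  by field; rewrite gt_eqF.
have d0 := enorm_ge0 (yl x - ys x).
have q0 c b : 0 <= c -> 0 <= b -> 0 <= c * dist x + lam * (b / 2 * dist x ^+ 2).
  by move=> *; rewrite addr_ge0 ?mulr_ge0 ?(ltW lam0) ?sqr_ge0 ?invr_ge0.
have k20 : 0 <= 2 * k := mulr_ge0 (ler0n R 2) (ltW k0).
rewrite ler_pM ?sqr_ge0 ?lerXn2r ?nnegrE//.
  by rewrite addr_ge0 ?q0// mulr_ge0// divr_ge0 ?q0// ltW.
have h1 := quad_le x rho0 (rho_le_lbar P) nu0 (nu_le_lbar P).
have h2 := quad_le x ell0 (ell_le_lbar P) rho0 (rho_le_lbar P).
have h3 : rho * ((ell * dist x + lam * (rho / 2 * dist x ^+ 2)) / mu) <=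
    l * (4 * (l * k ^+ 2 / lam) / mu).
  rewrite ler_pM ?rho_le_lbar ?divr_ge0 ?q0 ?(ltW mu0)//.
  by rewrite ler_pM2r ?invr_gt0.
have E : l * (4 * (l * k ^+ 2 / lam) / mu) = 4 * (l * k ^+ 3 / lam).
  by rewrite /kappa; field; rewrite !gt_eqF.
rewrite E in h3.
have h4 : l * k ^+ 2 / lam <= l * k ^+ 3 / lam.
  rewrite ler_pM2r ?invr_gt0// ler_pM2l// [leRHS]exprS ler_peMl ?sqr_ge0//.
lra.
Qed.

Lemma estimator_grad_error x y w e :
  enorm (y - yl x) <= e -> enorm (w - ys x) <= e ->
  enorm (grad_est P lam x y w - pgrad x) <= 4 * lam * ell * e.
Proof.
move=> ye we; have l2 := lam_ge2 SA dy0 lam_ge.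
rewrite grad_estE; apply: (le_trans (grad_approx_error ys yl Cf Cg lam0 x y w)).
have e0 := le_trans (enorm_ge0 _) ye.
have h1 : (ell + lam * ell) * enorm (y - yl x) <= (ell + lam * ell) * e.
  by rewrite ler_wpM2l// addr_ge0// mulr_ge0 ?(ltW lam0).
have h2 : lam * (ell * enorm (w - ys x)) <= lam * (ell * e).
  by rewrite !ler_wpM2l ?(ltW lam0).
apply: (le_trans (lerD h1 h2)).
have h3 : 0 <= ell * e by rewrite mulr_ge0.
nra.
Qed.

(** Recognizes [C2] as the constant of [schur_mx_lip] for the penalty Hessian, with norm bound
    [ell + lam ell] and inverse bound [2 / (lam mu)]. *)
Lemma C2E : C2 P lam = (rho + lam * rho) *
  (1 + 2 * ((ell + lam * ell) * (lam * mu / 2)^-1) + ((ell + lam * ell) * (lam * mu / 2)^-1) ^+ 2).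
Proof. by rewrite /C2; field; rewrite !gt_eqF. Qed.

Lemma C2_gt0 : 0 < C2 P lam.
Proof.
rewrite C2E; apply: mulr_gt0.
  by rewrite ltr_wpDr ?(rho_gt0 SA)// mulr_ge0 ?(ltW lam0).
set a := (_ + _) / _; have a0 : 0 <= a.
  by rewrite divr_ge0 ?addr_ge0 ?mulr_ge0 ?invr_ge0 ?(ltW lam0) ?(ltW mu0).
by have := sqr_ge0 a; lra.
Qed.

(** The error in [w] carries the same constant with [ell / mu] for [a], which is smaller; bounding
    it by [C2] as well yields the factor 2. *)
Lemma estimator_hess_error x y w e :
  enorm (y - yl x) <= e -> enorm (w - ys x) <= e ->
  opb (hess_est P lam x y w - phess x) (2 * C2 P lam * e).
Proof.
move=> ye we; have l2 := lam_ge2 SA dy0 lam_ge.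
rewrite hess_estE; apply: opbW (hess_approx_error ys yl Cf Cg mu0 lam0 lam_ge scg x y w).
have e0 := le_trans (enorm_ge0 _) ye.
set a := (ell + lam * ell) * _.
set b := ell * mu^-1.
have b0 : 0 <= b by rewrite mulr_ge0 ?invr_ge0 ?(ltW mu0).
have ba : b <= a.
  have -> : a = 2 * (1 + lam) / lam * b by rewrite /a /b; field; rewrite !gt_eqF.
  by rewrite ler_peMl// ler_pdivlMr//; lra.
have -> : 2 * C2 P lam * e = (rho + lam * rho) * e * (1 + 2 * a + a ^+ 2) +
    (rho + lam * rho) * e * (1 + 2 * a + a ^+ 2) by rewrite C2E -/a; ring.
have rl : 0 <= rho + lam * rho by rewrite addr_ge0 ?mulr_ge0 ?(ltW lam0).
have qa : 0 <= 1 + 2 * a + a ^+ 2 by have := sqr_ge0 a; have := le_trans b0 ba; lra.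
have qb : 0 <= 1 + 2 * b + b ^+ 2 by have := sqr_ge0 b; lra.
apply: lerD; first by rewrite ler_wpM2r// ler_wpM2l.
have -> : lam * (rho * enorm (w - ys x) * (1 + 2 * b + b ^+ 2)) =
  (lam * rho) * enorm (w - ys x) * (1 + 2 * b + b ^+ 2) by ring.
rewrite ler_pM ?mulr_ge0 ?enorm_ge0 ?(ltW lam0)//.
  by rewrite ler_pM ?mulr_ge0 ?enorm_ge0 ?(ltW lam0)// lerDr.
have : b ^+ 2 <= a ^+ 2 by rewrite lerXn2r ?nnegrE ?(le_trans b0).
lra.
Qed.

Lemma ystar_lip x x' : enorm (ys x - ys x') <= k * enorm (x - x').
Proof.
apply: (le_trans (ysol_lip Cg mu0 scg hys x x')).
by rewrite ler_wpM2r ?enorm_ge0.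
Qed.

Lemma ylstar_lip x x' : enorm (yl x - yl x') <= 3 * k * enorm (x - x').
Proof.
apply: (le_trans (ysol_lip (Q_c2 SA dy0 lam_ge) (Q_sc_gt0 SA dy0 lam_ge)
  (Q_sc_lower SA dy0 lam_ge) hyl x x')).
rewrite ler_wpM2r ?enorm_ge0//.
have -> : (ell + lam * ell) / (lam * mu / 2) = 2 * (1 + lam) / lam * (ell / mu).
  by field; rewrite !gt_eqF.
rewrite ler_pM ?divr_ge0 ?(ltW mu0) ?mulr_ge0 ?addr_ge0 ?(ltW lam0)//.
by rewrite ler_pdivrMr//; have := lam_ge2 SA dy0 lam_ge; lra.
Qed.

(** Smoothness [ell] is read as [k * (ell / k)], where [ell / k <= mu] is an admissible modulus. *)
Lemma agd_lower x z0 d e : 0 < e -> enorm (z0 - ys x) <= d ->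
  enorm (AGD (fun v => g (row_mx x v)) z0
    (natceil (2 * Num.sqrt (3 * k) * ln (Num.sqrt (3 * k + 1) / e * d)))
    ell^-1 (momentum k) - ys x) <= e.
Proof.
move=> e0 zd; have el0 := ell_gt0 SA dy0.
have -> : ell = k * (ell / k) by rewrite mulrC divfK// gt_eqF.
have G : grad (fun v => g (row_mx x v)) = (fun v => rsubmx (grad g (row_mx x v))).
  by rewrite slice0; apply: funext => v; case: (slice_grad Cg x 0 v).
apply: agd_accuracy => //.
- by rewrite divr_gt0.
- by have := k1; lra.
- rewrite G; apply: sc_lowerW (scg x).
  by rewrite ler_pdivrMr// mulrC -ler_pdivrMr.
- rewrite G [k * _]mulrC divfK ?gt_eqF// {1}slice0; exact: (slice_smooth Cg).
- by rewrite G hys.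
Qed.

(** Here the modulus is [(1 + lam) ell / (3 k)], at most [lam mu / 2] because
    [1 + lam <= 3 lam / 2]. *)
Lemma agd_penalty x z0 d e : 0 < e -> enorm (z0 - yl x) <= d ->
  enorm (AGD (Lpen P lam x) z0
    (natceil (2 * Num.sqrt (3 * k) * ln (Num.sqrt (3 * k + 1) / e * d)))
    ((1 + lam) * ell)^-1 (momentum (3 * k)) - yl x) <= e.
Proof.
move=> e0 zd; have el0 := ell_gt0 SA dy0; have l2 := lam_ge2 SA dy0 lam_ge.
have CQ := Q_c2 SA dy0 lam_ge; have scQ := Q_sc_lower SA dy0 lam_ge x.
have E : (1 + lam) * ell = 3 * k * ((1 + lam) * ell / (3 * k)).
  by rewrite [RHS]mulrC divfK// gt_eqF// mulr_gt0.
have EL : (1 + lam) * ell = ell + lam * ell by ring.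
rewrite {1}E.
have G : grad (Lpen P lam x) =
    (fun v => rsubmx (pen_grad (grad f) (grad g) lam (row_mx x v))).
  rewrite LpenE; apply: funext => v.
  by case: (slice_grad CQ x (- (lam * g (row_mx x (ystar P x)))) v).
apply: agd_accuracy => //.
- by apply: divr_gt0; apply: mulr_gt0 => //; rewrite addr_gt0.
- by have := k1; lra.
- rewrite G; apply: (@sc_lowerW _ _ (lam * mu / 2)); last by rewrite LpenE; apply: sc_lowerD.
  have k30 : 0 < 3 * k by rewrite pmulr_rgt0.
  rewrite ler_pdivrMr//.
  have -> : lam * mu / 2 * (3 * k) = 3 / 2 * lam * l by rewrite (lbarE SA); ring.
  apply: ler_pM => //; last exact: ell_le_lbar.
    by rewrite addr_ge0 ?(ltW lam0).
  by have := lam0; lra.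
- rewrite G -E EL LpenE; exact: (slice_smooth CQ).
- by rewrite G hyl.
Qed.

End Gaps.

(** * Executions of FSBA *)

Section Run.
Variables (R : realType) (dx dy : nat) (P : bilevel R dx dy) (x0 : 'rV[R]_dx).
Variables (eps M rhobar lam : R) (T N : nat).
Variables (x : nat -> 'rV[R]_dx) (w y : nat -> 'rV[R]_dy) (s : nat -> 'rV[R]_dx).
Hypotheses (SA : standing_assumption P) (dy0 : (0 < dy)%N).

Local Notation l := (lbar P).
Local Notation k := (kappa P).
Local Notation Delta := (gap P x0).
Local Notation K := (inner_steps P x0 lam M eps (3 * k) s).
Local Notation ys := (ystar P).
Local Notation yl := (ylstar P lam).
Local Notation et := (eps_inner P lam M eps).
Local Notation LL := (Lstar P lam).

Hypotheses (eps0 : 0 < eps) (Delta0 : 0 < Delta) (M0 : 0 < M).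
Hypotheses (lam1 : l * k ^+ 2 / Delta <= lam) (lam2 : l * k ^+ 3 / eps <= lam)
  (lam3 : l * k ^+ 5 / Num.sqrt (M * eps) <= lam).
Hypothesis lam_ge : 2 * ell P / mu P <= lam.
Hypotheses (lip : lipschitz_for (@spectral_norm R _ _) rhobar (hess LL)) (rM : rhobar <= M).
Hypothesis run : fsba_run P x0 lam M eps k (ell P) (3 * k) ((1 + lam) * ell P) T K K N x w y s.

Let mu0 : 0 < mu P := mu_gt0 SA.
Let lam0 : 0 < lam. Proof. by apply: lt_le_trans (lam_ge2 SA dy0 lam_ge). Qed.
Let l0 : 0 < l := lbar_gt0 SA dy0.
Let k1 : 1 <= k := kappa_ge1 SA dy0.
Let k0 : 0 < k. Proof. exact: lt_le_trans k1. Qed.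
Let Cf := f_c2 SA dy0.
Let Cg := g_c2 SA dy0.
Let C3 := g_c3 SA dy0.
Let scg := g_sc_lower SA dy0.
Let hys := ystar_grad SA dy0.
Let hyl := ylstar_grad SA dy0 lam_ge.
Let c0 : 0 <= lipf P := lipf_ge0 SA dy0.

Definition sigma : R := Num.sqrt (eps / M).

Lemma sigma_gt0 : 0 < sigma. Proof. by rewrite sqrtr_gt0 divr_gt0. Qed.

Lemma sigma_eps : M * sigma ^+ 2 = eps.
Proof. by rewrite sqr_sqrtr ?divr_ge0 ?(ltW M0) ?(ltW eps0)// mulrC divfK// gt_eqF. Qed.

Lemma sigma_sqrt : M * sigma = Num.sqrt (M * eps).
Proof.
have -> : M * eps = M ^+ 2 * (eps / M) by field; rewrite gt_eqF.
by rewrite sqrtrM ?sqr_ge0// sqrtr_sqr gtr0_norm.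
Qed.

Lemma eps_inner_gt0 : 0 < et.
Proof.
have C20 := C2_gt0 SA dy0 lam_ge; have e0 := ell_gt0 SA dy0.
rewrite /eps_inner lt_min !divr_gt0 ?mulr_gt0 ?invr_gt0 ?sqrtr_gt0 ?mulr_gt0//.
Qed.

Lemma eps_inner_grad : 4 * lam * ell P * et <= 192^-1 * (M * sigma ^+ 2).
Proof.
have e0 := ell_gt0 SA dy0.
have h : et <= 192^-1 * eps / (4 * lam * ell P) by rewrite /eps_inner ge_min lexx.
by rewrite sigma_eps mulrC -ler_pdivlMr ?mulr_gt0.
Qed.

Lemma eps_inner_hess : 2 * C2 P lam * et <= 48^-1 * (M * sigma).
Proof.
have C20 := C2_gt0 SA dy0 lam_ge.
have h : et <= 48^-1 * Num.sqrt (M * eps) / (2 * C2 P lam).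
  by rewrite /eps_inner ge_min lexx orbT.
by rewrite sigma_sqrt mulrC -ler_pdivlMr ?mulr_gt0.
Qed.

(** The warm start is off by the previous tolerance plus the drift of the minimizer, at most
    [3 k |s_(t-1)|], which the radius [et + 4 k |s_(t-1)|] covers. At [t = 0] the start is the
    origin, whence [init_radius]. *)
Lemma inner_accuracy t : (t < N)%N ->
  enorm (w t - ys (x t)) <= et /\ enorm (y t - yl (x t)) <= et.
Proof.
elim: t => [|t IH] tN; rewrite (run_w run tN) (run_y run tN) /=.
  split; [apply: (agd_lower SA dy0)|apply: (agd_penalty SA dy0 lam_ge)];
    rewrite ?eps_inner_gt0 ?(run_init run)// sub0r enormN /init_radius le_max lexx ?orbT//.
have [IHw IHy] := IH (ltnW tN).
have xt : enorm (x t - x t.+1) = enorm (s t).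
  by rewrite (run_x run (ltnW tN)) opprD addrA subrr add0r enormN.
have s0 := enorm_ge0 (s t).
split; [apply: (agd_lower SA dy0)|apply: (agd_penalty SA dy0 lam_ge)]; rewrite ?eps_inner_gt0//.
- have -> : w t - ys (x t.+1) = (w t - ys (x t)) + (ys (x t) - ys (x t.+1)).
    by rewrite addrA subrK.
  rewrite ler_enormD// (le_trans (ystar_lip SA dy0 _ _))// xt ler_wpM2r//.
  by have := k0; lra.
- have -> : y t - yl (x t.+1) = (y t - yl (x t)) + (yl (x t) - yl (x t.+1)).
    by rewrite addrA subrK.
  rewrite ler_enormD// (le_trans (ylstar_lip SA dy0 lam_ge _ _))// xt ler_wpM2r//.
  by have := k0; lra.
Qed.

Local Notation pgrad := (pen_value_grad (grad (fobj P)) (grad (gobj P)) lam ys yl).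
Local Notation phess := (pen_value_hess (hess (fobj P)) (hess (gobj P)) lam ys yl).

Lemma Lstar_differentiable z : differentiable LL z /\ grad LL z = pgrad z.
Proof.
by rewrite LstarE; exact: (pen_value_differentiable Cf Cg mu0 lam0 lam_ge scg hys hyl).
Qed.

Lemma Lstar_grad_differentiable z : differentiable (grad LL) z /\ hess LL z = phess z.
Proof.
by rewrite LstarE; exact: (pen_value_grad_differentiable Cf Cg mu0 lam0 lam_ge scg hys hyl).
Qed.

Let LLlip z z' : opb (hess LL z - hess LL z') (M * enorm (z - z')).
Proof.
apply: opbW (@opb_spectral_norm _ _ _ _); apply: (le_trans (lip z z')).
by rewrite ler_wpM2r ?enorm_ge0.
Qed.

Let gradE : grad LL = pgrad.
Proof. by apply: funext => z; case: (Lstar_differentiable z). Qed.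

Let hessE z : hess LL z = phess z.
Proof. by case: (Lstar_grad_differentiable z). Qed.

Let T3 z u : `|LL (z + u) - LL z - dot (pgrad z) u - dot (u *m phess z) u / 2|
  <= M / 6 * enorm u ^+ 3.
Proof.
rewrite -hessE -gradE; apply: taylor_hess (ltW M0) LLlip z u => z'.
- by case: (Lstar_differentiable z').
- by case: (Lstar_grad_differentiable z').
Qed.

Let T2 z u : enorm (pgrad (z + u) - pgrad z - u *m phess z) <= M / 2 * enorm u ^+ 2.
Proof.
rewrite -hessE -gradE; apply: taylor_jacobian (ltW M0) LLlip z u => z'.
by case: (Lstar_grad_differentiable z').
Qed.

Let T1 z u : opb (phess (z + u) - phess z) (M * enorm u).
Proof.
have E : enorm (z + u - z) = enorm u by rewrite addrAC subrr add0r.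
by rewrite -!hessE -E; exact: LLlip.
Qed.

Section Step.
Variable t : nat.
Hypothesis tN : (t < N)%N.

Let gerr : enorm (grad_est P lam (x t) (y t) (w t) - pgrad (x t)) <= 192^-1 * (M * sigma ^+ 2).
Proof.
have [aw ay] := inner_accuracy tN.
exact: le_trans (estimator_grad_error SA dy0 lam_ge ay aw) eps_inner_grad.
Qed.

Let Herr : opb (hess_est P lam (x t) (y t) (w t) - phess (x t)) (48^-1 * (M * sigma)).
Proof.
have [aw ay] := inner_accuracy tN.
apply: opbW (estimator_hess_error SA dy0 lam_ge ay aw); exact: eps_inner_hess.
Qed.

Lemma step_descent : sigma / 2 <= enorm (s t) ->
  LL (x t.+1) <= LL (x t) - M / 24 * enorm (s t) ^+ 3.
Proof.
rewrite (run_x run tN) => se.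
exact: (cubic_step_descent M0 sigma_gt0 (run_s run tN) (T3 (x t)) gerr Herr se).
Qed.

Lemma step_grad : enorm (s t) <= sigma / 2 -> enorm (pgrad (x t.+1)) <= eps.
Proof.
rewrite (run_x run tN) => se; rewrite -[leRHS]sigma_eps.
exact: (cubic_step_grad M0 sigma_gt0 (hess_est_sym SA dy0 lam_ge _ _ _) (run_s run tN)
  (T2 (x t)) gerr Herr se).
Qed.

Lemma step_curvature h : enorm (s t) <= sigma / 2 ->
  - (2 * (M * sigma)) * enorm h ^+ 2 <= dot h (h *m phess (x t.+1)).
Proof.
rewrite (run_x run tN) => se.
exact: (cubic_step_curvature M0 sigma_gt0 (run_s run tN) (T1 (x t)) Herr h se).
Qed.

End Step.

Lemma Lstar_start : LL (x 0%N) <= phi P x0.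
Proof. by rewrite (run_init run); exact: Lstar_le_phi SA dy0 lam_ge x0. Qed.

(** The penalty error [l k / (2 lam)] is at most [Delta / 2] by the first term of the maximum
    defining [lam]. *)
Lemma Lstar_lower z : phistar P - Delta / 2 <= LL z.
Proof.
have h1 : phistar P <= phi P z.
  by apply: ge_inf; [exact: (phi_bounded SA)|exists z].
have h2 := phi_le_Lstar SA dy0 lam_ge z.
suff h3 : l * k / (2 * lam) <= Delta / 2 by lra.
have h4 : l * k ^+ 2 / lam <= Delta.
  by rewrite ler_pdivrMr// [leRHS]mulrC -ler_pdivrMr.
have h5 : l * k <= l * k ^+ 2 by rewrite ler_pM2l// expr2 ler_peMr// ltW.
have -> : l * k / (2 * lam) = l * k / lam / 2 by field; rewrite gt_eqF.
rewrite ler_pM2r ?invr_gt0//; apply: le_trans h4.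
by rewrite ler_pM2r ?invr_gt0.
Qed.

Lemma descent_sum n : (n <= N)%N -> (forall t, (t < n)%N -> sigma / 2 < enorm (s t)) ->
  LL (x n) <= phi P x0 - n%:R * (M * sigma ^+ 3 / 192).
Proof.
elim: n => [|n IH] nN big; first by rewrite mul0r subr0; exact: Lstar_start.
have bn := ltW (big n (ltnSn n)).
have := step_descent nN bn.
have {IH} := IH (ltnW nN) (fun t tn => big t (ltnW tn)).
have : (sigma / 2) ^+ 3 <= enorm (s n) ^+ 3.
  by rewrite lerXn2r ?nnegrE ?enorm_ge0// divr_ge0// ltW ?sigma_gt0.
move=> /(ler_wpM2l (ltW M0)) h1 h2 h3.
rewrite -natr1 mulrDl mul1r.
move: h1 h2 h3; move: (LL _) (LL _) (enorm _ ^+ 3) (n%:R * _) => a b c d.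
have -> : (sigma / 2) ^+ 3 = sigma ^+ 3 / 8 by field.
move: (sigma ^+ 3) => z; lra.
Qed.

(** Restricted to steps before the last: the run stops at the first short step, which can only be
    [N.-1]. *)
Lemma run_big t : (t.+1 < N)%N -> sigma / 2 < enorm (s t).
Proof.
by move=> tN; rewrite ltNge; apply/negP; rewrite mulrC; exact: (run_continue run tN).
Qed.

(** A single step cannot use more than the whole drop [3 Delta / 2], and [24 * 3/2 = 36]. It serves
    to bound the logarithms in the inner step counts. *)
Lemma step_bound t : (t.+1 < N)%N -> M * enorm (s t) ^+ 3 <= 36 * Delta.
Proof.
move=> tN; have h1 := step_descent (ltnW tN) (ltW (run_big tN)).
have h2 := Lstar_lower (x t.+1).
have h3 : LL (x t) <= phi P x0.
  apply: (le_trans (@descent_sum t (ltnW (ltnW tN)) _)) => [u ut|].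
    by apply: run_big; exact: leq_ltn_trans ut (ltnW tN).
  by rewrite gerDl oppr_le0 mulr_ge0// divr_ge0// mulr_ge0 ?exprn_ge0 ?ltW ?sigma_gt0.
have E : phi P x0 = phistar P + Delta by rewrite /gap addrC subrK.
by move: h1 h2 h3; rewrite E; move: (enorm _ ^+ 3) => z; lra.
Qed.

(** Otherwise all [T] steps are long and [T M sigma^3 / 192] fits into the drop [3 Delta / 2], so
    [T] is at most 288 times the ratio; 300 makes the contradiction strict. *)
Lemma last_step_small : 300 * (Delta / (M * sigma ^+ 3)) <= T%:R ->
  enorm (s N.-1) <= sigma / 2.
Proof.
move=> T_ge; case: (run_stop run) => [NT|]; last by rewrite mulrC.
rewrite leNgt; apply/negP => big.
have h1 : LL (x N) <= phi P x0 - N%:R * (M * sigma ^+ 3 / 192).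
  apply: descent_sum => // t tN; have [tN'|] := ltnP t.+1 N; first exact: run_big.
  move=> Nt; have tE : t.+1 = N by apply/eqP; rewrite eqn_leq tN Nt.
  by rewrite -tE in big.
have h2 := Lstar_lower (x N).
have E : phi P x0 = phistar P + Delta by rewrite /gap addrC subrK.
have ms : 0 < M * sigma ^+ 3 by rewrite mulr_gt0// exprn_gt0// sigma_gt0.
move: T_ge; rewrite -NT mulrA ler_pdivrMr// => h3.
rewrite E mulrA in h1; move: h1 h2 h3; move: (N%:R * _) => z. have := Delta0; lra.
Qed.

Local Notation fhess :=
  (phi_hess (grad (fobj P)) (hess (fobj P)) (hess (gobj P)) (third (gobj P)) ys).

Lemma output_stationary : (0 < dx)%N -> enorm (s N.-1) <= sigma / 2 ->
  second_order_stationary (phi P) (9 * eps) (34 * Num.sqrt (M * eps)) (x N).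
Proof.
move=> dx0 small; have /andP[N0 _] := run_length run.
have NE : N = N.-1.+1 by rewrite prednK.
have nN : (N.-1 < N)%N by rewrite {2}NE.
have D1 z := phi_differentiable Cf Cg mu0 c0 (f_lip SA) scg hys z.
have D2 z := phi_grad_differentiable Cf Cg C3 (nu_ge0 SA dy0) mu0 c0 (f_lip SA) scg hys z.
have g1 := step_grad nN small; rewrite -NE in g1.
have g2 := grad_gap_le SA dy0 lam_ge (x N).
split.
- split; last by case: (D2 (x N)).
  by apply: filterE => z; case: (D1 z).
- have -> : grad (phi P) (x N) = phi_grad (grad (fobj P)) (hess (gobj P)) ys (x N).
    by case: (D1 (x N)).
  set v := phi_grad _ _ _ _ in g2 *.
  have -> : v = pgrad (x N) - (pgrad (x N) - v) by rewrite opprB addrC subrK.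
  (* One [eps] from the cubic step, eight from [grad_gap_le]; likewise 34 below is 2 from the cubic
     step plus 32 from [hess_gap_le]. *)
  have -> : 9 * eps = eps + 8 * eps by ring.
  apply: (ler_enormB g1); apply: (le_trans g2).
  by rewrite ler_wpM2l// ler_pdivrMr// [leRHS]mulrC -ler_pdivrMr.
- have -> : hess (phi P) (x N) = fhess (x N) by case: (D2 (x N)).
  have curv h : - (34 * Num.sqrt (M * eps)) * enorm h ^+ 2 <= dot h (h *m fhess (x N)).
    have h1 := step_curvature nN h small.
    have h2 := hess_gap_le SA dy0 lam_ge (x N) h.
    rewrite -NE in h1.
    have h3 : l * k ^+ 5 / lam <= Num.sqrt (M * eps).
      by rewrite ler_pdivrMr// [leRHS]mulrC -ler_pdivrMr// sqrtr_gt0 mulr_gt0.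
    have h4 := ler_wpM2r (sqr_ge0 (enorm h)) h3.
    rewrite sigma_sqrt in h1.
    by move: h1 h2 h4; move: (dot h _) (dot h _) (enorm h ^+ 2) => a b c; lra.
  rewrite /lambda_min; set E := [set a | _].
  have q0 : 0 <= 34 * Num.sqrt (M * eps) by rewrite mulr_ge0 ?sqrtr_ge0.
  (* The infimum of an empty set is 0 by default, which satisfies the bound; otherwise each
     eigenvalue is tested on its eigenvector. *)
  have [->|/set0P E0] := eqVneq E set0; first by rewrite inf0 oppr_le0.
  apply: lb_le_inf => // a /eigenvalueP[v va v0].
  have := curv v; rewrite va dotZr -enorm_sqr ler_pM2r//.
  by rewrite exprn_gt0// enorm_gt0.
Qed.

End Run.

(** * Oracle complexity *)

Section HalfPowers.
Variable R : realType.
Implicit Types a : R.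

Lemma powR_half a n : 0 <= a -> a `^ (n%:R / 2) = Num.sqrt a ^+ n.
Proof. by move=> a0; rewrite mulrC powRrM powR12_sqrt// powR_mulrn// sqrtr_ge0. Qed.

Lemma powRN_half a n : 0 <= a -> a `^ (- (n%:R / 2)) = (Num.sqrt a ^+ n)^-1.
Proof. by move=> a0; rewrite powRN powR_half. Qed.

Lemma sqrtrX a n : 0 <= a -> Num.sqrt (a ^+ n) = Num.sqrt a ^+ n.
Proof.
move=> a0; elim: n => [|n IH]; first by rewrite !expr0 sqrtr1.
by rewrite !exprS sqrtrM// IH.
Qed.

Lemma sqrtr_le_id a : 1 <= a -> Num.sqrt a <= a.
Proof.
move=> a1; have a0 : 0 <= a by exact: le_trans a1.
rewrite -ler_sqr ?nnegrE ?sqrtr_ge0// sqr_sqrtr// expr2 ler_peMr//.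
Qed.

(** Allows additive constants, such as those from rounding up, to be absorbed into multiples of
    [ln X]. *)
Lemma ln_ge_half a : 2 <= a -> 2^-1 <= ln a.
Proof.
move=> a2; have a0 : 0 < a by apply: lt_le_trans a2.
have h : ln (1 + (a^-1 - 1)) <= a^-1 - 1.
  by apply: le_ln1Dx; rewrite ltrBrDl subrr invr_gt0.
rewrite addrC subrK lnV ?posrE// in h.
have : a^-1 <= 2^-1 by rewrite lef_pV2 ?posrE.
by lra.
Qed.

Lemma natceil_le a b : 0 <= b -> a <= b -> (natceil a)%:R <= 1 + b.
Proof.
move=> b0 ab; rewrite /natceil; set c := Num.max _ _.
have c0 : 0 <= c by rewrite le_max lexx.
rewrite -[X in X <= _]/((absz c)%:~R) gez0_abs//.
rewrite /c maxEle; case: ifP => _; last by rewrite addr_ge0.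
by have := ceilB1_lt a; rewrite intrB; lra.
Qed.

(** [a] stands for a hidden constant rather than for problem data, so its logarithm is moved into
    the coefficient by [ln a <= a <= 2 a ln X]. *)
Lemma ln_monomial_le (a X z : R) n m : 1 <= a -> 2 <= X -> z <= a ^+ m * X ^+ n ->
  ln z <= (2 * m%:R * a + n%:R) * ln X.
Proof.
move=> a1 X2 zX.
have a0 : 0 < a by apply: lt_le_trans a1.
have X0 : 0 < X by apply: lt_le_trans X2.
have lX := ln_ge_half X2; have lX0 : 0 <= ln X by lra.
have [z1|z1] := lerP z 1.
  by apply: (le_trans (ln_le0 z1)); rewrite mulr_ge0// addr_ge0// !mulr_ge0// ltW.
have z0 : 0 < z by apply: lt_trans z1.
have : ln z <= ln (a ^+ m * X ^+ n) by rewrite ler_ln// posrE ?mulr_gt0 ?exprn_gt0.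
rewrite lnM ?posrE ?exprn_gt0// !lnXn// -[ln a *+ m]mulr_natl -[ln X *+ n]mulr_natl.
have la : ln a <= 2 * a * ln X.
  by have := ltW (ln_sublinear a0); nra.
have h : m%:R * ln a <= m%:R * (2 * a * ln X) by rewrite ler_wpM2l.
move: h; move: (m%:R) (n%:R) (ln X) (ln a) (ln z) => p q u v t; lra.
Qed.

End HalfPowers.

Section Complexity.
Variables (R : realType) (dx dy : nat) (P : bilevel R dx dy) (x0 : 'rV[R]_dx).
Variables (eps M rhobar lam : R) (T N : nat).
Variables (x : nat -> 'rV[R]_dx) (w y : nat -> 'rV[R]_dy) (s : nat -> 'rV[R]_dx).
Variables (a X : R).
Hypotheses (SA : standing_assumption P) (dy0 : (0 < dy)%N).

Local Notation l := (lbar P).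
Local Notation k := (kappa P).
Local Notation Delta := (gap P x0).
Local Notation K := (inner_steps P x0 lam M eps (3 * k) s).
Local Notation et := (eps_inner P lam M eps).
Local Notation Rad := (init_radius P lam x0).

Hypotheses (eps0 : 0 < eps) (Delta0 : 0 < Delta) (M0 : 0 < M).
Hypothesis lamE : lam = Num.max (Num.max (l * k ^+ 2 / Delta) (l * k ^+ 3 / eps))
  (l * k ^+ 5 / Num.sqrt (M * eps)).
Hypothesis lam_ge : 2 * ell P / mu P <= lam.
Hypothesis sbound : forall t, (t.+1 < N)%N -> M * enorm (s t) ^+ 3 <= 36 * Delta.
Hypotheses (a1 : 1 <= a)
  (T_ge1 : 1 <= a * (Delta * Num.sqrt M * (Num.sqrt eps ^+ 3)^-1)).
Hypotheses (X2 : 2 <= X) (kX : k <= X) (lX : l <= X) (eX : eps^-1 <= X)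
  (DX : Delta <= X) (DVX : Delta^-1 <= X) (RX : Rad <= X).

Let mu0 : 0 < mu P := mu_gt0 SA.
Let l0 : 0 < l := lbar_gt0 SA dy0.
Let k1 : 1 <= k := kappa_ge1 SA dy0.
Let k0 : 0 < k. Proof. exact: lt_le_trans k1. Qed.
Let a0 : 0 < a. Proof. exact: lt_le_trans a1. Qed.
Let X0 : 0 < X. Proof. exact: lt_le_trans X2. Qed.
Let X1 : 1 <= X. Proof. by have := X2; lra. Qed.
Let lam2 := lam_ge2 SA dy0 lam_ge.
Let lam0 : 0 < lam. Proof. by apply: lt_le_trans lam2. Qed.
Let sM : 0 < Num.sqrt M. Proof. by rewrite sqrtr_gt0. Qed.
Let se : 0 < Num.sqrt eps. Proof. by rewrite sqrtr_gt0. Qed.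

Let expX c n : 0 <= c -> c <= X -> c ^+ n <= X ^+ n.
Proof. by move=> c0 cX; rewrite lerXn2r ?nnegrE ?(ltW X0). Qed.

Let mulX b c n m : 0 <= b -> 0 <= c -> b <= X ^+ n -> c <= X ^+ m -> b * c <= X ^+ (n + m).
Proof. by move=> *; rewrite exprD ler_pM. Qed.

(** All quantities are bounded by monomials in [a] and [X]. The exponents are tracked only for
    concreteness: they end up in the coefficient of [ln X]. *)
Let mulaX b c i j n m : 0 <= b -> 0 <= c -> b <= a ^+ i * X ^+ n -> c <= a ^+ j * X ^+ m ->
  b * c <= a ^+ (i + j) * X ^+ (n + m).
Proof. by move=> *; rewrite !exprD mulrACA ler_pM. Qed.

Let X_aX c i n m : (n <= m)%N -> c <= X ^+ n -> c <= a ^+ i * X ^+ m.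
Proof.
move=> nm h; apply: (le_trans h); apply: (@le_trans _ _ (X ^+ m)).
  by rewrite ler_weXn2l.
by rewrite ler_peMl ?exprn_ge0 ?(ltW X0)// exprn_ege1.
Qed.

(* Only T >= 1 keeps M away from 0. *)
Lemma inv_sqrt_Meps : (Num.sqrt (M * eps))^-1 <= a ^+ 1 * X ^+ 3.
Proof.
have e3 : 0 < Num.sqrt eps ^+ 3 by rewrite exprn_gt0.
have h1 : Num.sqrt eps ^+ 3 <= a * Delta * Num.sqrt M.
  by have := T_ge1; rewrite !mulrA ler_pdivlMr// mul1r.
have E : Num.sqrt eps ^+ 2 = eps by rewrite sqr_sqrtr// ltW.
rewrite sqrtrM ?(ltW M0)//.
have -> : (Num.sqrt M * Num.sqrt eps)^-1 =
    (Num.sqrt eps ^+ 3 / Num.sqrt M) * eps^-1 ^+ 2.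
  by rewrite -[X in X^-1 ^+ 2]E; field; rewrite !gt_eqF.
have -> : a ^+ 1 * X ^+ 3 = (a * X) * X ^+ 2 by ring.
apply: ler_pM.
- exact: divr_ge0 (ltW e3) (ltW sM).
- exact: sqr_ge0.
- by rewrite ler_pdivrMr//; apply: (le_trans h1); rewrite ler_pM2r// ler_pM2l.
- by apply: expX => //; rewrite invr_ge0 ltW.
Qed.

(** [T_ge1] says that [eps^(3/2) / sqrt M <= a Delta]; square it and multiply by [eps^-3]. *)
Lemma inv_M : M^-1 <= a ^+ 2 * X ^+ 5.
Proof.
have -> : M^-1 = ((Num.sqrt (M * eps))^-1) ^+ 2 * eps.
  by rewrite exprVn sqr_sqrtr ?mulr_ge0 ?(ltW M0) ?(ltW eps0)//; field; rewrite !gt_eqF.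
have e3 : 0 < Num.sqrt eps ^+ 3 by rewrite exprn_gt0.
have h1 : Num.sqrt eps ^+ 3 <= a * Delta * Num.sqrt M.
  by have := T_ge1; rewrite !mulrA ler_pdivlMr// mul1r.
have E : Num.sqrt eps ^+ 2 = eps by rewrite sqr_sqrtr// ltW.
have EM : Num.sqrt M ^+ 2 = M by rewrite sqr_sqrtr// ltW.
have h2 : (Num.sqrt eps ^+ 3 / Num.sqrt M) ^+ 2 <= (a * X) ^+ 2.
  rewrite lerXn2r ?nnegrE ?divr_ge0 ?(ltW e3) ?(ltW sM)//.
    by rewrite ltW// mulr_gt0.
  rewrite ler_pdivrMr//; apply: (le_trans h1); rewrite ler_pM2r//.
  by rewrite ler_pM2l.
have -> : ((Num.sqrt (M * eps))^-1) ^+ 2 * eps =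
    (Num.sqrt eps ^+ 3 / Num.sqrt M) ^+ 2 * eps^-1 ^+ 3.
  rewrite exprVn sqr_sqrtr ?mulr_ge0 ?(ltW M0) ?(ltW eps0)//.
  have -> : (Num.sqrt eps ^+ 3 / Num.sqrt M) ^+ 2 = (Num.sqrt eps ^+ 2) ^+ 3 / Num.sqrt M ^+ 2.
    by field; rewrite gt_eqF.
  by rewrite E EM; field; rewrite !gt_eqF.
have -> : a ^+ 2 * X ^+ 5 = (a * X) ^+ 2 * X ^+ 3 by ring.
apply: ler_pM => //.
  by rewrite exprn_ge0// invr_ge0 ltW.
by apply: expX => //; rewrite invr_ge0 ltW.
Qed.

Let kn n : 0 <= k ^+ n. Proof. by rewrite exprn_ge0 ?(ltW k0). Qed.

Lemma lam_le : lam <= a ^+ 1 * X ^+ 9.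
Proof.
have lk n : l * k ^+ n <= X ^+ n.+1.
  by rewrite exprS ler_pM ?(ltW l0)// expX ?(ltW k0).
have lk0 n : 0 <= l * k ^+ n by rewrite mulr_ge0 ?(ltW l0).
rewrite lamE !ge_max; apply/andP; split; first (apply/andP; split).
- by apply: (@X_aX _ _ 4) => //; apply: (@mulX _ _ 3 1); rewrite ?invr_ge0 ?expr1 ?(ltW Delta0).
- by apply: (@X_aX _ _ 5) => //; apply: (@mulX _ _ 4 1); rewrite ?invr_ge0 ?expr1 ?(ltW eps0).
- by apply: (@mulaX _ _ 0 1 6 3); rewrite ?inv_sqrt_Meps ?invr_ge0 ?sqrtr_ge0 ?expr0 ?mul1r.
Qed.

Let pow2X n : (2 ^ n)%:R <= X ^+ n.
Proof. by rewrite natrX lerXn2r ?nnegrE ?(ltW X0). Qed.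

Let natM_ge0 (c : nat) (z : R) : 0 <= z -> 0 <= c%:R * z.
Proof. exact: mulr_ge0. Qed.

Let constX (c : R) n : c <= (2 ^ n)%:R -> c <= X ^+ n.
Proof. by move=> h; exact: le_trans h (pow2X n). Qed.

Lemma C2_le : C2 P lam <= 24 * (lam * l * k ^+ 2).
Proof.
rewrite (C2E SA dy0 lam_ge); set b := (_ + _) / _.
have rl := rho_le_lbar P; have el := ell_le_lbar P; have r0 := ltW (rho_gt0 SA).
have e0 := ell_ge0 SA dy0.
have bk : b <= 3 * k.
  have -> : b = 2 * (1 + lam) / lam * (ell P / mu P) by rewrite /b; field; rewrite !gt_eqF.
  apply: ler_pM.
  - by rewrite divr_ge0 ?mulr_ge0 ?addr_ge0 ?(ltW lam0).
  - by rewrite divr_ge0 ?(ltW mu0).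
  - by rewrite ler_pdivrMr//; have := lam2; lra.
  - by rewrite /kappa ler_pM2r ?invr_gt0.
have b0 : 0 <= b.
  rewrite divr_ge0 ?addr_ge0 ?mulr_ge0 ?invr_ge0 ?(ltW lam0) ?(ltW mu0)//.
have -> : 24 * (lam * l * k ^+ 2) = (3 / 2 * lam * l) * (16 * k ^+ 2) by field.
have b2 : b ^+ 2 <= (3 * k) ^+ 2.
  rewrite lerXn2r ?nnegrE//; exact: le_trans bk.
apply: ler_pM.
- by rewrite addr_ge0 ?mulr_ge0 ?(ltW lam0).
- by have := sqr_ge0 b; lra.
- apply: (@le_trans _ _ (3 / 2 * lam * rho P)); first by have := lam2; nra.
  by rewrite ler_wpM2l// mulr_ge0 ?(ltW lam0).
- by have := k1; rewrite exprMn in b2; nra.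
Qed.

Lemma inv_eps_inner : et^-1 <= a ^+ 2 * X ^+ 27.
Proof.
have C20 := C2_gt0 SA dy0 lam_ge; have e0 := ell_gt0 SA dy0.
have lame : 0 <= lam * ell P by rewrite mulr_ge0 ?ltW.
have h1 : (192^-1 * eps / (4 * lam * ell P))^-1 <= a ^+ 2 * X ^+ 27.
  have -> : (192^-1 * eps / (4 * lam * ell P))^-1 = lam * (768 * (ell P * eps^-1)).
    by field; rewrite !gt_eqF.
  have q0 : 0 <= ell P * eps^-1 by rewrite mulr_ge0 ?invr_ge0 ?(ltW e0) ?(ltW eps0).
  apply: (@mulaX _ _ 1 1 9 18); [exact: ltW|exact: natM_ge0|exact: lam_le|].
  refine (@X_aX _ _ 12 18 isT _).
  apply: (@mulX _ _ 10 2); [exact: ler0n|exact: q0|by apply: constX; rewrite ler_nat|].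
  apply: (@mulX _ _ 1 1); rewrite ?expr1 ?invr_ge0 ?(ltW e0) ?(ltW eps0)//.
  exact: le_trans (ell_le_lbar P) lX.
have sMe : 0 < Num.sqrt (M * eps) by rewrite sqrtr_gt0 mulr_gt0.
have h2 : (48^-1 * Num.sqrt (M * eps) / (2 * C2 P lam))^-1 <= a ^+ 2 * X ^+ 27.
  have -> : (48^-1 * Num.sqrt (M * eps) / (2 * C2 P lam))^-1 =
      C2 P lam * 96 * (Num.sqrt (M * eps))^-1 by field; rewrite !gt_eqF.
  have q0 : 0 <= l * k ^+ 2 by rewrite mulr_ge0 ?(ltW l0) ?kn.
  apply: (@mulaX _ _ 1 1 24 3); last exact: inv_sqrt_Meps.
  - by rewrite mulrC natM_ge0// ltW.
  - by rewrite invr_ge0 ltW.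
  apply: (@le_trans _ _ (24 * (lam * l * k ^+ 2) * 96)).
    by rewrite ler_pM2r ?ltr0n// C2_le.
  have -> : 24 * (lam * l * k ^+ 2) * 96 = lam * ((2304 : R) * (l * k ^+ 2)) by ring.
  apply: (@mulaX _ _ 1 0 9 15); [exact: ltW|exact: natM_ge0|exact: lam_le|].
  refine (@X_aX _ _ 15 15 (leqnn _) _).
  apply: (@mulX _ _ 12 3); [exact: ler0n|exact: q0|by apply: constX; rewrite ler_nat|].
  by rewrite [X ^+ 3]exprS ler_pM ?(ltW l0)// expX ?(ltW k0).
by rewrite /eps_inner minEle; case: ifP.
Qed.

(** Avoids a cube root: a step longer than 1 is at most its own cube. The last step is excluded, but
    it enters no inner step count. *)
Lemma step_le t : (t.+1 < N)%N -> enorm (s t) <= a ^+ 2 * X ^+ 12.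
Proof.
move=> tN; have s0 := enorm_ge0 (s t).
have h : enorm (s t) ^+ 3 <= a ^+ 2 * X ^+ 12.
  have : enorm (s t) ^+ 3 <= M^-1 * (36 * Delta).
    by rewrite -ler_pdivrMl ?invr_gt0// invrK sbound.
  move/le_trans; apply; apply: (@mulaX _ _ 2 0 5 7); last 1 first.
  - apply: (@X_aX _ _ 7) => //; apply: (@mulX _ _ 6 1); rewrite ?expr1 ?(ltW Delta0)//.
    by apply: constX; rewrite ler_nat.
  - by rewrite invr_ge0 ltW.
  - by rewrite mulr_ge0// ltW.
  - exact: inv_M.
have [s1|s1] := lerP (enorm (s t)) 1.
  apply: (le_trans s1); apply: (@X_aX _ _ 0) => //; by rewrite expr0.
apply: le_trans h; rewrite exprS ler_peMr// expr2.
by rewrite -[leLHS]mulr1 ler_pM// ltW.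
Qed.

Let arg t : R := Num.sqrt (3 * k + 1) / et *
  (if t is t'.+1 then et + 4 * k * enorm (s t') else Rad).

Lemma arg_le t : (t < N)%N -> arg t <= a ^+ 4 * X ^+ 46.
Proof.
have e0 : 0 < et by exact: (eps_inner_gt0 SA dy0 eps0 M0 lam_ge).
have rt : Num.sqrt (3 * k + 1) <= a ^+ 0 * X ^+ 3.
  rewrite expr0 mul1r; apply: (@le_trans _ _ (3 * k + 1)).
    by apply: sqrtr_le_id; have := k1; lra.
  apply: (@le_trans _ _ (4 * k)); first by have := k1; lra.
  apply: (@mulX _ _ 2 1); rewrite ?expr1 ?(ltW k0)//.
  by apply: constX; rewrite ler_nat.
have R0 : 0 <= Rad by rewrite /init_radius le_max enorm_ge0.
rewrite /arg -mulrA.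
case: t => [|t] tN; apply: (@mulaX _ _ 0 4 3 43); rewrite ?sqrtr_ge0//.
- by rewrite mulr_ge0// invr_ge0 ltW.
- apply: (@mulaX _ _ 2 2 27 16); rewrite ?invr_ge0 ?(ltW e0)//; first exact: inv_eps_inner.
  by apply: (@X_aX _ _ 1) => //; rewrite expr1.
- have d0 : 0 <= 4 * k * enorm (s t) by rewrite mulr_ge0 ?enorm_ge0// pmulr_rge0// ltW.
  by rewrite mulr_ge0 ?addr_ge0 ?invr_ge0 ?(ltW e0).
- rewrite mulrDr mulVf ?gt_eqF//.
  have h : et^-1 * (4 * k * enorm (s t)) <= a ^+ 4 * X ^+ 42.
    apply: (@mulaX _ _ 2 2 27 15); rewrite ?invr_ge0 ?(ltW e0)//; last 1 first.
    - apply: (@mulaX _ _ 0 2 3 12); rewrite ?enorm_ge0//; last exact: step_le.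
        by rewrite pmulr_rge0// ltW.
      rewrite expr0 mul1r; apply: (@mulX _ _ 2 1); rewrite ?expr1 ?(ltW k0)//.
      by apply: constX; rewrite ler_nat.
    - by rewrite mulr_ge0 ?enorm_ge0// pmulr_rge0// ltW.
    - exact: inv_eps_inner.
  have h1 : 1 <= a ^+ 4 * X ^+ 42 by apply: (@X_aX _ _ 0) => //; rewrite expr0.
  apply: (le_trans (lerD h1 h)).
  have -> : a ^+ 4 * X ^+ 43 = X * (a ^+ 4 * X ^+ 42) by ring.
  by move: h1; move: (a ^+ 4 * _) => z z1; have := X2; nra.
Qed.

Lemma inner_steps_le t : (t < N)%N ->
  (K t)%:R <= (6 + 4 * (8 * a + 46)) * ln X * Num.sqrt k.
Proof.
move=> tN; have la := ln_monomial_le a1 X2 (arg_le tN).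
have lX2 := ln_ge_half X2; have lX0 : 0 <= ln X by lra.
have B0 : 0 <= (2 * 4 * a + 46) * ln X.
  by rewrite mulr_ge0// addr_ge0// mulr_ge0 ?(ltW a0).
have s3 : 0 <= 2 * Num.sqrt (3 * k) by rewrite mulr_ge0 ?sqrtr_ge0.
have h : (K t)%:R <= 1 + 2 * Num.sqrt (3 * k) * ((2 * 4 * a + 46) * ln X).
  have E : K t = natceil (2 * Num.sqrt (3 * k) * ln (arg t)).
    by rewrite /inner_steps /arg; case: t {tN la}.
  by rewrite E; apply: natceil_le; [exact: mulr_ge0|rewrite ler_wpM2l].
apply: (le_trans h).
have sk : 1 <= Num.sqrt k by rewrite -(sqrtr1 R) ler_wsqrtr.
have s3k : Num.sqrt (3 * k) <= 2 * Num.sqrt k.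
  rewrite -ler_sqr ?nnegrE ?sqrtr_ge0 ?mulr_ge0 ?sqrtr_ge0// exprMn !sqr_sqrtr ?(ltW k0)//.
    by have := k0; lra.
  by rewrite pmulr_rge0// ltW.
have h2 : 2 * Num.sqrt (3 * k) * ((2 * 4 * a + 46) * ln X) <=
    2 * (2 * Num.sqrt k) * ((2 * 4 * a + 46) * ln X).
  by rewrite ler_wpM2r// ler_wpM2l.
(* The 1 lost in rounding up is charged to [ln X * Num.sqrt k], as [ln X >= 1/2]. *)
have h3 : 1 <= 2 * ln X * Num.sqrt k.
  rewrite -[leLHS]mulr1 ler_pM//; lra.
have h4 : 0 <= ln X * Num.sqrt k by rewrite mulr_ge0 ?sqrtr_ge0.
lra.
Qed.

Lemma first_order_calls_le : (first_order_calls K K N)%:R <=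
  N%:R * Num.sqrt k * (3 * (6 + 4 * (8 * a + 46)) + 6) * ln X.
Proof.
have lX2 := ln_ge_half X2.
have sk : 1 <= Num.sqrt k by rewrite -(sqrtr1 R) ler_wsqrtr.
rewrite /first_order_calls natr_sum.
have -> : N%:R * Num.sqrt k * (3 * (6 + 4 * (8 * a + 46)) + 6) * ln X =
  \sum_(t < N) ((3 * (6 + 4 * (8 * a + 46)) + 6) * ln X * Num.sqrt k).
  by rewrite sumr_const card_ord -mulr_natl; ring.
apply: ler_sum => t _; have h := inner_steps_le (ltn_ord t).
have -> : (K t + 2 * K t + 3)%:R = (K t)%:R + 2 * (K t)%:R + 3 :> R.
  by rewrite natrD natrD natrM.
have h3 : 1 <= 2 * ln X * Num.sqrt k by rewrite -[leLHS]mulr1 ler_pM//; lra.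
lra.
Qed.

End Complexity.

Lemma second_order_stationaryW (R : realType) n (h : 'rV[R]_n -> R) e e' tau tau' z :
  e <= e' -> tau <= tau' -> second_order_stationary h e tau z ->
  second_order_stationary h e' tau' z.
Proof.
move=> ee tt [d g c]; split=> //; first exact: le_trans ee.
by apply: le_trans c; rewrite lerN2.
Qed.

(** The order of quantifiers encodes the O-notation: [cT] is absolute, and [cO] and [p] depend only
    on the constants [cT'] and [cM] hidden in the choices of [T] and [M]. The bound
    [M <= cM * (l * k ^+ 5)] reflects the known size of [rhobar], and the polylogarithm is a power
    of the logarithm of a sum of all the data. *)
Theorem theorem3p4 (R : realType) :
  exists cT : R, 0 < cT /\ forall cT' cM : R, exists (cO : R) (p : nat),
  forall (dx dy : nat) (P : bilevel R dx dy) (x0 : 'rV[R]_dx)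
    (eps M rhobar lambda : R) (T N : nat)
    (x : nat -> 'rV[R]_dx) (w y : nat -> 'rV[R]_dy) (s : nat -> 'rV[R]_dx),
  let k := kappa P in
  let l := lbar P in
  let Delta := gap P x0 in
  let K := inner_steps P x0 lambda M eps (3 * k) s in
  (0 < dx)%N -> (0 < dy)%N ->
  standing_assumption P ->
  0 < eps -> 0 < Delta -> 0 < M ->
  lambda = Num.max (Num.max (l * k ^+ 2 / Delta) (l * k ^+ 3 / eps))
                   (l * k ^+ 5 / Num.sqrt (M * eps)) ->
  2 * ell P / mu P <= lambda ->
  lipschitz_for (@spectral_norm R _ _) rhobar (hess (Lstar P lambda)) ->
  rhobar <= M -> M <= cM * (l * k ^+ 5) ->
  cT * (Delta * Num.sqrt M * eps `^ (- (3 / 2))) <= T%:R ->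
  T%:R <= cT' * (Delta * Num.sqrt M * eps `^ (- (3 / 2))) ->
  fsba_run P x0 lambda M eps k (ell P) (3 * k) ((1 + lambda) * ell P)
    T K K N x w y s ->
  [/\ second_order_stationary (phi P) (cO * eps)
        (cO * (k `^ (5 / 2) * l `^ (1 / 2) * eps `^ (1 / 2))) (x N),
      (first_order_calls K K N)%:R <=
        cO * (Delta * k ^+ 3 * l `^ (1 / 2) * eps `^ (- (3 / 2)))
        * ln (2 + k + l + l^-1 + eps^-1 + Delta + Delta^-1
              + init_radius P lambda x0) ^+ p
    & (second_order_calls N)%:R <=
        cO * (Delta * k `^ (5 / 2) * l `^ (1 / 2) * eps `^ (- (3 / 2)))].
Proof.

exists 300; split=> // cT' cM.
(* [cT'] and [cM] are arbitrary reals; these majorants are at least 1. *)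
pose a := `|cT'| + 1; pose b := `|cM| + 1.
have a1 : 1 <= a by rewrite /a lerDr.
have b1 : 1 <= b by rewrite /b lerDr.
have a0 : 0 <= a by exact: le_trans a1.
have b0 : 0 <= b by exact: le_trans b1.
pose c := 3 * (6 + 4 * (8 * a + 46)) + 6.
have c0 : 0 <= c by rewrite /c; lra.
have ab0 : 0 <= a * b by exact: mulr_ge0.
(* The sum of the constants needed: [9] and [34 * b] for stationarity, [a * b * c] for first-order
   calls, [9 * (a * b)] for second-order calls. *)
pose cO := 9 + 34 * b + a * b * c + 9 * (a * b).
have abc0 : 0 <= a * b * c by exact: mulr_ge0.
exists cO, 1%N => dx dy P x0 eps M rhobar lam T N x w y s k l Delta K dx0 dy0 SA eps0 Delta0 M0
  lamE lam_ge lip rM Mle T_ge T_le run.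
have l0 : 0 < l := lbar_gt0 SA dy0.
have k1 : 1 <= k := kappa_ge1 SA dy0.
have k0 : 0 < k by exact: lt_le_trans k1.
have e32 : eps `^ (- (3 / 2)) = (Num.sqrt eps ^+ 3)^-1 by exact: powRN_half (ltW eps0).
have e12 : eps `^ (1 / 2) = Num.sqrt eps by rewrite mul1r powR12_sqrt// ltW.
have l12 : l `^ (1 / 2) = Num.sqrt l by rewrite mul1r powR12_sqrt// ltW.
have k52 : k `^ (5 / 2) = Num.sqrt k ^+ 5 by exact: powR_half (ltW k0).
rewrite e32 in T_ge T_le; rewrite e32 e12 l12 k52.
have sE : 0 < Num.sqrt eps by rewrite sqrtr_gt0.
have sM : 0 < Num.sqrt M by rewrite sqrtr_gt0.
have sl : 0 < Num.sqrt l by rewrite sqrtr_gt0.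
have sk : 0 < Num.sqrt k by rewrite sqrtr_gt0.
have sk2 : Num.sqrt k ^+ 2 = k by rewrite sqr_sqrtr// ltW.
set e3 := (Num.sqrt eps ^+ 3)^-1 in T_ge T_le *.
have e30 : 0 < e3 by rewrite invr_gt0 exprn_gt0.
have /andP[N0 NT] := run_length run.
pose W := Delta * Num.sqrt M * e3.
have W0 : 0 < W by rewrite !mulr_gt0.
have TW : T%:R <= a * W.
  apply: (le_trans T_le); rewrite ler_pM2r// /a.
  by have := ler_norm cT'; lra.
have T1 : 1 <= a * W.
  by apply: le_trans TW; rewrite ler1n (leq_trans N0).
have lam1 : l * k ^+ 2 / Delta <= lam by rewrite lamE !le_max lexx.
have lam2 : l * k ^+ 3 / eps <= lam by rewrite lamE !le_max lexx orbT.
have lam3 : l * k ^+ 5 / Num.sqrt (M * eps) <= lam by rewrite lamE !le_max lexx orbT.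
have sgE : sigma eps M = Num.sqrt eps / Num.sqrt M.
  by rewrite /sigma sqrtrM ?(ltW eps0)// sqrtrV// ltW.
have T_ge' : 300 * (Delta / (M * sigma eps M ^+ 3)) <= T%:R.
  apply: le_trans T_ge; rewrite le_eqVlt; apply/orP; left; apply/eqP; congr (_ * _).
  have EM : M = Num.sqrt M ^+ 2 by rewrite sqr_sqrtr// ltW.
  by rewrite sgE {1}EM /e3; field; rewrite !gt_eqF.
have small := last_step_small SA dy0 eps0 Delta0 M0 lam1 lam_ge lip rM run T_ge'.
have out := output_stationary SA dy0 eps0 M0 lam2 lam3 lam_ge lip rM run dx0 small.
(* Here [sqrt b <= b] since [b >= 1]; this inequality converts [sqrt M] into the powers of [k] and
   [l] of the conclusion. *)
have sMle : Num.sqrt M <= b * (Num.sqrt l * Num.sqrt k ^+ 5).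
  have h : M <= b * (l * k ^+ 5).
    have lk0 : 0 <= l * k ^+ 5 := mulr_ge0 (ltW l0) (exprn_ge0 5 (ltW k0)).
    apply: (le_trans Mle); rewrite ler_wpM2r//.
    by rewrite /b; have := ler_norm cM; lra.
  apply: (le_trans (ler_wsqrtr h)).
  rewrite sqrtrM// sqrtrM ?(ltW l0)// sqrtrX ?(ltW k0)// ler_wpM2r ?sqrtr_le_id//.
pose V := Delta * Num.sqrt k ^+ 5 * Num.sqrt l * e3.
have V0 : 0 <= V by rewrite !mulr_ge0 ?exprn_ge0 ?ltW.
have NV : N%:R <= a * b * V.
  apply: (@le_trans _ _ T%:R); first by rewrite ler_nat.
  apply: (le_trans TW); rewrite -mulrA ler_wpM2l// /W.
  have -> : b * V = Delta * (b * (Num.sqrt l * Num.sqrt k ^+ 5)) * e3 by rewrite /V; ring.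
  by rewrite ler_pM2r// ler_pM2l.
split.
- apply: second_order_stationaryW out.
    by rewrite ler_pM2r// /cO; move: (a * b * c) (a * b) abc0 ab0 => *; lra.
  have sMe : Num.sqrt (M * eps) = Num.sqrt M * Num.sqrt eps by rewrite sqrtrM// ltW.
  rewrite sMe.
  have -> : cO * (Num.sqrt k ^+ 5 * Num.sqrt l * Num.sqrt eps) =
    cO * (Num.sqrt l * Num.sqrt k ^+ 5) * Num.sqrt eps by ring.
  rewrite mulrA ler_pM2r//.
  apply: (@le_trans _ _ (34 * (b * (Num.sqrt l * Num.sqrt k ^+ 5)))).
    by rewrite ler_wpM2l.
  rewrite mulrA; apply: ler_wpM2r; first by rewrite mulr_ge0 ?exprn_ge0 ?sqrtr_ge0.
  by rewrite /cO; move: (a * b * c) (a * b) abc0 ab0 => *; lra.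
- pose X := 2 + k + l + l^-1 + eps^-1 + Delta + Delta^-1 + init_radius P lam x0.
  have sb t : (t.+1 < N)%N -> M * enorm (s t) ^+ 3 <= 36 * Delta.
    move=> tN; exact: (step_bound SA dy0 eps0 Delta0 M0 lam1 lam_ge lip rM run tN).
  have R0 : 0 <= init_radius P lam x0 by rewrite /init_radius le_max enorm_ge0.
  have li0 : 0 < l^-1 by rewrite invr_gt0.
  have ei0 : 0 < eps^-1 by rewrite invr_gt0.
  have Di0 : 0 < Delta^-1 by rewrite invr_gt0.
  have XB : [/\ 2 <= X, k <= X, l <= X & [/\ eps^-1 <= X, Delta <= X, Delta^-1 <= X &
      init_radius P lam x0 <= X]].
    by move: (l^-1) (eps^-1) (Delta^-1) li0 ei0 Di0 @X => ? ? ? ? ? ? X;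
      rewrite /X; split; [| | |split]; lra.
  have [X2 kX lX [eX DX DVX RX]] := XB.
  have := first_order_calls_le SA dy0 eps0 Delta0 M0 lamE lam_ge sb a1 T1 X2 kX lX eX DX DVX RX.
  rewrite -/c expr1 -/X => h; apply: (le_trans h).
  have lX0 : 0 <= ln X by have := ln_ge_half X2; lra.
  rewrite ler_wpM2r//.
  (* The [Num.sqrt k] of the inner loops raises [k^(5/2)] to [k^3]. *)
  have -> : cO * (Delta * k ^+ 3 * Num.sqrt l * e3) = V * Num.sqrt k * cO.
    by rewrite /V -[in LHS]sk2; ring.
  apply: (@le_trans _ _ (a * b * V * Num.sqrt k * c)).
    by rewrite ler_wpM2r// ler_pM2r.
  have -> : a * b * V * Num.sqrt k * c = V * Num.sqrt k * (a * b * c) by ring.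
  apply: ler_wpM2l; first by rewrite mulr_ge0 ?sqrtr_ge0.
  by rewrite /cO; move: (a * b * c) (a * b) abc0 ab0 => *; lra.
- have -> : (second_order_calls N)%:R = 9 * N%:R :> R.
    by rewrite /second_order_calls sum_nat_const card_ord natrM mulrC.
  apply: (@le_trans _ _ (9 * (a * b * V))); first by rewrite ler_wpM2l.
  rewrite mulrA ler_wpM2r//.
  by rewrite /cO; move: (a * b * c) (a * b) abc0 ab0 => *; lra.
Qed.
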